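(* For every integer $D \geq 1$, set $c_D := \frac{1}{64}\big(1 - \operatorname{sinc}(\pi/D)\big)$. For every integer $D\ge 1$ there exist constants $C_D > 0$ and $N_D \geq 3$, depending only on $D$, with the following property. Let $a : \mathbb{Z}[i] \setminus \{0\} \to \mathbb{C}$ be completely multiplicative, with $|a(n)| = 1$ for every $n \neq 0$, and suppose $\#\{a(p) : p \in \mathcal{P}_{\mathbb{Z}[i]}\} \leq D$. Then, for every $N \geq N_D$, $$\max_{\substack{h \in \mathbb{Z} \\ 1 \leq |h| \leq \lfloor(\log N)^2\rfloor}} \left|\mathop{\mathbb{E}}_{n \in B_N} a(n) e^{i h \arg(n)}\right| \leq C_D (\log N)^{-c_D}.$$
   Context: $\operatorname{sinc}(t) := \sin(t)/t$. $\mathcal{P}_{\mathbb{Z}[i]}$ is the set of all Gaussian prime elements, including all associates. $B_N$ is the set of nonzero Gaussian integers $n$ with $\mathcal{N}(n) := |n|^2 \leq N$ ($N\ge 1$ real). For a finite nonempty set $E$, $\mathop{\mathbb{E}}_{n \in E} f(n) := \frac{1}{|E|}\sum_{n \in E} f(n)$. Completely multiplicative means $a(mn) = a(m)a(n)$ for all nonzero $m, n \in \mathbb{Z}[i]$ (including units). *)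

(* Defs.v *)
From HB Require Import structures.
From mathcomp Require Import all_boot all_order all_algebra.
From mathcomp Require Import finmap.
From mathcomp Require Import all_classical all_reals all_analysis.
From mathcomp Require Export complex.
Set Implicit Arguments.
Unset Strict Implicit.
Unset Printing Implicit Defensive.
Import Order.TTheory GRing.Theory Num.Theory.
Local Open Scope classical_set_scope.
Local Open Scope ring_scope.
Local Open Scope complex_scope.

(* Otherwise Re and Im resolve to the projections of numClosedFieldType. *)
Local Notation Re := complex.Re.
Local Notation Im := complex.Im.

(* [complex.v] only makes [T[i]] a ring when T is a field, hence this alias
   of [int[i]], which carries the same operations. *)
Definition gaussInt : Type := int[i].

HB.instance Definition _ := Countable.copy gaussInt int[i].
HB.instance Definition _ := GRing.Zmodule.copy gaussInt int[i].

Lemma gaussInt_mul1 :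
  left_id (1 +i* 0 : gaussInt) (@ComplexField.mulc int : gaussInt -> _).
Proof. by case=> x y /=; rewrite !mul1r !mul0r subr0 addr0. Qed.

Lemma gaussInt_mulDl :
  left_distributive (@ComplexField.mulc int : gaussInt -> _) +%R.
Proof.
move=> [a b] [c d] [e f]; rewrite /GRing.add /= !mulrDl.
by congr (_ +i* _); rewrite ?opprD addrACA.
Qed.

Lemma gaussInt_oner_neq0 : (1 +i* 0 : gaussInt) != 0.
Proof. by []. Qed.

HB.instance Definition _ := GRing.Zmodule_isComNzRing.Build gaussInt
  (@ComplexField.mulcA int) (@ComplexField.mulcC int)
  gaussInt_mul1 gaussInt_mulDl gaussInt_oner_neq0.

Definition gnorm (n : gaussInt) : int := Re n ^+ 2 + Im n ^+ 2.

Definition gdvd (m n : gaussInt) : Prop := exists k : gaussInt, n = m * k.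

Definition gprime (p : gaussInt) : Prop :=
  [/\ p != 0, ~ gdvd p 1 &
      forall m n : gaussInt, gdvd p (m * n) -> gdvd p m \/ gdvd p n].

Definition completely_multiplicative (K : pzRingType) (a : gaussInt -> K) :=
  forall m n : gaussInt, m != 0 -> n != 0 -> a (m * n) = a m * a n.

Section Analysis.
Variable R : realType.
Implicit Types (z : R[i]) (t N : R).

(* The modulus of [complex.v], with values in R instead of R[i]. *)
Local Notation normc := (@ComplexField.Normc.normc R).

Definition gaussC (n : gaussInt) : R[i] := (Re n)%:~R +i* (Im n)%:~R.

Lemma gaussCM m n : gaussC (m * n) = gaussC m * gaussC n.
Proof.
case: m n => [a b] [c d]; rewrite /gaussC /GRing.mul /=.
by rewrite rmorphB rmorphD !rmorphM.
Qed.

Lemma gnormE n : (gnorm n)%:~R = normc (gaussC n) ^+ 2.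
Proof.
by rewrite /= sqr_sqrtr ?addr_ge0 ?sqr_ge0// rmorphD !rmorphXn.
Qed.

Definition gball N : set gaussInt :=
  [set n | n != 0 /\ (gnorm n)%:~R <= N].

(* At t = 0 this is 0, not the limit 1. *)
Definition sinc t : R := sin t / t.

(* The principal argument, in ]-pi, pi] for z != 0. *)
Definition carg z : R :=
  if 0 <= Im z then acos (Re z / normc z) else - acos (Re z / normc z).

Definition expi t : R[i] := cos t +i* sin t.

Lemma cargE z : z = (normc z)%:C * expi (carg z).
Proof.
have [->|z0] := eqVneq z 0.
  by rewrite ComplexField.Normc.normc0 /real_complex_def mul0r.
have n0 : normc z != 0.
  by apply: contra_neq z0; exact: ComplexField.Normc.eq0_normc.
case: z z0 n0 => x y _; rewrite /carg /expi.
set r := normc _ => r0.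
have r_gt0 : 0 < r by rewrite lt_neqAle eq_sym r0 sqrtr_ge0.
have rE : r ^+ 2 = x ^+ 2 + y ^+ 2 by rewrite sqr_sqrtr ?addr_ge0 ?sqr_ge0.
have u2 : (x / r) ^+ 2 + (y / r) ^+ 2 = 1.
  by rewrite !expr_div_n -mulrDl -rE divff// expf_neq0.
have u1 : -1 <= x / r <= 1.
  rewrite -ler_norml -(@ler_pXn2r _ 2)// ?nnegrE// expr1n real_normK ?num_real//.
  by rewrite -u2 lerDl sqr_ge0.
have yE : Num.sqrt (1 - (x / r) ^+ 2) = `|y| / r.
  rewrite -u2 addrC addKr sqrtr_sqr normrM normfV.
  by rewrite (gtr0_norm r_gt0).
rewrite /GRing.mul /= !mul0r subr0 addr0.
have [y0|y0] := leP 0 y; rewrite ?cosN ?sinN acosK ?in_itv// sin_acos// yE.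
  by rewrite (ger0_norm y0) !(mulrC r) !divfK.
by rewrite (ltr0_norm y0) mulNr opprK !(mulrC r) !divfK.
Qed.

Lemma carg_bound z : z != 0 -> - pi < carg z <= pi.
Proof.
move=> z0.
have n0 : normc z != 0.
  by apply: contra_neq z0; exact: ComplexField.Normc.eq0_normc.
case: z z0 n0 => x y _; rewrite /carg; set r := normc _ => r0 /=.
have r_gt0 : 0 < r by rewrite lt_neqAle eq_sym r0 sqrtr_ge0.
have rE : r ^+ 2 = x ^+ 2 + y ^+ 2 by rewrite sqr_sqrtr ?addr_ge0 ?sqr_ge0.
have u2 : (x / r) ^+ 2 + (y / r) ^+ 2 = 1.
  by rewrite !expr_div_n -mulrDl -rE divff// expf_neq0.
have u1 : -1 <= x / r <= 1.
  rewrite -ler_norml -(@ler_pXn2r _ 2)// ?nnegrE// expr1n real_normK ?num_real//.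
  by rewrite -u2 lerDl sqr_ge0.
have a0 := acos_ge0 u1; have api := acos_lepi u1.
have pi0 := pi_gt0 R.
have [y0|y0] := leP 0 y.
  by rewrite api andbT (lt_le_trans _ a0)// oppr_lt0.
rewrite ltrN2 (le_trans _ (ltW pi0)) ?oppr_le0// andbT.
rewrite lt_neqAle api andbT; apply/eqP => e.
have := acosK u1; rewrite e cospi => e1.
have : (y / r) ^+ 2 = 0.
  by apply: (addrI ((x / r) ^+ 2)); rewrite u2 -e1 sqrrN expr1n addr0.
by move/eqP; rewrite sqrf_eq0 mulf_eq0 invr_eq0 (lt_eqF y0) (negbTE r0).
Qed.

(* [fset_set E] is empty when E is infinite, so this is only meaningful on
   finite sets; see [finite_gball]. *)
Definition average (T : choiceType) (E : set T) (f : T -> R[i]) : R[i] :=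
  (#|` fset_set E|%:R)^-1 * \sum_(n <- fset_set E) f n.

Definition freqs (M : int) : set int := [set h | 1 <= `|h| <= M].

Lemma finite_int_norm (M : int) : finite_set [set h : int | `|h| <= M].
Proof.
apply: (@sub_finite_set _ _ ((Posz @` `I_(`|M|%N).+1) `|`
                            ((fun k => - Posz k) @` `I_(`|M|%N).+1))).
  move=> h /= hM.
  have k : (`|h|%N < (`|M|%N).+1)%N.
    by rewrite ltnS -lez_nat !abszE (le_trans hM) ?ler_norm.
  have [h0|h0] := leP 0 h.
    by left; exists `|h|%N => //; rewrite abszE ger0_norm.
  by right; exists `|h|%N => //; rewrite abszE ltr0_norm// opprK.
by rewrite finite_setU; split; apply: finite_image; exact: finite_II.
Qed.

Lemma finite_freqs (M : int) : finite_set (freqs M).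
Proof.
by apply: sub_finite_set (finite_int_norm M) => h /= /andP[].
Qed.

Lemma finite_gball N : finite_set (gball N).
Proof.
pose M := Num.floor N; pose B := [set h : int | `|h| <= M].
apply: (@sub_finite_set _ _ ((fun u => u.1 +i* u.2 : gaussInt) @` (B `*` B))).
  have bnd (x y : int) : x ^+ 2 + y ^+ 2 <= M -> `|x| <= M.
    move=> xyM; apply: le_trans xyM.
    have : `|x| <= x ^+ 2.
      rewrite -[leRHS]real_normK ?num_real// -abszE.
      by case: `|x|%N => // k; rewrite expr2 ler_peMr.
    by move/le_trans; apply; rewrite lerDl sqr_ge0.
  move=> [x y] [_]; rewrite -floor_ge_int => xyM.
  exists (x, y) => //; split => /=; first exact: bnd xyM.
  by apply: (bnd _ x); rewrite addrC.
by apply: finite_image; apply: finite_setX; exact: finite_int_norm.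
Qed.

Definition decay_exponent (D : nat) : R := 64^-1 * (1 - sinc (pi / D%:R)).

End Analysis.

(* Main.v *)
(* Put f n = a n * (n / |n|)^h and let S K be the sum of f over the nonzero n of norm at
   most K. If f takes a value other than 1 at i, then S K = 0 by rotation. Otherwise
   ln = 1 * Lambda gives, for s K = S K / K,
     ln K * s K = sum_(N p <= K) ln (N p) / N p * f p * s (K / N p) + O(1).
   Since a takes at most D values z on primes, Re (z v) is at most 1 - 2 / n^2 plus a
   multiple of a sum of Fejer kernels at the points z v, where |v| = 1 and n = 2 D + 1.
   The constant term of this trigonometric polynomial is small. Its other harmonics lead
   to sums of ln (N p) / N p * (p / |p|)^(h k) * w (ln (N p)) with w Lipschitz, because s
   varies slowly on the logarithmic scale. They are negligible: Jackson's kernel expands w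
   in few frequencies t, and the sums of ln (N p) / N p * (p / |p|)^m * N(p)^(i t) are
   O((ln (m (1 + |t|)))^9). The last bound needs no continuation of L-functions: counting
   lattice points gives power-saving cancellation in the sums of (n / |n|)^m * N(n)^(i t)
   over all n, and the 3-4-1 inequality slightly to the right of 1 bounds the Dirichlet
   series at 1 from below.
   Hence ln K * |s K| <= (1 - mu) * sum_p ln (N p) / N p * |s (K / N p)| + small, with
   mu = 1 / (18 D^2), and with Mertens' theorem this gives by induction
   |s K| <= 2 (V / (V + ln K))^c for c = 1 / (20 D^2) and V = (ln N)^(1/10), up to a
   constant factor. Finally 9 c / 10 exceeds the required exponent since
   1 - sinc (pi / D) <= pi^2 / (6 D^2) and pi <= 4. *)
Require Import Defs.
From mathcomp Require Import all_boot all_order all_algebra.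
From mathcomp Require Import finmap.
From mathcomp Require Import all_classical all_reals all_analysis.
From mathcomp Require Import complex.
From mathcomp Require Import ring lra zify.
Set Implicit Arguments.
Unset Strict Implicit.
Unset Printing Implicit Defensive.
Import Order.TTheory GRing.Theory Num.Theory.
Local Open Scope classical_set_scope.
Local Open Scope card_scope.
Local Open Scope ring_scope.
Local Open Scope complex_scope.
Local Notation Re := complex.Re.
Local Notation Im := complex.Im.
(* [gnorm] is also a rewrite rule of [monoid.v]. *)
Local Notation gnorm := Defs.gnorm.
Import numFieldNormedType.Exports.

(** * Gaussian integers *)

(** The obstacle is alignment: absolute values in the recursion alone give no decay, so the phase of
    [f p * s (K / N p)] has to differ from that of [s K] for many primes. Since [a p] is one of at
    most D numbers, this becomes a statement about the angles of primes against the phase of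
    [s (K / N p)]. That phase is not Lipschitz near zeros of [s], so each harmonic keeps the modulus
    of [s] as a factor ([argpow]). The exponents are best read with ln K = X^5. A Jackson kernel
    with q of size X^3 makes its Fourier cost q times a power of ln X, and its approximation error
    X^5 * X^5 / q^2, both O(X^4). One step of the recursion thus loses O(X^4) and gains a multiple
    of X^5 * |s|; the loss is absorbed as long as the target bound stays above X^(-1/2), which c <=
    1/20 ensures. The frequency h may be as large as (ln N)^2, whereas the induction starts where ln
    K is about V = (ln N)^(1/10). Hence h is only known to be at most V^20 <= X^100; this is
    harmless because the conductor enters through its logarithm. *)

Definition gn (n : gaussInt) : nat := `|gnorm n|%N.

Arguments gn n%_R.

Definition gI : gaussInt := 0 +i* 1.

Definition gconj (n : gaussInt) : gaussInt := Re n +i* - Im n.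

Lemma gmulE (a b c d : int) :
  (a +i* b : gaussInt) * (c +i* d) = (a * c - b * d) +i* (a * d + b * c).
Proof. by []. Qed.

Lemma gaddE (a b c d : int) :
  (a +i* b : gaussInt) + (c +i* d) = (a + c) +i* (b + d).
Proof. by []. Qed.

Lemma goppE (a b : int) : - (a +i* b : gaussInt) = (- a) +i* (- b).
Proof. by []. Qed.

Lemma gnE n : (gn n)%:Z = gnorm n.
Proof. by rewrite /gn gez0_abs// addr_ge0// sqr_ge0. Qed.

Lemma gnormM m n : gnorm (m * n) = gnorm m * gnorm n.
Proof. by case: m n => [a b] [c d]; rewrite /gnorm gmulE /=; ring. Qed.

Lemma gnM m n : gn (m * n) = (gn m * gn n)%N.
Proof. by rewrite /gn gnormM abszM. Qed.

Lemma gn1 : gn 1 = 1%N. Proof. by []. Qed.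

Lemma gn0 : gn 0 = 0%N. Proof. by []. Qed.

Lemma gnX n k : gn (n ^+ k) = (gn n ^ k)%N.
Proof. by elim: k => // k IH; rewrite exprS gnM IH expnS. Qed.

Lemma gn_eq0 n : (gn n == 0)%N = (n == 0).
Proof.
rewrite /gn absz_eq0 /gnorm; case: n => a b /=.
rewrite paddr_eq0 ?sqr_ge0// !sqrf_eq0.
by apply/andP/eqP => [[/eqP -> /eqP ->]//|[-> ->]].
Qed.

Lemma gn_gt0 n : (0 < gn n)%N = (n != 0).
Proof. by rewrite lt0n gn_eq0. Qed.

Lemma gmulf_eq0 (m n : gaussInt) : (m * n == 0) = (m == 0) || (n == 0).
Proof. by rewrite -!gn_eq0 gnM muln_eq0. Qed.

Lemma gmulfI (m n k : gaussInt) : m != 0 -> m * n = m * k -> n = k.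
Proof.
move=> m0 e; apply/eqP; rewrite -subr_eq0.
have : m * (n - k) == 0 by rewrite mulrBr e subrr.
by rewrite gmulf_eq0 (negbTE m0).
Qed.

Lemma gexpf_neq0 (m : gaussInt) k : m != 0 -> m ^+ k != 0.
Proof. by rewrite -!gn_gt0 gnX expn_gt0 => ->. Qed.

Lemma gmul_conj n : n * gconj n = gnorm n +i* 0.
Proof.
by case: n => a b; rewrite /gconj /gnorm gmulE /=; congr (_ +i* _); ring.
Qed.

Lemma gnorm_conj n : gnorm (gconj n) = gnorm n.
Proof. by rewrite /gnorm /gconj /= sqrrN. Qed.

Lemma nearest_quot (x k : int) : 0 < k -> exists q : int, 2 * `|x - k * q| <= k.
Proof.
move=> k0; exists ((2 * x + k) %/ (2 * k))%Z.
have := divz_eq (2 * x + k) (2 * k).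
have := modz_ge0 (2 * x + k) (_ : 2 * k != 0).
have := ltz_pmod (2 * x + k) (_ : 0 < 2 * k).
move: (_ %/ _)%Z (_ %% _)%Z => q r; lia.
Qed.

Lemma gauss_euclid (a b : gaussInt) :
  b != 0 -> exists q, (gn (a - b * q)%R < gn b)%N.
Proof.
move=> b0.
have k0 : 0 < gnorm b by rewrite -gnE; move: b0; rewrite -gn_gt0; lia.
have [q1 h1] := nearest_quot (Re (a * gconj b)) k0.
have [q2 h2] := nearest_quot (Im (a * gconj b)) k0.
exists (q1 +i* q2).
suff : gnorm (a - b * (q1 +i* q2)) < gnorm b by rewrite -!gnE; lia.
(* After multiplication by the conjugate of [b], both coordinates of the remainder are at most k / 2
   in absolute value for k = [gnorm b], so its norm is at most k^2 / 2 < k^2. *)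
rewrite -(ltr_pM2r k0) -{1}(gnorm_conj b) -gnormM mulrBl.
rewrite (mulrC b) -mulrA gmul_conj gmulE.
move: (gnorm b) k0 h1 h2 => k k0.
case: (a * gconj b) => x y /=; rewrite goppE gaddE /gnorm /=.
rewrite !mulr0 subr0 add0r !(mulrC _ k).
set u := x - k * q1; set v := y - k * q2 => hu hv.
have := real_normK (num_real u); have := real_normK (num_real v).
have := normr_ge0 u; have := normr_ge0 v.
move: `|u| `|v| hu hv => s t hs ht t0 s0 <- <-.
have : 4 * s ^+ 2 <= k ^+ 2 by nia.
have : 4 * t ^+ 2 <= k ^+ 2 by nia.
nia.
Qed.

Lemma gdvd_refl n : gdvd n n. Proof. by exists 1; rewrite mulr1. Qed.

Lemma gdvd_trans m n k : gdvd m n -> gdvd n k -> gdvd m k.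
Proof. by move=> [x ->] [y ->]; exists (x * y); rewrite mulrA. Qed.

Lemma gdvd_mulr m n k : gdvd m n -> gdvd m (n * k).
Proof. by move=> [x ->]; exists (x * k); rewrite mulrA. Qed.

Lemma gdvd_mull m n k : gdvd m n -> gdvd m (k * n).
Proof. by rewrite mulrC; apply: gdvd_mulr. Qed.

Lemma gdvd_gn m n : gdvd m n -> (gn m %| gn n)%N.
Proof. by move=> [x ->]; rewrite gnM dvdn_mulr. Qed.

Lemma gdvd_leq m n : n != 0 -> gdvd m n -> (gn m <= gn n)%N.
Proof. by rewrite -gn_gt0 => n0 /gdvd_gn; apply: dvdn_leq. Qed.

Lemma gdvd_pmul2l m n k : m != 0 -> gdvd (m * n) (m * k) <-> gdvd n k.
Proof.
move=> m0; split=> -[x e]; exists x; last by rewrite e mulrA.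
by apply: (gmulfI m0); rewrite e mulrA.
Qed.

Lemma gn1_unit u : gn u = 1%N -> u * gconj u = 1.
Proof. by rewrite gmul_conj -gnE => ->. Qed.

Lemma gdvd1 n : gdvd n 1 <-> gn n = 1%N.
Proof.
split; last by move/gn1_unit => e; exists (gconj n).
by move/gdvd_gn; rewrite gn1 dvdn1 => /eqP.
Qed.

Lemma gn1_exp u : gn u = 1%N -> exists2 k, (k < 4)%N & u = gI ^+ k.
Proof.
case: u => a b /(congr1 Posz); rewrite gnE /gnorm /= => h.
have : [\/ a = 1 /\ b = 0, a = 0 /\ b = 1, a = - 1 /\ b = 0 | a = 0 /\ b = - 1].
  have : (a = 1 \/ a = 0 \/ a = -1) by nia.
  case=> [e|[e|e]]; subst a.
  - by have -> : b = 0; [nia|apply: Or41].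
  - have : b = 1 \/ b = - 1 by nia.
    by case=> ->; [apply: Or42|apply: Or44].
  - by have -> : b = 0; [nia|apply: Or43].
by case=> -[-> ->]; [exists 0%N|exists 1%N|exists 2%N|exists 3%N].
Qed.

Lemma gprime_gn p : gprime p -> (1 < gn p)%N.
Proof.
case=> p0 p1 _; have : (0 < gn p)%N by rewrite gn_gt0.
have : gn p <> 1%N by move=> e; apply: p1; apply/gdvd1.
by lia.
Qed.

Lemma gprime_neq0 p : gprime p -> p != 0. Proof. by case. Qed.

(** Bezout argument: an element [d] of least norm in the ideal generated by [p] and [m] divides
    both. If [d] is a unit, then [p] divides [n]; if [d] is an associate of [p], then [p] divides
    [m]. *)
Lemma irreducible_gprime p : (1 < gn p)%N ->
  (forall d, gdvd d p -> gn d = 1%N \/ gn d = gn p) -> gprime p.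
Proof.
move=> p1 irr.
have p0 : p != 0 by rewrite -gn_gt0; lia.
split=> // [/gdvd1|m n pmn]; first by lia.
have [pm|pm] := pselect (gdvd p m); [by left|right].
pose Q k := `[< exists x y, p * x + m * y != 0 /\ gn (p * x + m * y) = k >].
have exQ : exists k, Q k.
  by exists (gn p); apply/asboolP; exists 1, 0; rewrite mulr0 addr0 mulr1.
have /asboolP[x [y [d0 dk]]] := xchooseP exQ.
case: (ex_minnP exQ) => k /asboolP[{}x [{}y [{}d0 {}dk]]] kmin.
set d := p * x + m * y in d0 dk.
have dvd_comb u v : gdvd d (p * u + m * v).
  have [q hq] := gauss_euclid (p * u + m * v) d0.
  have [e|ne] := eqVneq (p * u + m * v - d * q) 0.
    by exists q; apply/eqP; rewrite -subr_eq0 e.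
  have : (k <= gn (p * u + m * v - d * q))%N.
    apply: kmin; apply/asboolP; exists (u - x * q), (v - y * q).
    by have -> : p * (u - x * q) + m * (v - y * q) = p * u + m * v - d * q
      by rewrite /d; ring.
  by rewrite leqNgt -dk hq.
have dp : gdvd d p by have := dvd_comb 1 0; rewrite mulr1 mulr0 addr0.
have dm : gdvd d m by have := dvd_comb 0 1; rewrite mulr1 mulr0 add0r.
case: (irr d dp) => [/gn1_unit du|dgp].
  case: pmn => z hz; exists (x * gconj d * n + z * y * gconj d).
  rewrite -[LHS]mulr1 -du /d.
  transitivity (p * x * gconj d * n + m * n * y * gconj d); first by rewrite -/d /d; ring.
  by rewrite hz; ring.
case: dp => u pu.
have u1 : gn u = 1%N.
  have : (gn d * 1 = gn d * gn u)%N by rewrite -gnM -pu muln1.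
  by move/eqP; rewrite eqn_mul2l gn_eq0 (negbTE d0) => /eqP.
case: pm; apply: gdvd_trans dm; exists (gconj u).
by rewrite pu -mulrA gn1_unit// mulr1.
Qed.

Lemma gprime_divisor n : (1 < gn n)%N -> exists2 p, gprime p & gdvd p n.
Proof.
have [k] := ubnP (gn n); elim: k n => // k IH n nk n1.
have [irr|] := pselect (forall d, gdvd d n -> gn d = 1%N \/ gn d = gn n).
  by exists n; [exact: irreducible_gprime|exact: gdvd_refl].
move/existsNP => [d /not_implyP[dn /not_orP[d1 dnn]]].
have n0 : n != 0 by rewrite -gn_gt0; lia.
have dle := gdvd_leq n0 dn.
have d0 : d != 0.
  by case: dn => x e; apply: contra_neq n0 => d0; rewrite e d0 mul0r.
have dg : (0 < gn d)%N by rewrite gn_gt0.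
have [||p pp pd] := IH d; [lia|lia|].
by exists p => //; apply: gdvd_trans dn.
Qed.

(** A fundamental domain for multiplication by units: half-open, so that every nonzero element has
    exactly one associate in it. *)
Definition quad (n : gaussInt) : bool := (0 < Re n) && (0 <= Im n).

Lemma gmulIE n : gI * n = (- Im n) +i* Re n.
Proof. by case: n => a b; rewrite /gI gmulE /=; congr (_ +i* _); ring. Qed.

Lemma gI2 : gI ^+ 2 = -1. Proof. by []. Qed.
Lemma gI4 : gI ^+ 4 = 1. Proof. by []. Qed.
Lemma gnI : gn gI = 1%N. Proof. by []. Qed.

Lemma gIX_neq0 k : gI ^+ k != 0. Proof. exact: gexpf_neq0. Qed.

Lemma quad_rot n : n != 0 -> exists2 k, (k < 4)%N & quad (gI ^+ k * n).
Proof.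
case: n => a b; rewrite -gn_eq0 -(eqr_nat int) => h.
have {}h : a != 0 \/ b != 0.
  have [a0|] := eqVneq a 0; [right|by left].
  by apply: contra h => /eqP b0; rewrite a0 b0.
have [k0|k0] := ltP 0 a; have [l0|l0] := leP 0 b.
- by exists 0%N => //; rewrite mul1r /quad /=; lia.
- by exists 1%N => //; rewrite expr1 gmulIE /quad /=; lia.
- have [e|ne] := eqVneq b 0.
    by exists 2%N => //; rewrite exprS expr1 -mulrA !gmulIE /quad /=; lia.
  by exists 3%N => //; rewrite !exprS expr0 mulr1 -!mulrA !gmulIE /quad /=; lia.
- have [e|ne] := eqVneq a 0.
    by exists 1%N => //; rewrite expr1 gmulIE /quad /=; lia.
  by exists 2%N => //; rewrite exprS expr1 -mulrA !gmulIE /quad /=; lia.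
Qed.

Lemma quad_uniq n k : (k < 4)%N -> quad n -> quad (gI ^+ k * n) -> k = 0%N.
Proof.
case: n => a b; case: k => [|[|[|[|]]]]//= _; rewrite ?exprS expr0 ?mulr1 -?mulrA ?gmulIE /quad /=; lia.
Qed.

(** One prime per class of associates, so that factorizations and sums over primes count each prime
    once. *)
Definition cprime (p : gaussInt) : bool := `[< gprime p >] && quad p.

Lemma cprime_gprime p : cprime p -> gprime p.
Proof. by case/andP => /asboolP. Qed.

Lemma gprime_rot p k : gprime p -> gprime (gI ^+ k * p).
Proof.
case=> p0 p1 pp.
have d x : gdvd (gI ^+ k * p) x <-> gdvd p x.
  split; first by apply: gdvd_trans; apply: gdvd_mull; exact: gdvd_refl.
  case=> y ->; exists (gI ^+ (3 * k) * y).
  have e : gI ^+ k * gI ^+ (3 * k) = 1.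
    by rewrite -exprD -[X in (X + _)%N]mul1n -mulnDl exprM gI4 expr1n.
  by rewrite mulrACA e mul1r.
split; first by rewrite gmulf_eq0 negb_or gIX_neq0.
  by rewrite d.
by move=> m n; rewrite !d; exact: pp.
Qed.

Lemma gprime_cprime p : gprime p ->
  exists q, [/\ cprime q, gdvd q p & exists2 k, (k < 4)%N & q = gI ^+ k * p].
Proof.
move=> pp; have [k k4 qk] := quad_rot (gprime_neq0 pp).
exists (gI ^+ k * p); split; last by exists k.
  by rewrite /cprime qk andbT; apply/asboolP/gprime_rot.
exists (gI ^+ (3 * k)).
rewrite mulrAC -exprD -[X in (X + _)%N]mul1n -mulnDl exprM gI4 expr1n mul1r//.
Qed.

Lemma cprime_divisor n : (1 < gn n)%N -> exists2 p, cprime p & gdvd p n.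
Proof.
case/gprime_divisor => p /gprime_cprime[q [cq qp _]] pn.
by exists q => //; apply: gdvd_trans pn.
Qed.

Lemma cprime_dvd_eq p q : cprime p -> cprime q -> gdvd p q -> p = q.
Proof.
move=> cp cq [k qk].
have [p0 p1 pp] := cprime_gprime cp; have [q0 q1 qq] := cprime_gprime cq.
have : gdvd q (p * k) by rewrite -qk; exact: gdvd_refl.
case/qq => [[l pl] | [l kl]].
  have kl : l * k = 1 by apply: (gmulfI q0); rewrite mulr1 mulrA -pl.
  have : gn k = 1%N by apply/gdvd1; exists l; rewrite mulrC.
  case/gn1_exp => j j4 kj.
  have : j = 0%N.
    apply: (quad_uniq j4 (n := p)); first by case/andP: cp.
    by rewrite mulrC -kj -qk; case/andP: cq.
  by move=> j0; rewrite qk kj j0 expr0 mulr1.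
case: p1; exists l; apply: (gmulfI q0); rewrite mulr1 mulrCA -kl [LHS]qk; ring.
Qed.

Lemma cprime_ndvd p q : cprime p -> cprime q -> p != q -> ~ gdvd p q.
Proof. by move=> cp cq /eqP pq /(cprime_dvd_eq cp cq). Qed.

Lemma gprime_exp_dvd p q m j : gprime p -> ~ gdvd p q ->
  gdvd (p ^+ j) (q * m) <-> gdvd (p ^+ j) m.
Proof.
move=> pp pq; split; last exact: gdvd_mull.
elim: j m => [|j IH] m; first by move=> _; exists m; rewrite mul1r.
move=> h; have pm : gdvd p m.
  have : gdvd p (q * m).
    by apply: gdvd_trans h; rewrite exprS; apply: gdvd_mulr; exact: gdvd_refl.
  by case: pp => _ _ pp /pp[].
case: pm h => m' ->; rewrite mulrCA exprS !gdvd_pmul2l ?gprime_neq0//.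
exact: IH.
Qed.

(** * Finite lists of Gaussian integers *)

Definition irange (k : nat) : seq int := [seq i%:Z - k%:Z | i <- iota 0 (k.*2.+1)].

Definition box (k : nat) : seq gaussInt :=
  [seq (a +i* b : gaussInt) | a <- irange k, b <- irange k].

Definition shell (k : nat) : seq gaussInt := [seq n <- box k | gn n == k].

(** Listed by shells of equal norm, so that partial summation over the norm applies; the list starts
    at norm 1 and therefore omits 0. *)
Definition gnball (K : nat) : seq gaussInt := flatten [seq shell k | k <- iota 1 K].

Arguments irange : simpl never.
Arguments box : simpl never.
Arguments shell : simpl never.
Arguments gnball : simpl never.

Lemma mem_irange k (a : int) : (a \in irange k) = (`|a| <= k%:Z).
Proof.
apply/mapP/idP => [[j] | h]; first by rewrite mem_iota; lia.
by exists (absz (a + k%:Z)); rewrite ?mem_iota; lia.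
Qed.

Lemma irange_uniq k : uniq (irange k).
Proof. by rewrite map_inj_uniq ?iota_uniq// => i j; lia. Qed.

Lemma mem_box k n : (n \in box k) = (`|Re n| <= k%:Z) && (`|Im n| <= k%:Z).
Proof.
apply/allpairsP/idP => [[[a b] /= [ha hb ->]] | ].
  by rewrite /= -!mem_irange ha.
by case: n => a b /=; rewrite -!mem_irange => /andP[ha hb]; exists (a, b).
Qed.

Lemma box_uniq k : uniq (box k).
Proof.
apply: allpairs_uniq; rewrite ?irange_uniq//.
by move=> [a b] [c d] _ _ /= [-> ->].
Qed.

Lemma gn_coord n : (`|Re n| <= (gn n)%:Z) && (`|Im n| <= (gn n)%:Z).
Proof.
rewrite gnE /gnorm; move: (Re n) (Im n) => a b.
have := real_normK (num_real a); have := real_normK (num_real b).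
have := normr_ge0 a; have := normr_ge0 b.
by move: `|a| `|b| => s t *; apply/andP; split; nia.
Qed.

Lemma mem_shell k n : (n \in shell k) = (gn n == k).
Proof.
rewrite mem_filter mem_box; have [<-|//] := eqVneq (gn n) k.
by rewrite gn_coord.
Qed.

Lemma shell_uniq k : uniq (shell k).
Proof. exact/filter_uniq/box_uniq. Qed.

Lemma mem_gnball K n : (n \in gnball K) = (0 < gn n <= K)%N.
Proof.
apply/flatten_mapP/idP => [[k] | h]; rewrite ?mem_iota ?mem_shell.
  by move=> hk /eqP ->; lia.
by exists (gn n); rewrite ?mem_iota ?mem_shell//; lia.
Qed.

Lemma gnball_recr K : gnball K.+1 = gnball K ++ shell K.+1.
Proof. by rewrite /gnball -(addn1 K) iotaD map_cat flatten_cat /= cats0 add1n addn1. Qed.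

Lemma gnball_uniq K : uniq (gnball K).
Proof.
elim: K => // K IH; rewrite gnball_recr cat_uniq IH shell_uniq andbT /=.
by apply/hasPn => n; rewrite mem_shell mem_gnball => /eqP ->; lia.
Qed.

Lemma big_gnball (V : nmodType) K (P : pred gaussInt) (F : gaussInt -> V) :
  \sum_(n <- gnball K | P n) F n =
  \sum_(1 <= k < K.+1) \sum_(n <- shell k | P n) F n.
Proof. by rewrite big_flatten /= big_map /index_iota subSS subn0. Qed.

Lemma gnball_widen (V : nmodType) K L (P : pred gaussInt) (F : gaussInt -> V) :
  (K <= L)%N ->
  \sum_(n <- gnball K | P n) F n = \sum_(n <- gnball L | P n && (gn n <= K)%N) F n.
Proof.
move=> KL; rewrite -[LHS]big_filter -[RHS]big_filter; apply: perm_big.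
apply: uniq_perm; rewrite ?filter_uniq ?gnball_uniq// => n.
by rewrite !mem_filter !mem_gnball -andbA; case: (P n) => //=; lia.
Qed.

(** * Complex modulus and elementary trigonometry *)

Local Notation nc := (@ComplexField.Normc.normc _).

Section ComplexModulus.
Variable R : realType.
Implicit Types (z w : R[i]) (a b t : R).

Lemma nc_ge0 z : 0 <= nc z.
Proof. by case: z => a b /=; exact: sqrtr_ge0. Qed.

Lemma ncE z : nc z ^+ 2 = Re z ^+ 2 + Im z ^+ 2.
Proof. by case: z => a b /=; rewrite sqr_sqrtr// addr_ge0// sqr_ge0. Qed.

Lemma nc0 : nc (0 : R[i]) = 0. Proof. exact: ComplexField.Normc.normc0. Qed.

Lemma nc1 : nc (1 : R[i]) = 1. Proof. exact: ComplexField.Normc.normc1. Qed.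

Lemma nc_eq0 z : (nc z == 0) = (z == 0).
Proof.
by apply/eqP/eqP => [|->]; [exact: ComplexField.Normc.eq0_normc|exact: nc0].
Qed.

Lemma nc_gt0 z : (0 < nc z) = (z != 0).
Proof. by rewrite lt_neqAle eq_sym nc_eq0 nc_ge0 andbT. Qed.

Lemma ncM z w : nc (z * w) = nc z * nc w.
Proof. exact: ComplexField.Normc.normcM. Qed.

Lemma ncV z : nc z^-1 = (nc z)^-1.
Proof. exact: ComplexField.Normc.normcV. Qed.

Lemma ncX z n : nc (z ^+ n) = nc z ^+ n.
Proof. by elim: n => [|n IH]; rewrite ?expr0 ?nc1// !exprS ncM IH. Qed.

Lemma ncN z : nc (- z) = nc z.
Proof. by case: z => a b /=; rewrite !sqrrN. Qed.

Lemma ncD z w : nc (z + w) <= nc z + nc w.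
Proof. exact: (@le_normcD R z w). Qed.

Lemma ncB z w : nc (z - w) <= nc z + nc w.
Proof. by rewrite -(ncN w) ncD. Qed.

Lemma nc_subC z w : nc (z - w) = nc (w - z).
Proof. by rewrite -ncN opprB. Qed.

Lemma nc_sub_trans w z v : nc (z - v) <= nc (z - w) + nc (w - v).
Proof.
by have -> : z - v = (z - w) + (w - v); [ring|exact: ncD].
Qed.

Lemma nc_le_sub z w : nc z <= nc w + nc (z - w).
Proof. by have -> : nc z = nc (w + (z - w)); [congr nc; ring|exact: ncD]. Qed.

Lemma nc_dist z w : `|nc z - nc w| <= nc (z - w).
Proof.
rewrite ler_norml; have := nc_le_sub z w; have := nc_le_sub w z.
by rewrite (nc_subC w z) => *; apply/andP; split; lra.
Qed.

Lemma nc_sum (I : Type) (r : seq I) (P : pred I) (F : I -> R[i]) :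
  nc (\sum_(i <- r | P i) F i) <= \sum_(i <- r | P i) nc (F i).
Proof.
elim/big_rec2: _ => [|i y x _ h]; first by rewrite nc0.
by apply: le_trans (ncD _ _) _; rewrite lerD2l.
Qed.

Lemma nc_real a : nc (a%:C : R[i]) = `|a|.
Proof. by rewrite /= expr0n /= addr0 sqrtr_sqr. Qed.

Lemma nc_nat n : nc (n%:R : R[i]) = n%:R.
Proof. by rewrite -(rmorph_nat (real_complex R)) nc_real normr_nat. Qed.

Lemma Re_le_nc z : `|Re z| <= nc z.
Proof.
rewrite -(@ler_pXn2r _ 2)// ?nnegrE ?nc_ge0// ncE real_normK ?num_real//.
by rewrite lerDl sqr_ge0.
Qed.

Lemma Im_le_nc z : `|Im z| <= nc z.
Proof.
rewrite -(@ler_pXn2r _ 2)// ?nnegrE ?nc_ge0// ncE real_normK ?num_real//.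
by rewrite lerDr sqr_ge0.
Qed.

Lemma ReD z w : Re (z + w) = Re z + Re w. Proof. by case: z; case: w. Qed.
Lemma ImD z w : Im (z + w) = Im z + Im w. Proof. by case: z; case: w. Qed.
Lemma ReM z w : Re (z * w) = Re z * Re w - Im z * Im w.
Proof. by case: z; case: w. Qed.
Lemma ImM z w : Im (z * w) = Re z * Im w + Im z * Re w.
Proof. by case: z => ? ?; case: w. Qed.
Lemma ReZ a z : Re (a%:C * z) = a * Re z.
Proof. by rewrite ReM /= mul0r subr0. Qed.
Lemma ImZ a z : Im (a%:C * z) = a * Im z.
Proof. by rewrite ImM /= mul0r addr0. Qed.

Lemma Re_sum (I : Type) (r : seq I) (P : pred I) (F : I -> R[i]) :
  Re (\sum_(i <- r | P i) F i) = \sum_(i <- r | P i) Re (F i).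
Proof. by elim/big_rec2: _ => // i y x _ <-; exact: ReD. Qed.

Lemma nc_conj z : nc z^*%C = nc z.
Proof. by case: z => a b /=; rewrite sqrrN. Qed.

Lemma mul_conj z : z * z^*%C = (nc z ^+ 2)%:C.
Proof. by apply/eqP; rewrite eq_complex ncE; case: z => a b /=; apply/andP; split; apply/eqP; ring. Qed.

Lemma expi0 : expi (0 : R) = 1.
Proof. by rewrite /expi cos0 sin0. Qed.

Lemma expiD a b : expi (a + b) = expi a * expi b.
Proof.
apply/eqP; rewrite eq_complex /expi /= cosD sinD eqxx andTb; apply/eqP; ring.
Qed.

Lemma expi_mulrn a n : expi (n%:R * a) = expi a ^+ n.
Proof.
elim: n => [|n IH]; first by rewrite mul0r expi0 expr0.
by rewrite -natr1 mulrDl mul1r expiD IH exprSr.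
Qed.

Lemma nc_expi a : nc (expi a) = 1.
Proof. by rewrite /expi /= cos2Dsin2 sqrtr1. Qed.

Lemma expi_conj a : (expi a)^*%C = expi (- a).
Proof. by rewrite /expi /= cosN sinN. Qed.

Lemma nc_expiB a b : nc (expi a - expi b) ^+ 2 = 2 * (1 - cos (a - b)).
Proof.
rewrite ncE /= cosB; have := cos2Dsin2 a; have := cos2Dsin2 b.
move: (cos a) (sin a) (cos b) (sin b) => x y z w h1 h2.
transitivity ((x ^+ 2 + y ^+ 2) + (z ^+ 2 + w ^+ 2) - 2 * (x * z + y * w)); first by ring.
by rewrite h1 h2; ring.
Qed.

Lemma le_of_derive_ge0 (f df : R -> R) a b :
  (forall x : R, is_derive x 1 f (df x)) -> a <= b ->
  (forall x, a < x < b -> 0 <= df x) -> f a <= f b.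
Proof.
move=> fd; rewrite le_eqVlt => /orP[/eqP->//|ab] df0.
have cf : {within `[a, b], continuous f}.
  apply: continuous_subspaceT => x; apply/differentiable_continuous.
  by apply/derivable1_diffP; have [] := fd x.
have [c] := @MVT R f df a b ab (fun x _ => fd x) cf.
rewrite in_itv /= => ac h.
by rewrite -subr_ge0 h mulr_ge0 ?df0// subr_ge0 ltW.
Qed.

Lemma sin_le a : 0 <= a -> sin a <= a.
Proof.
move=> a0; pose f x : R := x - sin x; pose df x : R := 1 - cos x.
have fd (x : R) : is_derive x 1 f (df x).
  by rewrite /f /df; apply: is_derive_eq.
have := le_of_derive_ge0 fd a0.
rewrite /f sin0 subr0 => h.
suff : 0 <= a - sin a by rewrite subr_ge0.
apply: h => x _.
by rewrite /df subr_ge0 cos_le1.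
Qed.

Lemma cos_ge a : 1 - a ^+ 2 / 2 <= cos a.
Proof.
wlog a0 : a / 0 <= a.
  move=> H; have [/H//|/ltW a0] := leP 0 a.
  by have := H (- a); rewrite cosN sqrrN oppr_ge0 => /(_ a0).
pose f x : R := cos x + x ^+ 2 / 2; pose df x : R := x - sin x.
have fd (x : R) : is_derive x 1 f (df x).
  by rewrite /f /df; apply: is_derive_eq; rewrite /GRing.scale /=; field.
have := le_of_derive_ge0 fd a0.
rewrite /f cos0 expr0n /= mul0r addr0 => h.
suff : 1 <= cos a + a ^+ 2 / 2 by lra.
by apply: h => x /andP[x0 _]; rewrite /df subr_ge0 sin_le// ltW.
Qed.

Lemma sin_ge a : 0 <= a -> a - a ^+ 3 / 6 <= sin a.
Proof.
move=> a0; pose f x : R := sin x - x + x ^+ 3 / 6.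
pose df x : R := cos x - 1 + x ^+ 2 / 2.
have fd (x : R) : is_derive x 1 f (df x).
  by rewrite /f /df; apply: is_derive_eq; rewrite /GRing.scale /=; field.
have := le_of_derive_ge0 fd a0.
rewrite /f sin0 expr0n /= mul0r addr0 subr0 => h.
suff : 0 <= sin a - a + a ^+ 3 / 6 by lra.
by apply: h => x _; rewrite /df; have := cos_ge x; lra.
Qed.

(** The inequality between an angle and its tangent, freed of the division by the cosine; the
    derivative of the difference is x * sin x. *)
Lemma mul_cos_le_sin a : 0 <= a <= pi -> a * cos a <= sin a.
Proof.
move=> /andP[a0 api]; pose f x : R := sin x - x * cos x.
pose df x : R := x * sin x.
have fd (x : R) : is_derive x 1 f (df x).
  by rewrite /f /df; apply: is_derive_eq; rewrite /GRing.scale /=; ring.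
have := le_of_derive_ge0 fd a0.
rewrite /f sin0 mul0r subr0 => h; rewrite -subr_ge0; apply: h => x /andP[x0 xa].
apply: mulr_ge0; first exact: ltW.
by apply: sin_ge0_pi; apply/andP; split; lra.
Qed.

Lemma nc_expi_lip a b : nc (expi a - expi b) <= `|a - b|.
Proof.
rewrite -(@ler_pXn2r _ 2)// ?nnegrE ?nc_ge0// nc_expiB real_normK ?num_real//.
have := cos_ge (a - b); lra.
Qed.

End ComplexModulus.

Arguments gdvd m%_R n%_R.
Notation gdvdb d n := (asbool (gdvd d n)).

Lemma gdvd_leq_exp p n j : cprime p -> n != 0 -> gdvd (p ^+ j) n -> (j < gn n)%N.
Proof.
move=> /cprime_gprime/gprime_gn p1 n0 /(gdvd_leq n0); rewrite gnX.
by apply: leq_trans; exact: ltn_expl.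
Qed.

(* The multiplicity of [p] in [n], as soon as [gn n <= B]. *)
Definition gval (B : nat) (p n : gaussInt) : nat :=
  \sum_(1 <= j < B.+1 | gdvdb (p ^+ j) n) 1.

Lemma gval_mul_self q m B : cprime q -> m != 0 -> (gn (q * m) <= B)%N ->
  gval B q (q * m) = (gval B q m).+1.
Proof.
move=> cq m0; have q0 := gprime_neq0 (cprime_gprime cq).
have q1 := gprime_gn (cprime_gprime cq).
have mg : (0 < gn m)%N by rewrite gn_gt0.
case: B => [|B]; rewrite gnM => mB; first by nia.
rewrite /gval big_ltn_cond// expr1 ifT; last first.
  by apply/asboolP/gdvd_mulr; exact: gdvd_refl.
(* The exponents for [q * m] are those for [m] shifted by one. The top exponent in the range cannot
   occur for [m], since it exceeds [gn m]. *)
rewrite add1n; congr _.+1; rewrite [RHS]big_mkcond big_nat_recr//= ifF; last first.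
  by apply/negbTE/asboolP => /(gdvd_leq_exp cq m0); nia.
rewrite addn0 [LHS]big_mkcond /= big_add1 /=.
apply: eq_bigr => j _; congr (if _ then _ else _).
by rewrite exprS; apply: asbool_equiv_eq; exact: gdvd_pmul2l.
Qed.

Lemma gval_mul_other p q m B : cprime p -> cprime q -> p != q ->
  gval B p (q * m) = gval B p m.
Proof.
move=> cp cq pq; apply: eq_bigl => j; apply: asbool_equiv_eq.
by apply: gprime_exp_dvd (cprime_gprime cp) _; exact: cprime_ndvd.
Qed.

Lemma gval1 B p n : cprime p -> gn n = 1%N -> gval B p n = 0%N.
Proof.
move=> cp n1; rewrite /gval big1_seq// => j; rewrite mem_index_iota.
case/and3P => /asboolP h j1 _; have n0 : n != 0 by rewrite -gn_gt0 n1.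
by have := gdvd_leq_exp cp n0 h; lia.
Qed.

(** * The identity ln = 1 * Lambda *)

Section LogIdentity.
Variable R : realType.

Definition lgn (n : gaussInt) : R := ln (gn n)%:R.

Lemma lgnM m n : m != 0 -> n != 0 -> lgn (m * n) = lgn m + lgn n.
Proof. by move=> m0 n0; rewrite /lgn gnM natrM lnM// posrE ltr0n gn_gt0. Qed.

Lemma lgn_ge0 n : 0 <= lgn n.
Proof.
rewrite /lgn; have [->|n0] := eqVneq n 0; first by rewrite gn0 ln0.
by rewrite ln_ge0// ler1n gn_gt0.
Qed.

(** Induction on the norm: splitting off a prime [q] raises the multiplicity of [q] by one and
    leaves all others unchanged. Units contribute 0 on both sides. *)
Lemma lgn_factor n B : n != 0 -> (gn n <= B)%N ->
  lgn n = \sum_(p <- gnball B | cprime p) lgn p *+ gval B p n.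
Proof.
have [k] := ubnP (gn n); elim: k n => // k IH n nk n0 nB.
have ng : (0 < gn n)%N by rewrite gn_gt0.
have [n1|n1] := leqP (gn n) 1.
  have e : gn n = 1%N by lia.
  by rewrite /lgn e ln1 big1// => p cp; rewrite gval1.
have [q cq [m nm]] := cprime_divisor n1.
have qp := cprime_gprime cq; have q0 := gprime_neq0 qp.
have q1 := gprime_gn qp.
have m0 : m != 0 by move: n0; rewrite nm gmulf_eq0 negb_or => /andP[].
have mg : (0 < gn m)%N by rewrite gn_gt0.
have nE : gn n = (gn q * gn m)%N by rewrite nm gnM.
rewrite {1}nm lgnM// (IH m) //; [|nia|nia].
have qB : q \in gnball B by rewrite mem_gnball; nia.
rewrite big_mkcond [RHS]big_mkcond /= !(bigD1_seq q) ?gnball_uniq//=.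
rewrite cq addrA -mulrS -gval_mul_self -?nm//; congr (_ + _).
apply: eq_bigr => p pq; case: ifP => // cp.
by rewrite nm gval_mul_other.
Qed.

Lemma sum_gdvd (V : nmodType) (d : gaussInt) K (F : gaussInt -> V) : d != 0 ->
  \sum_(n <- gnball K | gdvdb d n) F n =
  \sum_(m <- gnball (K %/ gn d)) F (d * m).
Proof.
move=> d0; have dg : (0 < gn d)%N by rewrite gn_gt0.
rewrite -big_filter -(big_map (fun m => d * m) xpredT F); apply: perm_big.
apply: uniq_perm; rewrite ?filter_uniq ?gnball_uniq//.
  by rewrite map_inj_uniq ?gnball_uniq// => m n; apply: gmulfI.
move=> n; rewrite mem_filter mem_gnball; apply/idP/mapP.
  case/andP => /asboolP[m ->]; rewrite gnM => h; exists m => //.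
  by rewrite mem_gnball leq_divRL// mulnC; nia.
case=> m; rewrite mem_gnball leq_divRL// => h ->; apply/andP; split.
  by apply/asboolP; exists m.
by rewrite gnM mulnC; nia.
Qed.

Lemma sum_mul_lgn (V : comNzRingType) (emb : {rmorphism R -> V})
    (G : gaussInt -> V) K :
  (forall m n, m != 0 -> n != 0 -> G (m * n) = G m * G n) ->
  \sum_(n <- gnball K) emb (lgn n) * G n =
  \sum_(p <- gnball K | cprime p) \sum_(1 <= j < K.+1)
     emb (lgn p) * G (p ^+ j) * \sum_(m <- gnball (K %/ gn p ^ j)) G m.
Proof.
move=> GM.
transitivity (\sum_(n <- gnball K) \sum_(p <- gnball K | cprime p)
   \sum_(1 <= j < K.+1 | gdvdb (p ^+ j) n) emb (lgn p) * G n).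
  apply: eq_big_seq => n; rewrite mem_gnball => /andP[n0 nK].
  rewrite (@lgn_factor n K)// -?gn_gt0// rmorph_sum big_distrl /=.
  apply: eq_bigr => p cp; rewrite -mulr_natr rmorphM rmorph_nat /gval natr_sum.
  by rewrite mulr_sumr mulr_suml; apply: eq_bigr => j _; rewrite mulr1.
rewrite exchange_big /=; apply: eq_bigr => p cp.
under eq_bigr do rewrite big_mkcond.
rewrite exchange_big /=; apply: eq_bigr => j _.
have p0 : p ^+ j != 0 by apply/gexpf_neq0/gprime_neq0/cprime_gprime.
rewrite -big_mkcond /= sum_gdvd// gnX mulr_sumr; apply: eq_big_seq => m.
by rewrite mem_gnball => /andP[m0 _]; rewrite GM ?mulrA// -gn_gt0.
Qed.

End LogIdentity.

(** * Partial summation and inequalities for powers and logarithms *)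

Section Abel.
Variable R : realType.

(** Partial summation puts the nonnegative weights [phi k - phi k.+1] on the partial sums, so these
    may be replaced by their majorants; summing back by parts leaves only the increments of [B]. *)
Lemma abel_majorant (b : nat -> R[i]) (B phi : nat -> R) m n : (m < n)%N ->
  (forall j, (m <= j < n)%N -> nc (\sum_(m <= k < j.+1) b k) <= B j) ->
  (forall k, (m <= k < n)%N -> 0 <= phi k) ->
  (forall k, (m <= k)%N -> (k.+1 < n)%N -> phi k.+1 <= phi k) ->
  nc (\sum_(m <= k < n) (phi k)%:C * b k) <=
    B m * phi m + \sum_(m.+1 <= k < n) (B k - B k.-1) * phi k.
Proof.
case: n => // n; rewrite ltnS => mn Bb phi0 phid.
pose S j := \sum_(m <= k < j.+1) b k.
pose A j := \sum_(m <= k < j.+1) (phi k)%:C * b k - (phi j)%:C * S j.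
pose E j := B m * phi m + \sum_(m.+1 <= k < j.+1) (B k - B k.-1) * phi k.
(* The boundary terms [phi j * S j] and [B j * phi j] are removed on both sides, so that one step
   adds [phi j - phi j.+1] times the partial sum and times its majorant respectively. *)
have key j : (m <= j)%N -> (j <= n)%N -> nc (A j) <= E j - B j * phi j.
  elim: j => [|j IH]; rewrite leq_eqVlt => /orP[/eqP e _|].
  - by subst m; rewrite /A /E /S !big_nat1 !big_geq// subrr nc0 addr0 subrr.
  - by [].
  - by subst m; rewrite /A /E /S !big_nat1 !big_geq// subrr nc0 addr0 subrr.
  rewrite ltnS => mj jn.
  have -> : A j.+1 = A j + (phi j - phi j.+1)%:C * S j.
    rewrite /A {1}big_nat_recr ?ltnS//=; last by lia.
    rewrite /S (big_nat_recr j.+1)/=; last by lia.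
    by rewrite rmorphB /=; ring.
  have -> : E j.+1 - B j.+1 * phi j.+1 =
      E j - B j * phi j + (phi j - phi j.+1) * B j.
    by rewrite /E (big_nat_recr j.+1)//=; ring.
  apply: le_trans (ncD _ _) _; apply: lerD; first by apply: IH; lia.
  have h0 : 0 <= phi j - phi j.+1 by rewrite subr_ge0 phid//; lia.
  rewrite ncM nc_real ger0_norm//; apply: ler_wpM2l => //.
  by apply: Bb; lia.
have -> : \sum_(m <= k < n.+1) (phi k)%:C * b k = A n + (phi n)%:C * S n.
  by rewrite /A subrK.
apply: le_trans (ncD _ _) _.
have := key n mn (leqnn n); rewrite -/(E n) ncM nc_real ger0_norm; last first.
  by apply: phi0; lia.
have := ler_wpM2l (phi0 n _) (Bb n _) => /(_ _ _).
move=> h1 h2; have {}h1 := h1 _ _; have := h1; rewrite -/(S n).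
have e1 : (m <= n < n.+1)%N by lia.
move=> /(_ e1 e1) h3; lra.
Qed.

End Abel.

Section RealBounds.
Variable R : realType.
Implicit Types (a x y : R).

(** With E = (1 + x)^a and L = ln (1 + x), the tangent bound for exp gives E (1 + (1 - a) L) <= 1 +
    x and E (1 - a L) <= 1. In the combination with weights a and 1 - a the terms in L cancel. *)
Lemma powR_bernoulli a x : 0 <= a <= 1 -> -1 < x -> (1 + x) `^ a <= 1 + a * x.
Proof.
move=> /andP[a0 a1] x1; have y0 : 0 < 1 + x by lra.
rewrite /powR gt_eqF//; set L := ln (1 + x); set E := expR (a * L).
have E0 : 0 < E by exact: expR_gt0.
have e1 : 1 + x = E * expR ((1 - a) * L).
  by rewrite -expRD -mulrDl (addrC a) subrK mul1r lnK.
have e2 : 1 = E * expR (- a * L) by rewrite -expRD mulNr subrr expR0.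
have h1 := expR_ge1Dx ((1 - a) * L); have h2 := expR_ge1Dx (- a * L).
have k1 : E * (1 + (1 - a) * L) <= 1 + x by rewrite e1 ler_wpM2l// ltW.
have k2 : E * (1 + - a * L) <= 1 by rewrite [leRHS]e2 ler_wpM2l// ltW.
have k3 := ler_wpM2l a0 k1.
have k4 : (1 - a) * (E * (1 + - a * L)) <= (1 - a) * 1.
  by apply: ler_wpM2l => //; lra.
suff : E = a * (E * (1 + (1 - a) * L)) + (1 - a) * (E * (1 + - a * L)) by lra.
by ring.
Qed.

Lemma ln_le_sub1 x : 0 < x -> ln x <= x - 1.
Proof. by move=> x0; have := @le_ln1Dx R (x - 1); rewrite (addrC 1) subrK; apply; lra. Qed.

Lemma ln_ge_1subV x : 0 < x -> 1 - x^-1 <= ln x.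
Proof.
move=> x0; have := @ln_le_sub1 x^-1; rewrite invr_gt0 => /(_ x0).
by rewrite lnV ?posrE//; lra.
Qed.

Lemma powR_diff_le a (k : nat) : 0 <= a <= 1 -> (0 < k)%N ->
  k%:R `^ a - k.-1%:R `^ a <= k%:R `^ (a - 1) :> R.
Proof.
move=> /andP[a0 a1] k0; have kR : 0 < k%:R :> R by rewrite ltr0n.
have -> : k%:R `^ (a - 1) = k%:R `^ a * k%:R^-1 :> R.
  by rewrite powRB ?(gt_eqF kR) ?implybT// powRr1 // ltW.
have [k1|k1] := leqP k 1.
  have -> : k = 1%N by lia.
  by rewrite invr1 mulr1 /= gerBl powR_ge0.
have e : k.-1%:R = k%:R * (1 - k%:R^-1) :> R.
  by rewrite mulrBr mulr1 divff ?gt_eqF// -subn1 natrB.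
have u0 : 0 < 1 - k%:R^-1 :> R.
  by rewrite subr_gt0 invf_lt1// ltr1n.
rewrite e powRM ?ler0n ?(ltW u0)//.
have h : 1 - k%:R^-1 <= (1 - k%:R^-1) `^ a :> R.
  apply: ger1_powR => //; rewrite u0 /=.
  have : 0 < k%:R^-1 :> R by rewrite invr_gt0.
  by lra.
move: h (powR_ge0 (k%:R : R) a); move: (k%:R^-1) (_ `^ a) (k%:R `^ a) => i Q P.
by nra.
Qed.

Lemma powR_diff_ge a (k : nat) : 0 <= a <= 1 -> (0 < k)%N ->
  a * k%:R `^ (a - 1) <= k%:R `^ a - k.-1%:R `^ a :> R.
Proof.
move=> /andP[a0 a1] k0; have kR : 0 < k%:R :> R by rewrite ltr0n.
have -> : k%:R `^ (a - 1) = k%:R `^ a * k%:R^-1 :> R.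
  by rewrite powRB ?(gt_eqF kR) ?implybT// powRr1 // ltW.
have [k1|k1] := leqP k 1.
  have -> : k = 1%N by lia.
  rewrite invr1 mulr1 /= powR1 /=.
  have [->|an] := eqVneq a 0; first by rewrite powRr0; lra.
  by rewrite powR0//; lra.
have e : k.-1%:R = k%:R * (1 - k%:R^-1) :> R.
  by rewrite mulrBr mulr1 divff ?gt_eqF// -subn1 natrB.
have u0 : 0 < 1 - k%:R^-1 :> R.
  by rewrite subr_gt0 invf_lt1// ltr1n.
rewrite e powRM ?ler0n ?(ltW u0)//.
have h : (1 - k%:R^-1) `^ a <= 1 + a * (- k%:R^-1) :> R.
  by apply: powR_bernoulli; [rewrite a0|lra].
move: h (powR_ge0 (k%:R : R) a); move: (k%:R^-1) (_ `^ a) (k%:R `^ a) => i Q P.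
by nra.
Qed.

Lemma sum_powR_le a K : 0 < a <= 1 ->
  \sum_(1 <= k < K.+1) k%:R `^ (a - 1) <= K%:R `^ a / a :> R.
Proof.
move=> /andP[a0 a1]; rewrite ler_pdivlMr// mulrC mulr_sumr.
elim: K => [|K IH]; first by rewrite big_geq// powR_ge0.
rewrite big_nat_recr//=.
have := @powR_diff_ge a K.+1; rewrite a1 ltW//= => /(_ isT isT); lra.
Qed.

Lemma powR_tail_step a (k : nat) : 0 < a -> (1 < k)%N ->
  a * k%:R `^ (- 1 - a) <= k.-1%:R `^ (- a) - k%:R `^ (- a) :> R.
Proof.
move=> a0 k1; have kR : 0 < k%:R :> R by rewrite ltr0n; lia.
have -> : k%:R `^ (- 1 - a) = k%:R `^ (- a) * k%:R^-1 :> R.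
  rewrite (addrC (-1)) powRD ?(gt_eqF kR) ?implybT// powR_inv1 // ltW.
have e : k.-1%:R = k%:R * (1 - k%:R^-1) :> R.
  by rewrite mulrBr mulr1 divff ?gt_eqF// -subn1 natrB//; lia.
have u0 : 0 < 1 - k%:R^-1 :> R.
  by rewrite subr_gt0 invf_lt1// ltr1n.
rewrite e powRM ?ler0n ?(ltW u0)//.
have h : 1 + a * k%:R^-1 <= (1 - k%:R^-1) `^ (- a) :> R.
  rewrite /powR gt_eqF//.
  have := expR_ge1Dx (- a * ln (1 - k%:R^-1) : R).
  have := ler_wpM2l (ltW a0) (ln_le_sub1 u0); lra.
move: h (powR_ge0 (k%:R : R) (- a)).
move: (k%:R^-1) (_ `^ (- a)) (k%:R `^ (- a)) => i Q P.
by nra.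
Qed.

Lemma sum_powR_tail a m n : 0 < a -> (0 < m)%N ->
  \sum_(m.+1 <= k < n) k%:R `^ (- 1 - a) <= m%:R `^ (- a) / a :> R.
Proof.
move=> a0 m0; rewrite ler_pdivlMr// mulrC mulr_sumr.
have [nm|mn] := leqP n m.+1; first by rewrite big_geq// powR_ge0.
suff : \sum_(m.+1 <= k < n) a * k%:R `^ (- 1 - a)
    <= m%:R `^ (- a) - n.-1%:R `^ (- a) :> R.
  by have := powR_ge0 (n.-1%:R : R) (- a); lra.
elim: n mn => // n IH; rewrite ltnS leq_eqVlt => /orP[/eqP <-|mn].
  by rewrite big_nat1 /=; apply: powR_tail_step => //; lia.
rewrite big_nat_recr//=; last by lia.
have := IH mn.
have n1 : (1 < n)%N by lia.
by have := powR_tail_step a0 n1; lra.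
Qed.

(** Passing from K to K + 1 adds K copies of ln (1 + 1 / K), in total at most 1. *)
Lemma sum_ln_ratio K : \sum_(1 <= k < K.+1) (ln K%:R - ln k%:R) <= K%:R :> R.
Proof.
elim: K => [|K IH]; first by rewrite big_geq.
rewrite big_nat_recr//= subrr addr0.
have [->|K0] := posnP K; first by rewrite big_geq// ler01.
have kR : 0 < K%:R :> R by rewrite ltr0n.
have -> : \sum_(1 <= k < K.+1) (ln K.+1%:R - ln k%:R) =
   \sum_(1 <= k < K.+1) (ln K%:R - ln k%:R) + K%:R * (ln K.+1%:R - ln K%:R) :> R.
  rewrite -[K in K%:R * _]subn0 -(subSS 0) mulr_natl -sumr_const_nat -big_split /=.
  by apply: eq_bigr => k _; ring.
rewrite -natr1; apply: lerD => //.
have -> : ln (K%:R + 1) - ln K%:R = ln (1 + K%:R^-1) :> R.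
  rewrite -ln_div ?posrE ?addr_gt0// mulrDl divff ?gt_eqF// mul1r//.
have : 0 < K%:R^-1 :> R by rewrite invr_gt0.
move=> h; have := @le_ln1Dx R K%:R^-1; rewrite (lt_trans _ h) ?ltrN10// => /(_ isT).
by move/(ler_wpM2l (ltW kR)); rewrite divff ?gt_eqF.
Qed.

End RealBounds.

(** * Lattice points and character sums *)

Lemma nat_sqrt_exists n : exists s, (s ^ 2 <= n < s.+1 ^ 2)%N.
Proof.
elim: n => [|n [s /andP[h1 h2]]]; first by exists 0%N.
have [h|h] := leqP (s.+1 ^ 2) n.+1.
  by exists s.+1; rewrite h /=; nia.
by exists s; rewrite h andbT; lia.
Qed.

(** If b0 is the least solution, then b >= b0 + G would make b^2 exceed b0^2 by at least G^2 > H;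
    all solutions therefore lie among G consecutive integers. *)
Lemma nat_window_count (A H G a N : nat) : (H < G ^ 2)%N ->
  (size [seq b <- iota 0 N | (A < a + b ^ 2 <= A + H)%N] <= G)%N.
Proof.
move=> HG; set P := fun b : nat => _.
have [h|] := boolP (has P (iota 0 N)); last first.
  by rewrite has_filter negbK => /eqP ->.
have exP : exists b, P b by case/hasP: h => b _ Pb; exists b.
case: (ex_minnP exP) => b0 Pb0 bmin.
rewrite -(size_iota b0 G); apply: uniq_leq_size; first exact/filter_uniq/iota_uniq.
move=> b; rewrite mem_filter mem_iota => /andP[Pb _].
have := bmin b Pb; move: Pb Pb0; rewrite /P mem_iota; nia.
Qed.

Lemma absz_sqrD (a b : int) :
  (`|(a ^+ 2 + b ^+ 2)%R| = `|a| ^ 2 + `|b| ^ 2)%N.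
Proof.
have e (x : int) : x ^+ 2 = (`|x| ^ 2)%N%:Z.
  by rewrite -mulnn PoszM abszE -expr2 real_normK ?num_real.
by rewrite !e -PoszD absz_nat.
Qed.

Lemma int_window_count (A H G B : nat) (a : int) : (H < G ^ 2)%N ->
  (size [seq b : int <- irange B | (A < `|(a ^+ 2 + b ^+ 2)%R|%N <= A + H)%N] <= G.*2)%N.
Proof.
move=> HG; pose L := [seq b <- iota 0 B.+1 | (A < `|a|%N ^ 2 + b ^ 2 <= A + H)%N].
apply: leq_trans (_ : size ([seq Posz b | b <- L] ++ [seq - Posz b | b <- L]) <= _)%N.
  apply: uniq_leq_size; first exact/filter_uniq/irange_uniq.
  move=> b; rewrite mem_filter mem_irange => /andP[h bB].
  have hL : `|b|%N \in L.
    rewrite mem_filter mem_iota add0n /=; apply/andP; split; last by lia.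
    by rewrite -absz_sqrD.
  rewrite mem_cat; apply/orP; have [b0|b0] := leP 0 b.
    by left; apply/mapP; exists `|b|%N => //; lia.
  by right; apply/mapP; exists `|b|%N => //; lia.
by rewrite size_cat !size_map addnn leq_double nat_window_count.
Qed.

(** Counted row by row: at most 2 B + 1 real parts occur, each with at most 2 G imaginary parts. *)
Lemma annulus_count A H B G : (A + H < B.+1 ^ 2)%N -> (H < G ^ 2)%N ->
  (size [seq n <- gnball (A + H) | A < gn n] <= B.*2.+1 * G.*2)%N.
Proof.
move=> hB hG.
pose row (a : int) := [seq b : int <- irange B | (A < `|(a ^+ 2 + b ^+ 2)%R|%N <= A + H)%N].
pose L := flatten [seq [seq (a +i* b : gaussInt) | b <- row a] | a <- irange B].
apply: leq_trans (_ : size L <= _)%N.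
  apply: uniq_leq_size; first exact/filter_uniq/gnball_uniq.
  case=> a b; rewrite mem_filter mem_gnball => /and3P[h0 _ h1].
  have hab : (`|a| <= B%:Z) && (`|b| <= B%:Z).
    have := gnE (a +i* b); rewrite /gnorm /=.
    have := real_normK (num_real a); have := real_normK (num_real b).
    have := normr_ge0 a; have := normr_ge0 b.
    move: h1 hB; move: (gn _) => g; move: `|a| `|b| => s t h1 hB t0 s0 <- <- ge.
    have hh : s ^+ 2 + t ^+ 2 < (B.+1%:Z) ^+ 2.
      by nia.
    by apply/andP; split; nia.
  case/andP: hab => ha hb; apply/flatten_mapP; exists a; first by rewrite mem_irange.
  apply/mapP; exists b => //; rewrite mem_filter mem_irange hb andbT.
  by move: h0 h1; rewrite /gn /gnorm /= => -> ->.
rewrite /L size_flatten /shape -map_comp.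
apply: leq_trans (_ : sumn [seq G.*2 | _ <- irange B] <= _)%N.
  rewrite !sumnE !big_map; apply: leq_sum => a _ /=.
  by rewrite size_map int_window_count.
by rewrite sumnE big_map big_const_seq count_predT iter_addn_0 size_map size_iota mulnC.
Qed.

Lemma gnball_size_le K : (size (gnball K) <= 30 * K)%N.
Proof.
case: K => // K; have [s /andP[s1 s2]] := nat_sqrt_exists K.+1.
have h : (0 + K.+1 < s.+1 ^ 2)%N by [].
have := @annulus_count 0 K.+1 s s.+1 h s2.
rewrite add0n -(eq_in_filter (a1 := xpredT)) ?filter_predT; last first.
  by move=> n; rewrite mem_gnball => /andP[->].
by move/leq_trans; apply; nia.
Qed.

Section Directions.
Variable R : realType.
Local Notation gC := (gaussC R).

(** The direction n / |n|. The convention for the inverse of 0 makes it 0 at 0, so its modulus is at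
    most 1 everywhere. *)
Definition dir (n : gaussInt) : R[i] := ((nc (gC n))^-1)%:C * gC n.

Lemma nc_gC n : nc (gC n) ^+ 2 = (gn n)%:R.
Proof. by rewrite -gnormE -gnE. Qed.

Lemma nc_gCE n : nc (gC n) = Num.sqrt (gn n)%:R.
Proof. by rewrite -nc_gC sqrtr_sqr ger0_norm// nc_ge0. Qed.

Lemma nc_gC_gt0 n : n != 0 -> 0 < nc (gC n).
Proof. by move=> n0; rewrite nc_gCE sqrtr_gt0 ltr0n gn_gt0. Qed.

Lemma gC0 : gC 0 = 0. Proof. by []. Qed.

Lemma gCD m n : gC (m + n) = gC m + gC n.
Proof.
case: m n => [a b] [c d]; rewrite /gaussC gaddE /= !rmorphD.
by [].
Qed.

Lemma nc_dir n : n != 0 -> nc (dir n) = 1.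
Proof.
move=> n0; rewrite /dir ncM nc_real ger0_norm ?invr_ge0 ?nc_ge0//.
by rewrite mulVf// gt_eqF// nc_gC_gt0.
Qed.

Lemma nc_dir_le1 n : nc (dir n) <= 1.
Proof.
have [->|/nc_dir->//] := eqVneq n 0.
by rewrite /dir gC0 mulr0 nc0.
Qed.

Lemma dirM m n : dir (m * n) = dir m * dir n.
Proof.
by rewrite /dir gaussCM ncM invfM rmorphM /=; ring.
Qed.

Lemma dir_conj n : dir (gconj n) = (dir n)^*%C.
Proof.
case: n => a b; rewrite /dir /gconj /gaussC /= !rmorphN /= sqrrN.
by apply/eqP; rewrite eq_complex /=; apply/andP; split; apply/eqP; ring.
Qed.

Lemma dir_expi n : n != 0 -> dir n = expi (carg (gC n)).
Proof.
move=> n0; rewrite /dir {2}(cargE (gC n)) mulrA -rmorphM /=.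
by rewrite mulVf ?mul1r// gt_eqF// nc_gC_gt0.
Qed.

Lemma dirI : dir gI = 'i.
Proof.
have e : nc (gC gI) = 1 by rewrite nc_gCE gnI sqrtr1.
by rewrite /dir e invr1 mul1r; apply/eqP; rewrite eq_complex /= !eqxx.
Qed.

Lemma nc_dirB m n : m != 0 -> n != 0 ->
  nc (dir m - dir n) <= 2 * nc (gC m - gC n) / nc (gC n).
Proof.
move=> m0 n0; have M0 := nc_gC_gt0 m0; have N0 := nc_gC_gt0 n0.
have e : dir m - dir n = ((nc (gC n))^-1)%:C *
    ((gC m - gC n) + (nc (gC n) - nc (gC m))%:C * dir m).
  rewrite /dir; set s := nc (gC m); set t := nc (gC n).
  have -> : (t - s)%:C = t%:C - s%:C :> R[i] by rewrite rmorphB.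
  have st : s%:C * (s^-1)%:C = 1 :> R[i] by rewrite -rmorphM /= divff ?gt_eqF.
  have tt : t%:C * (t^-1)%:C = 1 :> R[i] by rewrite -rmorphM /= divff ?gt_eqF.
  transitivity ((s^-1)%:C * gC m * (t%:C * (t^-1)%:C) + (t^-1)%:C * gC m * (1 - s%:C * (s^-1)%:C) - (t^-1)%:C * gC n).
    by rewrite st tt; ring.
  by ring.
rewrite e ncM nc_real ger0_norm ?invr_ge0 ?(ltW N0)// mulrC ler_pM2r ?invr_gt0//.
apply: le_trans (ncD _ _) _; rewrite mulr_natl mulr2n lerD2l ncM nc_dir// mulr1.
by rewrite nc_real; apply: le_trans (nc_dist _ _) _; rewrite nc_subC.
Qed.

Lemma nc_expB (u v : R[i]) m : nc u <= 1 -> nc v <= 1 ->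
  nc (u ^+ m - v ^+ m) <= m%:R * nc (u - v).
Proof.
move=> u1 v1; elim: m => [|m IH]; first by rewrite !expr0 subrr nc0 mul0r.
have -> : u ^+ m.+1 - v ^+ m.+1 = u * (u ^+ m - v ^+ m) + (u - v) * v ^+ m.
  by rewrite !exprS; ring.
apply: le_trans (ncD _ _) _; rewrite !ncM ncX -natr1 mulrDl mul1r.
apply: lerD; first by apply: le_trans IH; rewrite ler_piMl ?nc_ge0.
by rewrite ler_piMr ?nc_ge0// exprn_ile1// nc_ge0.
Qed.

End Directions.

Section Scaling.
Variable alpha : gaussInt.
Hypothesis alpha0 : alpha != 0.

(** Rounding down both coordinates of n / alpha. The elements of quotient 0 are the lattice points
    of the half-open square spanned by alpha and i * alpha, a complete system of residues. *)
Definition gquot (n : gaussInt) : gaussInt :=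
  (Re (n * gconj alpha) %/ gnorm alpha)%Z +i* (Im (n * gconj alpha) %/ gnorm alpha)%Z.

Definition residues : seq gaussInt :=
  [seq r <- box (gn alpha).*2 | gquot r == 0].

Lemma gnorm_alpha_gt0 : 0 < gnorm alpha.
Proof. by rewrite -gnE; move: alpha0; rewrite -gn_gt0; lia. Qed.

Lemma gquotD l r : gquot (alpha * l + r) = l + gquot r.
Proof.
rewrite /gquot mulrDl mulrAC gmul_conj; have k0 := gnorm_alpha_gt0.
case: l => x y; case: (r * gconj alpha) => z w.
rewrite gmulE gaddE /= !mul0r subr0 addr0.
move: (gnorm alpha) k0 => k k0.
by rewrite !(mulrC k) !divzMDl ?gt_eqF.
Qed.

Lemma gquot0_gn r : gquot r = 0 -> (gn r < (gn alpha).*2)%N.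
Proof.
case=> h1 h2; have k0 := gnorm_alpha_gt0.
suff : gnorm r * gnorm alpha < 2 * gnorm alpha * gnorm alpha.
  by rewrite ltr_pM2r// -!gnE; lia.
have -> : gnorm r * gnorm alpha = gnorm (r * gconj alpha).
  by rewrite gnormM gnorm_conj.
have := divz_eq (Re (r * gconj alpha)) (gnorm alpha).
have := divz_eq (Im (r * gconj alpha)) (gnorm alpha).
have := ltz_pmod (Re (r * gconj alpha)) k0.
have := ltz_pmod (Im (r * gconj alpha)) k0.
have := modz_ge0 (Re (r * gconj alpha)) (_ : gnorm alpha != 0).
have := modz_ge0 (Im (r * gconj alpha)) (_ : gnorm alpha != 0).
rewrite h1 h2 !mul0r !add0r gt_eqF// => /(_ isT) + /(_ isT).
have -> : gnorm (r * gconj alpha) =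
  Re (r * gconj alpha) ^+ 2 + Im (r * gconj alpha) ^+ 2 by [].
move: (Re (r * _)) (Im (r * _)) (gnorm alpha) k0 => x y k k0.
move=> a1 a2 a3 a4 e1 e2; move: a1 a2 a3 a4; rewrite -e1 -e2 => a1 a2 a3 a4.
have : x * x <= k * k by apply: ler_pM => //; exact: ltW.
have : y * y < k * k by apply: ltr_pM.
by rewrite !expr2; lia.
Qed.

Lemma mem_residues r : (r \in residues) = (gquot r == 0).
Proof.
rewrite mem_filter; have [/gquot0_gn h|//] := eqVneq (gquot r) 0.
rewrite mem_box /=; case/andP: (gn_coord r) => h1 h2.
by apply/andP; split; [apply: le_trans h1 _|apply: le_trans h2 _]; lia.
Qed.

Lemma residues_uniq : uniq residues.
Proof. exact/filter_uniq/box_uniq. Qed.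

(** Division with remainder is a bijection between Gaussian integers and pairs of a quotient and a
    residue; the box only has to be large enough to contain all quotients that occur. *)
Lemma sum_residues (V : nmodType) (F : gaussInt -> V) K :
  \sum_(n <- gnball (gn alpha * K)) F n =
  \sum_(r <- residues) \sum_(l <- box (2 * K + 4) |
     (alpha * l + r \in gnball (gn alpha * K))) F (alpha * l + r).
Proof.
pose G n := if n \in gnball (gn alpha * K) then F n else 0.
have -> : \sum_(r <- residues) \sum_(l <- box (2 * K + 4) |
     (alpha * l + r \in gnball (gn alpha * K))) F (alpha * l + r) =
   \sum_(r <- residues) \sum_(l <- box (2 * K + 4)) G (alpha * l + r).
  by apply: eq_bigr => r _; rewrite big_mkcond.
have -> : \sum_(r <- residues) \sum_(l <- box (2 * K + 4)) G (alpha * l + r) =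
    \sum_(n <- [seq alpha * l + r | r <- residues, l <- box (2 * K + 4)]) G n.
  by rewrite big_allpairs_dep.
rewrite -[RHS]big_mkcond -[RHS]big_filter.
apply: perm_big; apply: uniq_perm; first exact: gnball_uniq.
  apply/filter_uniq/allpairs_uniq; rewrite ?residues_uniq ?box_uniq//.
  move=> [r l] [r' l'] /allpairsP hr /allpairsP hr' /= e.
  have {hr} q : gquot r = 0.
    by case: hr => -[u v] [+ _ [-> _]]; rewrite mem_residues => /eqP.
  have {hr'} q' : gquot r' = 0.
    by case: hr' => -[u v] [+ _ [-> _]]; rewrite mem_residues => /eqP.
  have := gquotD l r; rewrite e gquotD q q' !addr0 => ll; subst l'.
  by move: e => /addrI ->.
move=> n; rewrite mem_filter; case hn : (n \in gnball _); last by [].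
rewrite andTb; symmetry.
apply/allpairsP; exists (n - alpha * gquot n, gquot n).
have q0 : gquot (n - alpha * gquot n) = 0.
  have := gquotD (gquot n) (n - alpha * gquot n).
  by rewrite addrC subrK => /(congr1 (fun z => z - gquot n)); rewrite subrr addrC addKr.
split; [by rewrite mem_residues q0| |by rewrite [_.1]/(n - _) addrC subrK].
rewrite [_.2]/(gquot n).
have h := gquot0_gn q0; set l := gquot n in h *.
(* By the parallelogram inequality N(alpha l) <= 2 N(n) + 2 N(r), where N(n) <= N(alpha) K and N(r)
   < 2 N(alpha). *)
have nl : (gn l <= 2 * K + 4)%N.
  have par (x y : gaussInt) : (gn y <= 2 * gn x + 2 * gn (x - y))%N.
    have : gnorm y <= 2 * gnorm x + 2 * gnorm (x - y).
      case: x y => [a b] [c d]; rewrite goppE gaddE /gnorm /=.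
      by have := sqr_ge0 (2 * a - c); have := sqr_ge0 (2 * b - d); clear; lra.
    by rewrite -!gnE; lia.
  have ag : (0 < gn alpha)%N by rewrite gn_gt0.
  have := par n (alpha * l); move: hn h; rewrite mem_gnball gnM => /andP[_].
  move=> h1 h2 h3; rewrite -(leq_pmul2l ag) mulnDr mulnCA; lia.
rewrite mem_box; case/andP: (gn_coord l) => h1 h2.
by apply/andP; split; [apply: le_trans h1 _|apply: le_trans h2 _]; lia.
Qed.

End Scaling.

Section LatticeSums.
Variable R : realType.
Local Notation dir := (dir R).

Definition chisum (m K : nat) : R[i] := \sum_(n <- gnball K) dir n ^+ m.

Lemma big_gnball_gt (V : nmodType) m K (P : pred gaussInt) (F : gaussInt -> V) :
  (m <= K)%N -> \sum_(n <- gnball K | P n && (m < gn n)%N) F n =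
  \sum_(m.+1 <= k < K.+1) \sum_(n <- shell k | P n) F n.
Proof.
move=> mK; rewrite big_gnball (big_cat_nat (n := m.+1))//=.
rewrite big1_seq ?add0r; last first.
  move=> k; rewrite mem_index_iota => /andP[_ km]; rewrite big1_seq// => n.
  by rewrite mem_shell => /andP[/andP[_ h] /eqP e]; lia.
apply: eq_big_seq => k; rewrite mem_index_iota => /andP[mk _].
rewrite big_seq_cond [RHS]big_seq_cond; apply: eq_bigl => n.
by rewrite mem_shell; have [->|//] := eqVneq (gn n) k; rewrite mk andbT.
Qed.

Lemma gnball_abel (g : gaussInt -> R[i]) (P : pred gaussInt) (B phi : nat -> R) m K :
  (m < K)%N ->
  (forall j, (m < j <= K)%N ->
     nc (\sum_(n <- gnball j | P n && (m < gn n)%N) g n) <= B j) ->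
  (forall k, (m < k <= K)%N -> 0 <= phi k) ->
  (forall k, (m < k < K)%N -> phi k.+1 <= phi k) ->
  nc (\sum_(n <- gnball K | P n && (m < gn n)%N) (phi (gn n))%:C * g n) <=
    B m.+1 * phi m.+1 + \sum_(m.+2 <= k < K.+1) (B k - B k.-1) * phi k.
Proof.
move=> mK hB phi0 phid; rewrite big_gnball_gt ?(ltnW mK)//.
have -> : \sum_(m.+1 <= k < K.+1) \sum_(n <- shell k | P n) (phi (gn n))%:C * g n =
  \sum_(m.+1 <= k < K.+1) (phi k)%:C * \sum_(n <- shell k | P n) g n.
  apply: eq_bigr => k _; rewrite mulr_sumr big_seq_cond [RHS]big_seq_cond.
  by apply: eq_bigr => n; rewrite mem_shell => /andP[/eqP -> _].
apply: (@abel_majorant R _ B phi m.+1 K.+1).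
- by [].
- move=> j /andP[mj jK]; rewrite -big_gnball_gt; last by lia.
  by apply: hB; lia.
- by move=> k h; apply: phi0; lia.
- by move=> k h1 h2; apply: phid; lia.
Qed.

Lemma gnball_abel_linear (w : gaussInt -> R) (P : pred gaussInt) (C : R) (phi : nat -> R) K :
  (forall n, P n -> 0 <= w n) ->
  (forall j, (j <= K)%N -> \sum_(n <- gnball j | P n) w n <= C * j%:R) ->
  (forall k, (0 < k <= K)%N -> 0 <= phi k) ->
  (forall k, (0 < k < K)%N -> phi k.+1 <= phi k) ->
  \sum_(n <- gnball K | P n) phi (gn n) * w n <= C * \sum_(1 <= k < K.+1) phi k.
Proof.
move=> w0 wC phi0 phid; have [->|K0] := posnP K.
  by rewrite !big_geq// /gnball big_nil mulr0.
have e (F : gaussInt -> R) j : \sum_(n <- gnball j | P n) F n =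
    \sum_(n <- gnball j | P n && (0 < gn n)%N) F n.
  rewrite big_seq_cond [RHS]big_seq_cond; apply: eq_bigl => n.
  by rewrite mem_gnball; case: (0 < gn n)%N; rewrite ?andbT ?andbF.
apply: le_trans (ler_norm _) _; rewrite e -nc_real rmorph_sum /=.
have -> : \sum_(n <- gnball K | P n && (0 < gn n)%N) (phi (gn n) * w n)%:C =
    \sum_(n <- gnball K | P n && (0 < gn n)%N) (phi (gn n))%:C * (w n)%:C :> R[i].
  by apply: eq_bigr => n _; rewrite rmorphM.
apply: le_trans (@gnball_abel (fun n => (w n)%:C) P (fun j => C * j%:R) phi 0 K _ _ _ _) _.
- by [].
- move=> j /andP[j0 jK]; rewrite -rmorph_sum nc_real -e ger0_norm ?wC//.
  by apply: sumr_ge0 => n Pn; exact: w0.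
- by move=> k h; apply: phi0; lia.
- by move=> k h; apply: phid; lia.
rewrite [in leRHS]big_ltn// mulrDr mulr1 lerD2l mulr_sumr le_eqVlt; apply/orP; left.
apply/eqP; apply: eq_big_nat => k /andP[k1 _].
by case: k k1 => // k _; rewrite -mulrBr /= -natr1; ring.
Qed.

Lemma gnball_count_le j : \sum_(n <- gnball j) (1 : R) <= 30 * j%:R.
Proof. by rewrite big_const_seq count_predT iter_addr addr0 -[X in _ <= X * _]/(30%:R) -natrM ler_nat gnball_size_le. Qed.

Lemma gnball_sum_le (phi : nat -> R) K :
  (forall k, (0 < k <= K)%N -> 0 <= phi k) ->
  (forall k, (0 < k < K)%N -> phi k.+1 <= phi k) ->
  \sum_(n <- gnball K) phi (gn n) <= 30 * \sum_(1 <= k < K.+1) phi k.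
Proof.
move=> h1 h2; under eq_bigr do rewrite -[phi _]mulr1.
by apply: gnball_abel_linear => // j _; exact: gnball_count_le.
Qed.

Lemma annulus_count_real : exists2 C : R, 0 < C & forall A H : nat, (0 < A + H)%N ->
  (size [seq n <- gnball (A + H) | (A < gn n)%N])%:R <=
   C * Num.sqrt (A + H)%:R * (Num.sqrt H%:R + 1).
Proof.
exists 12 => // A H AH0.
have [s /andP[s1 s2]] := nat_sqrt_exists (A + H).
have [g /andP[g1 g2]] := nat_sqrt_exists H.
have h := annulus_count s2 g2.
have hs : s%:R <= Num.sqrt (A + H)%:R :> R.
  by rewrite -[leLHS]ger0_norm// -sqrtr_sqr ler_wsqrtr// -natrX ler_nat.
have hg : g%:R <= Num.sqrt H%:R :> R.
  by rewrite -[leLHS]ger0_norm// -sqrtr_sqr ler_wsqrtr// -natrX ler_nat.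
have s0 : (0 < s)%N by nia.
have : (size [seq n <- gnball (A + H) | (A < gn n)%N] <= 3 * s * (2 * (g + 1)))%N.
  by apply: leq_trans h _; apply: leq_mul; lia.
rewrite -(ler_nat R) => /le_trans; apply.
rewrite !natrM natrD.
have -> : 3 * s%:R * (2 * (g%:R + 1)) = 6 * (s%:R * (g%:R + 1)) :> R by ring.
have : s%:R * (g%:R + 1) <= Num.sqrt (A + H)%:R * (Num.sqrt H%:R + 1) :> R.
  by apply: ler_pM; rewrite ?addr_ge0// lerD2r.
have : 0 <= Num.sqrt (A + H)%:R * (Num.sqrt H%:R + 1) :> R.
  by rewrite mulr_ge0 ?addr_ge0 ?sqrtr_ge0.
rewrite -mulrA; lra.
Qed.

(* The number of lattice points that a bounded perturbation can move across the circle. *)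
Lemma near_circle_count : exists2 C : R, 0 < C & forall K : nat, (0 < K)%N ->
  (count (fun l => (l != 0) && (`|(gn l)%:R - K%:R| <= 3 * Num.sqrt K%:R + 3 :> R))
     (box (2 * K + 4)))%:R <= C * K%:R `^ (3 / 4).
Proof.
have [C C0 h] := annulus_count_real.
exists (C * 15 * 15) => [|K K0]; first by rewrite !mulr_gt0.
have [s /andP[s1 s2]] := nat_sqrt_exists K.
(* Since sqrt K <= s + 1, the norms to be counted differ from K by at most 3 s + 6; the interval
   from A + 1 to A + H covers them, also when the subtraction truncates to 0. *)
pose H := (2 * (3 * s + 6)).+1; pose A := (K - (3 * s + 7))%N.
have s0 : (0 < s)%N by nia.
have sK : s%:R <= Num.sqrt K%:R :> R.
  by rewrite -[leLHS]ger0_norm// -sqrtr_sqr ler_wsqrtr// -natrX ler_nat.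
have Ks : Num.sqrt K%:R <= s.+1%:R :> R.
  by rewrite -[leRHS]ger0_norm// -sqrtr_sqr ler_wsqrtr// -natrX ler_nat ltnW.
have AH : (K + 3 * s + 6 <= A + H)%N by rewrite /A /H; lia.
have sK' : (s <= K)%N by nia.
have AH2 : (A + H <= 19 * K)%N by rewrite /A /H; lia.
have HH : (H <= 19 * s)%N by rewrite /H; lia.
apply: le_trans (_ : (size [seq n <- gnball (A + H) | (A < gn n)%N])%:R <= _).
  rewrite ler_nat -size_filter; apply: uniq_leq_size.
    exact/filter_uniq/box_uniq.
  move=> l; rewrite !mem_filter mem_gnball -gn_gt0 ler_norml => /andP[/andP[l0 /andP[h1 h2]] _].
  have g1 : (gn l <= K + 3 * s + 6)%N.
    by rewrite -(ler_nat R) 2!natrD natrM; move: Ks; rewrite -natr1; lra.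
  have g2 : (K <= gn l + 3 * s + 6)%N.
    by rewrite -(ler_nat R) 2!natrD natrM; move: Ks; rewrite -natr1; lra.
  by rewrite /A; lia.
have AH0 : (0 < A + H)%N by lia.
apply: le_trans (h A H AH0) _.
have -> : K%:R `^ (3 / 4) = Num.sqrt K%:R * Num.sqrt (Num.sqrt K%:R) :> R.
  rewrite -!powR12_sqrt ?powR_ge0// -powRrM -powRD; last by rewrite pnatr_eq0 -lt0n K0 implybT.
  by congr (_ `^ _); field.
have e1 : Num.sqrt (A + H)%:R <= 15 * Num.sqrt K%:R :> R.
  have -> : 15 = Num.sqrt (15 ^+ 2) :> R by rewrite sqrtr_sqr ger0_norm.
  rewrite -sqrtrM ?sqr_ge0// ler_wsqrtr// -natrX -natrM ler_nat; lia.
have e2 : Num.sqrt H%:R + 1 <= 15 * Num.sqrt (Num.sqrt K%:R) :> R.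
  have k1 : 1 <= Num.sqrt (Num.sqrt K%:R) :> R.
    rewrite -[leLHS]sqrtr1 ler_wsqrtr// -[leLHS]sqrtr1 ler_wsqrtr// ler1n//.
  have : Num.sqrt H%:R <= 5 * Num.sqrt (Num.sqrt K%:R) :> R.
    have -> : 5 = Num.sqrt (5 ^+ 2) :> R by rewrite sqrtr_sqr ger0_norm.
    rewrite -sqrtrM ?sqr_ge0// ler_wsqrtr//.
    apply: le_trans (_ : 19 * s%:R <= _); first by rewrite -natrM ler_nat.
    by move: sK (ler0n R s); lra.
  by lra.
have -> : C * 15 * 15 * (Num.sqrt K%:R * Num.sqrt (Num.sqrt K%:R)) =
  C * ((15 * Num.sqrt K%:R) * (15 * Num.sqrt (Num.sqrt K%:R))) by ring.
rewrite -mulrA ler_pM2l//; apply: ler_pM => //; rewrite ?addr_ge0 ?sqrtr_ge0//.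
Qed.

End LatticeSums.

Section Scaling2.
Variable R : realType.
Local Notation dir := (dir R).
Local Notation chisum := (chisum R).

Lemma sum_inv_sqrt_gnball K : (0 < K)%N ->
  \sum_(n <- gnball K) (Num.sqrt (gn n)%:R)^-1 <= 60 * K%:R `^ (3 / 4) :> R.
Proof.
move=> K0; apply: le_trans (@gnball_sum_le R (fun k => (Num.sqrt k%:R)^-1) K _ _) _.
- by move=> k _; rewrite invr_ge0 sqrtr_ge0.
- move=> k /andP[k0 _]; rewrite lef_pV2 ?posrE ?sqrtr_gt0 ?ltr0n//.
  by rewrite ler_wsqrtr// ler_nat.
have -> : \sum_(1 <= k < K.+1) (Num.sqrt k%:R)^-1 =
    \sum_(1 <= k < K.+1) k%:R `^ (2^-1 - 1) :> R.
  apply: eq_big_nat => k /andP[k0 _].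
  by rewrite -powR12_sqrt// -powRN; congr (_ `^ _); field.
have half : 0 < (2^-1 : R) <= 1 by lra.
have h := sum_powR_le K half.
have : K%:R `^ 2^-1 <= K%:R `^ (3 / 4) :> R.
  by apply: ler_powR; [rewrite ler1n|lra].
by move: h; rewrite invrK; lra.
Qed.

Lemma nc_dirX_le1 n m : nc (dir n ^+ m) <= 1.
Proof. by rewrite ncX; apply: exprn_ile1; [exact: nc_ge0|exact: nc_dir_le1]. Qed.

(** Each n is written as alpha l + r, and r is then dropped. This changes the direction by O(1 /
    |l|) and moves only points close to the circle in or out of the ball, so up to a power saving
    every residue class contributes the same rescaled sum. *)
Lemma chisum_scaling : exists2 C : R, 0 < C &
  forall m K alpha, (0 < K)%N -> alpha != 0 ->
  nc (chisum m (gn alpha * K) -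
      (size (residues alpha))%:R * (dir alpha ^+ m * chisum m K)) <=
  (size (residues alpha))%:R * (C * m.+1%:R * K%:R `^ (3 / 4)).
Proof.
have [C C0 hC] := near_circle_count R.
(* 19 * 19 = 6 * 60 + 1: 6 * 60 from the changes of direction, 1 from the term l = 0; [C] pays for
   the points near the circle. *)
exists (C + 19 * 19) => [|m K alpha K0 al0]; first by rewrite addr_gt0// mulr_gt0.
set B := box (2 * K + 4).
have Kp1 : 1 <= K%:R `^ (3 / 4) :> R.
  by rewrite -[leLHS](powRr0 K%:R); apply: ler_powR; [rewrite ler1n|lra].
have -> : chisum m K = \sum_(l <- B | l \in gnball K) dir l ^+ m.
  rewrite /chisum -[RHS]big_filter; apply: perm_big; apply: uniq_perm.
  - exact: gnball_uniq.
  - exact/filter_uniq/box_uniq.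
  move=> l; rewrite mem_filter; case hl : (l \in gnball K) => //; symmetry.
  rewrite andTb mem_box; move: hl; rewrite mem_gnball => /andP[_ hl].
  case/andP: (gn_coord l) => h1 h2.
  by apply/andP; split; [apply: le_trans h1 _|apply: le_trans h2 _]; lia.
rewrite /chisum sum_residues// -/B.
have -> : (size (residues alpha))%:R *
    (dir alpha ^+ m * \sum_(l <- B | l \in gnball K) dir l ^+ m) =
    \sum_(r <- residues alpha) \sum_(l <- B | l \in gnball K) dir (alpha * l) ^+ m.
  rewrite big_const_seq count_predT iter_addr addr0 mulr_natl mulr_sumr.
  congr (_ *+ _); apply: eq_bigr => l _; rewrite dirM.
  by rewrite [RHS]exprMn.
rewrite -sumrB; apply: le_trans (nc_sum _ _ _) _.
have -> : (size (residues alpha))%:R * ((C + 19 * 19) * m.+1%:R * K%:R `^ (3 / 4)) =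
   \sum_(r <- residues alpha) ((C + 19 * 19) * m.+1%:R * K%:R `^ (3 / 4)) :> R.
  by rewrite big_const_seq count_predT iter_addr addr0 mulr_natl.
rewrite big_seq [leRHS]big_seq; apply: ler_sum => r.
rewrite mem_residues// => /eqP r0.
have rg := gquot0_gn al0 r0.
pose near (l : gaussInt) :=
  (l != 0) && (`|(gn l)%:R - K%:R| <= 3 * Num.sqrt K%:R + 3 :> R).
(* The three errors at [l]: the change of the m-th power of the direction, a change of membership in
   the ball, and the exceptional value [l = 0], where no direction is available. *)
pose e (l : gaussInt) : R := (if l \in gnball K then m%:R * 6 * (Num.sqrt (gn l)%:R)^-1 else 0)
  + (near l)%:R + (l == 0)%:R.
have pos (l : gaussInt) : 0 <= m%:R * 6 * (Num.sqrt (gn l)%:R)^-1 :> R.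
  by rewrite mulr_ge0 ?invr_ge0 ?sqrtr_ge0// mulr_ge0.
apply: le_trans (_ : \sum_(l <- B) e l <= _).
  rewrite big_mkcond [X in nc (_ - X)]big_mkcond -sumrB.
  apply: le_trans (nc_sum _ _ _) _; apply: ler_sum => l _.
  have ag : (0 < gn alpha)%N by rewrite gn_gt0.
  have e0 : 0 <= e l.
    by rewrite /e !addr_ge0//; case: ifP => // _; exact: pos.
  have [l0|l0] := eqVneq l 0.
    subst l; rewrite [X in _ - X]ifF ?subr0; last by rewrite mem_gnball gn0.
    rewrite /e eqxx; case: ifP => _; last by rewrite nc0 -/(e 0).
    apply: le_trans (nc_dirX_le1 _ _) _.
    by rewrite mem_gnball gn0 /near eqxx /= !add0r.
  have lg : (0 < gn l)%N by rewrite gn_gt0.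
  have z0 : alpha * l + r != 0.
    apply: contra_neq l0 => z0; have := gquotD al0 l r.
    have q0 : gquot alpha 0 = 0.
      by rewrite /gquot mul0r !div0z.
    by rewrite z0 q0 r0 addr0.
  have w0 : alpha * l != 0 by rewrite gmulf_eq0 negb_or al0 l0.
  have k0 : 0 < Num.sqrt (gn alpha)%:R :> R by rewrite sqrtr_gt0 ltr0n.
  have l0' : 0 < Num.sqrt (gn l)%:R :> R by rewrite sqrtr_gt0 ltr0n.
  have rr : nc (gaussC R r) <= 3 / 2 * Num.sqrt (gn alpha)%:R.
    rewrite nc_gCE; have -> : 3 / 2 = Num.sqrt ((3 / 2) ^+ 2) :> R.
      by rewrite sqrtr_sqr ger0_norm//; lra.
    rewrite -sqrtrM ?sqr_ge0// ler_wsqrtr//.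
    have : (gn r)%:R <= 2 * (gn alpha)%:R :> R by rewrite -natrM ler_nat mul2n ltnW.
    have : 0 <= (gn alpha)%:R :> R by [].
    by lra.
  have wE : nc (gaussC R (alpha * l)) = Num.sqrt (gn alpha)%:R * Num.sqrt (gn l)%:R.
    by rewrite nc_gCE gnM natrM sqrtrM.
  have diff : nc (gaussC R (alpha * l + r) - gaussC R (alpha * l)) = nc (gaussC R r).
    by rewrite gCD addrC addKr.
  have memz : (alpha * l + r \in gnball (gn alpha * K)) = (gn (alpha * l + r) <= gn alpha * K)%N.
    by rewrite mem_gnball gn_gt0 z0.
  have meml : (l \in gnball K) = (gn l <= K)%N by rewrite mem_gnball lg.
  (* As |r| <= 3/2 |alpha|, a change of membership forces |l| to be within 3/2 of sqrt K, and hence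
     the norm of [l] to be within 3 sqrt K + 9/4 of K. *)
  have nearl : (alpha * l + r \in gnball (gn alpha * K)) != (l \in gnball K) -> near l.
    move=> hne; rewrite /near l0 /=.
    have t1 := nc_le_sub (gaussC R (alpha * l)) (gaussC R (alpha * l + r)).
    have t2 := nc_le_sub (gaussC R (alpha * l + r)) (gaussC R (alpha * l)).
    rewrite nc_subC diff wE nc_gCE in t1; rewrite diff wE nc_gCE in t2.
    move: hne; rewrite memz meml -(ler_nat R (gn l)) -(ler_nat R (gn _)) natrM.
    have sq1 : Num.sqrt (gn l)%:R ^+ 2 = (gn l)%:R :> R by rewrite sqr_sqrtr.
    have sqK : Num.sqrt K%:R ^+ 2 = K%:R :> R by rewrite sqr_sqrtr.
    have sK0 : 0 <= Num.sqrt K%:R :> R := sqrtr_ge0 _.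
    have hle (x y : R) : 0 <= x -> 0 <= y -> (x <= y) = (Num.sqrt x <= Num.sqrt y).
      by move=> x0 y0; rewrite ler_sqrt.
    rewrite (hle (gn (_ + _))%:R) ?mulr_ge0// (sqrtrM K%:R)//.
    rewrite (hle (gn l)%:R)//.
    move: t1 t2 rr; set a := Num.sqrt (gn alpha)%:R; set b := Num.sqrt (gn l)%:R.
    set c := Num.sqrt K%:R; set z := Num.sqrt (gn (alpha * l + r))%:R => t1 t2 rr.
    rewrite -sq1 -sqK -/b -/c => hne.
    have bc : `|b - c| <= 3 / 2.
      rewrite ler_norml; apply/andP; move: hne; rewrite -/a in k0.
      have [z1|z1] := leP z (a * c); have [b1|b1] := leP b c => // _.
        have : a * b <= a * (c + 3 / 2) by rewrite mulrDr; lra.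
        by rewrite ler_pM2l// => h; split; lra.
      have : a * c <= a * (b + 3 / 2) by rewrite mulrDr; lra.
      by rewrite ler_pM2l// => h; split; lra.
    have -> : b ^+ 2 - c ^+ 2 = (b - c) * (2 * c + (b - c)) by ring.
    rewrite normrM.
    have : `|2 * c + (b - c)| <= 2 * c + 3 / 2.
      apply: le_trans (ler_normD _ _) _; rewrite ger0_norm ?mulr_ge0// lerD2l//.
    move=> h; apply: le_trans (ler_pM _ _ bc h) _ => //; lra.
  have [hz|hz] := boolP (alpha * l + r \in _); have [hl|hl] := boolP (l \in gnball K).
  - rewrite /e hl (negbTE l0) addr0.
    apply: le_trans (nc_expB _ (nc_dir_le1 _ _) (nc_dir_le1 _ _)) _.
    have := nc_dirB R z0 w0; rewrite diff wE => h.
    apply: le_trans (_ : m%:R * (6 * (Num.sqrt (gn l)%:R)^-1) <= _); last first.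
      by rewrite mulrA lerDl.
    apply: ler_wpM2l => //; apply: le_trans h _; rewrite ler_pdivrMr ?mulr_gt0//.
    have -> : 6 / Num.sqrt (gn l)%:R * (Num.sqrt (gn alpha)%:R * Num.sqrt (gn l)%:R) =
      6 * Num.sqrt (gn alpha)%:R * (Num.sqrt (gn l)%:R / Num.sqrt (gn l)%:R) :> R.
      by ring.
    rewrite divff ?gt_eqF// mulr1; lra.
  - have nl : near l by apply: nearl; rewrite hz (negbTE hl).
    rewrite subr0; apply: le_trans (nc_dirX_le1 _ _) _.
    by rewrite /e (negbTE hl) nl (negbTE l0) add0r addr0.
  - have nl : near l by apply: nearl; rewrite hl (negbTE hz).
    rewrite sub0r ncN; apply: le_trans (nc_dirX_le1 _ _) _.
    rewrite /e hl nl (negbTE l0) addr0 lerDr.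
    exact: pos.
  - by rewrite subr0 nc0.
rewrite /e !big_split /= -[X in X + _ + _]big_mkcond /=.
have b1 : \sum_(l <- B | l \in gnball K) m%:R * 6 * (Num.sqrt (gn l)%:R)^-1 <=
    m%:R * (6 * 60) * K%:R `^ (3 / 4) :> R.
  rewrite -mulr_sumr.
  have -> : m%:R * (6 * 60) * K%:R `^ (3 / 4) = m%:R * 6 * (60 * K%:R `^ (3 / 4)) :> R by ring.
  apply: ler_wpM2l; first by rewrite mulr_ge0.
  apply: le_trans (sum_inv_sqrt_gnball K0).
  rewrite -big_filter le_eqVlt; apply/orP; left; apply/eqP; apply: perm_big.
  apply: uniq_perm; [exact/filter_uniq/box_uniq|exact: gnball_uniq|].
  move=> l; rewrite mem_filter; case hl : (l \in gnball K) => //.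
  rewrite andTb mem_box; move: hl; rewrite mem_gnball => /andP[_ hl].
  case/andP: (gn_coord l) => h1 h2.
  by apply/andP; split; [apply: le_trans h1 _|apply: le_trans h2 _]; lia.
have cnt (Q : pred gaussInt) : \sum_(l <- B) (Q l)%:R = (count Q B)%:R :> R.
  by rewrite -sum1_count natr_sum [RHS]big_mkcond; apply: eq_bigr => l _; case: (Q l).
have b2 : \sum_(l <- B) (near l)%:R <= C * K%:R `^ (3 / 4) :> R.
  by rewrite cnt hC.
have b3 : \sum_(l <- B) (l == 0)%:R <= 1 :> R.
  by rewrite (cnt (pred1 0)) lern1 count_uniq_mem ?box_uniq//; case: (_ \in _).
have m1 : m.+1%:R = m%:R + 1 :> R by rewrite natr1.
have m0 : 0 <= m%:R :> R by [].
rewrite m1; move: b1 b2 b3 Kp1 C0 m0.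
move: (\sum_(l <- B | _) _) (\sum_(l <- B) (near l)%:R) (\sum_(l <- B) (l == 0)%:R) => x y z.
move: (K%:R `^ (3 / 4)) (m%:R : R) => k M b1 b2 b3 Kp1 C0 m0.
have : 0 <= C * M * k by rewrite !mulr_ge0//; lra.
have : 0 <= M * k by rewrite mulr_ge0//; lra.
lra.
Qed.

End Scaling2.

Section LatticeResults.
Variable R : realType.
Local Notation dir := (dir R).
Local Notation chisum := (chisum R).

Definition gcount (K : nat) : R := (size (gnball K))%:R.

(** Conjugation permutes the ball and conjugates every summand. This reality is what turns the
    scaling relation into a bound in [chisum_bound]. *)
Lemma chisum_real m K : Im (chisum m K) = 0.
Proof.
have e : (chisum m K)^*%C = chisum m K.
  have -> : (chisum m K)^*%C = \sum_(n <- gnball K) (dir n ^+ m)^*%C.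
    by rewrite /chisum rmorph_sum.
  have inv : involutive gconj by case=> a b; rewrite /gconj /= opprK.
  have -> : \sum_(n <- gnball K) (dir n ^+ m)^*%C =
      \sum_(n <- [seq gconj n | n <- gnball K]) dir n ^+ m.
    by rewrite big_map; apply: eq_bigr => n _; rewrite dir_conj rmorphXn.
  apply: perm_big; apply: uniq_perm.
  - by rewrite map_inj_uniq ?gnball_uniq//; exact: inv_inj.
  - exact: gnball_uniq.
  have gnc n : gn (gconj n) = gn n by rewrite /gn gnorm_conj.
  move=> n; apply/mapP/idP => [[k hk ->]|hn].
    by move: hk; rewrite !mem_gnball gnc.
  by exists (gconj n); rewrite ?inv// mem_gnball gnc -mem_gnball.
by move: e; case: (chisum m K) => a b [] /= e; lra.
Qed.

Lemma residues_size_gt0 alpha : alpha != 0 -> (0 < size (residues alpha))%N.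
Proof.
move=> al0; have : 0 \in residues alpha by rewrite mem_residues// /gquot mul0r /= !div0z.
by case: (residues alpha).
Qed.

(* With [dir (m + i) = expi theta] one has [sin theta <= theta <= tan theta = 1 / m]. *)
Lemma im_dir_exp m : (0 < m)%N -> 1 / 2 <= Im (dir (m%:Z +i* 1) ^+ m).
Proof.
move=> m0; pose al : gaussInt := m%:Z +i* 1.
have al0 : al != 0 by rewrite -gn_gt0 /gn /gnorm /=; lia.
have mR : 1 <= m%:R :> R by rewrite ler1n.
have nE : nc (gaussC R al) = Num.sqrt (m%:R ^+ 2 + 1).
  by rewrite nc_gCE; congr Num.sqrt; rewrite -nc_gC ncE /= expr1n.
set r := Num.sqrt _ in nE.
have r2 : r ^+ 2 = m%:R ^+ 2 + 1 by rewrite sqr_sqrtr// addr_ge0// sqr_ge0.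
have r0 : 0 < r by rewrite sqrtr_gt0 ltr_wpDl// sqr_ge0.
pose th := carg (gaussC R al).
have dE : dir al = expi th by rewrite dir_expi.
have [cE sE] : cos th = m%:R / r /\ sin th = r^-1.
  have : dir al = expi th by [].
  by rewrite /dir nE /expi /GRing.mul /= !mul0r subr0 addr0 mulr1 mulrC => -[<- <-].
have th0 : 0 <= th <= pi.
  rewrite /th /carg ifT// nE; set x := Re _ / r.
  have xE : x = m%:R / r by [].
  have u1 : -1 <= x <= 1.
    have h : 0 <= x by rewrite xE divr_ge0// ltW.
    rewrite (le_trans _ h) ?lerN10//= xE ler_pdivrMr// mul1r.
    by rewrite -(@ler_pXn2r _ 2)// ?nnegrE ?(ltW r0)// r2 lerDl.
  by rewrite acos_ge0// acos_lepi.
have [t0 tpi] := andP th0.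
have h1 := mul_cos_le_sin th0; have h2 := sin_le t0.
have mth : m%:R * th <= 1.
  move: h1; rewrite cE sE mulrA -[leRHS]mul1r ler_pM2r ?invr_gt0// mulrC.
  by [].
have mth2 : 2 / 3 <= m%:R * th.
  have : m%:R / r <= m%:R * th by apply: ler_wpM2l; rewrite // -sE.
  apply: le_trans; rewrite ler_pdivlMr//.
  rewrite -(@ler_pXn2r _ 2)// ?nnegrE ?mulr_ge0 ?(ltW r0)// exprMn r2.
  have : 1 <= m%:R ^+ 2 :> R by rewrite exprn_ege1.
  by lra.
have -> : Im (dir (m%:Z +i* 1) ^+ m) = sin (m%:R * th).
  by rewrite -/al dE -expi_mulrn.
move: (m%:R * th) mth mth2 => x x1 x2.
have x0 : 0 <= x by lra.
have := sin_ge x0; have : x ^+ 3 <= x by rewrite exprS ger_pMr ?expr_le1//; lra.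
by lra.
Qed.

(** In the scaling relation for alpha = m + i both character sums are real, but the factor
    [dir alpha ^+ m] has imaginary part at least 1/2. The imaginary part of the relation therefore
    bounds the sum by twice the error; the number of residues cancels. *)
Lemma chisum_bound : exists2 C : R, 0 < C &
  forall m K, (0 < m)%N -> (0 < K)%N -> nc (chisum m K) <= C * m.+1%:R * K%:R `^ (3 / 4).
Proof.
have [C C0 h] := chisum_scaling R.
exists (2 * C) => [|m K m0 K0]; first by rewrite mulr_gt0.
pose al : gaussInt := m%:Z +i* 1.
have al0 : al != 0 by rewrite -gn_gt0 /gn /gnorm /=; lia.
have := h m K al K0 al0; set w := size _.
have w0 : 0 < w%:R :> R by rewrite ltr0n residues_size_gt0.
move=> hh; have := le_trans (Im_le_nc _) hh.
rewrite ImD.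
have -> : forall z : R[i], Im (- z) = - Im z by case.
rewrite chisum_real sub0r normrN.
have -> : (w%:R : R[i]) = (w%:R)%:C by rewrite rmorph_nat.
rewrite ImZ ImM chisum_real mulr0 add0r normrM (ger0_norm (ltW w0)) ler_pM2l//.
have ncS : nc (chisum m K) = `|Re (chisum m K)|.
  have := ncE (chisum m K); rewrite chisum_real expr0n addr0 => e.
  by rewrite -[LHS]ger0_norm ?nc_ge0// -[LHS]sqrtr_sqr e sqrtr_sqr.
rewrite normrM -ncS; have := im_dir_exp m0; rewrite -/al => i1.
rewrite ger0_norm; last by lra.
have : 0 <= nc (chisum m K) by exact: nc_ge0.
move: (nc _) (Im _) i1 => x y i1 x0 hxy.
have : 2^-1 * x <= y * x by apply: ler_wpM2r => //; lra.
by lra.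
Qed.

Lemma chisum0 K : chisum 0 K = (gcount K)%:C.
Proof.
rewrite /chisum /gcount rmorph_nat -sum1_size natr_sum.
by apply: eq_bigr => n _; rewrite expr0.
Qed.

Lemma residues_int L : (0 < L)%N -> size (residues (L%:Z +i* 0)) = (L ^ 2)%N.
Proof.
move=> L0; pose al : gaussInt := L%:Z +i* 0.
have al0 : al != 0 by rewrite -gn_gt0 /gn /gnorm /=; lia.
have -> : size (residues al) =
    size [seq ((a%:Z +i* b%:Z) : gaussInt) | a <- iota 0 L, b <- iota 0 L].
  apply: perm_size; apply: uniq_perm; first exact: residues_uniq.
    apply: allpairs_uniq; rewrite ?iota_uniq//.
    by move=> [a b] [c d] _ _ /= [-> ->].
  have qE (x y : int) : gquot al (x +i* y) = (x %/ L%:Z)%Z +i* (y %/ L%:Z)%Z.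
    rewrite /gquot /gconj gmulE /gnorm /= !(expr0n, oppr0, mulr0, addr0, add0r, subr0) /=.
    by rewrite expr2 !divzMpr ?ltz_nat.
  move=> n; rewrite mem_residues//; apply/eqP/allpairsP.
    case: n => x y; rewrite qE => -[hx hy]; exists (`|x|%N, `|y|%N) => /=.
    have := divz_eq x L%:Z; have := divz_eq y L%:Z.
    have := modz_ge0 x (_ : L%:Z != 0); have := modz_ge0 y (_ : L%:Z != 0).
    have := ltz_pmod x (_ : 0 < L%:Z); have := ltz_pmod y (_ : 0 < L%:Z).
    rewrite hx hy !mul0r !add0r => h1 h2 h3 h4 e1 e2.
    have x0 : 0 <= x < L%:Z by rewrite {1 2}e2 h4 ?h2//; lia.
    have y0 : 0 <= y < L%:Z by rewrite {1 2}e1 h3 ?h1//; lia.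
    by split; rewrite ?mem_iota; [lia|lia|congr (_ +i* _); lia].
  case=> -[a b] /= []; rewrite !mem_iota !add0n => ha hb ->; rewrite qE.
  by rewrite !divz_small//=; lia.
by rewrite size_allpairs !size_iota mulnn.
Qed.

Lemma gcount_mono K L : (K <= L)%N -> gcount K <= gcount L.
Proof.
move=> KL; rewrite ler_nat; apply: uniq_leq_size; first exact: gnball_uniq.
by move=> n; rewrite !mem_gnball; lia.
Qed.

Lemma gcount_le K : gcount K <= 30 * K%:R.
Proof. by rewrite -natrM ler_nat gnball_size_le. Qed.

Lemma gcount_ge K : K%:R <= 8 * gcount K.
Proof.
rewrite -natrM ler_nat.
have [s /andP[s1 s2]] := nat_sqrt_exists K.
have [->//|K0] := posnP K.
have s0 : (0 < s)%N by nia.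
(* With t close to 2 s / 3, the square of points with both coordinates from 1 to t lies in the ball
   and has more than K / 8 points. For s <= 2 the four units suffice. *)
have [t [t1 t2]] : exists t, (2 * t ^ 2 <= s ^ 2 /\ (s.+1 ^ 2 <= 8 * t ^ 2 \/ s = 1 \/ s = 2))%N.
  exists (2 * s %/ 3)%N; split.
    have := leq_trunc_div (2 * s) 3; nia.
  have [h|h] := leqP s 2; first by right; lia.
  left; have := ltn_ceil (2 * s) (isT : 0 < 3)%N; nia.
pose L := [seq ((a%:Z +i* b%:Z) : gaussInt) | a <- iota 1 t, b <- iota 1 t].
have szL : (size L = t ^ 2)%N by rewrite size_allpairs !size_iota mulnn.
have : (t ^ 2 <= size (gnball K))%N.
  rewrite -szL; apply: uniq_leq_size.
    by apply: allpairs_uniq; rewrite ?iota_uniq// => -[a b] [c d] _ _ /= [-> ->].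
  move=> n /allpairsP[[a b] /= []]; rewrite !mem_iota => ha hb ->.
  rewrite mem_gnball; have -> : gn (a%:Z +i* b%:Z) = (a ^ 2 + b ^ 2)%N by exact: absz_sqrD.
  nia.
have : (4 <= size (gnball K))%N.
  have -> : 4%N = size [:: (1 : gaussInt); -1; gI; - gI] by [].
  apply: uniq_leq_size => // n; rewrite !inE mem_gnball.
  by case/or4P => /eqP -> ; rewrite K0.
nia.
Qed.

End LatticeResults.

Lemma sqr_succ_le s : (0 < s)%N -> (s.+1 ^ 2 <= s ^ 2 + 3 * s)%N.
Proof. by rewrite -(addn1 s) sqrnD; lia. Qed.

Section CountAsymptotics.
Variable R : realType.
Local Notation gcount := (gcount R).

(** No area is computed. Scaling by the integer j compares the density [rho k] with [rho (j * k)];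
    so any two densities, each with its error bar, are compatible, and [c] is the infimum of the
    upper ends. Monotonicity of the count extends the estimate from squares to all K. *)
Lemma gcount_asymptotic : exists c C : R, [/\ 0 < c, 0 < C &
  forall K, `|gcount K - c * K%:R| <= C * K%:R `^ (3 / 4)].
Proof.
have [C C0 hC] := chisum_scaling R.
have scal L K : (0 < L)%N -> (0 < K)%N ->
    `|gcount (L ^ 2 * K) - (L ^ 2)%:R * gcount K| <= (L ^ 2)%:R * (C * K%:R `^ (3 / 4)).
  move=> L0 K0; have al0 : (L%:Z +i* 0 : gaussInt) != 0.
    by rewrite -gn_gt0 /gn /gnorm /=; lia.
  have := hC 0%N K _ K0 al0; rewrite residues_int// expr0 mul1r mulr1.
  have -> : gn (L%:Z +i* 0) = (L ^ 2)%N.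
    by have := absz_sqrD L%:Z 0; rewrite addn0.
  rewrite !chisum0; have -> : ((L ^ 2)%:R : R[i]) = (((L ^ 2)%:R : R))%:C by rewrite rmorph_nat.
  by rewrite -rmorphM -rmorphB nc_real.
pose e j : R := C * (j ^ 2)%:R `^ (3 / 4) / (j ^ 2)%:R.
pose rho j : R := gcount (j ^ 2) / (j ^ 2)%:R.
have rr j k : (0 < j)%N -> (0 < k)%N -> `|rho (j * k)%N - rho k| <= e k.
  move=> j0 k0; have j2 : 0 < (j ^ 2)%:R :> R by rewrite ltr0n expn_gt0 j0.
  have k2 : 0 < (k ^ 2)%:R :> R by rewrite ltr0n expn_gt0 k0.
  have k20 : (0 < k ^ 2)%N by rewrite expn_gt0 k0.
  have -> : rho (j * k)%N - rho k =
     (gcount (j ^ 2 * k ^ 2) - (j ^ 2)%:R * gcount (k ^ 2)) / ((j ^ 2)%:R * (k ^ 2)%:R).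
    rewrite /rho expnMn natrM mulrBl; congr (_ - _).
    by rewrite invfM mulrACA divff ?gt_eqF// mul1r.
  rewrite normrM [X in _ * X]gtr0_norm ?invr_gt0 ?mulr_gt0//.
  rewrite ler_pdivrMr ?mulr_gt0//; apply: le_trans (scal j (k ^ 2)%N j0 k20) _.
  have -> : e k * ((j ^ 2)%:R * (k ^ 2)%:R) =
      (j ^ 2)%:R * (C * (k ^ 2)%:R `^ (3 / 4)) * ((k ^ 2)%:R / (k ^ 2)%:R).
    by rewrite /e; ring.
  by rewrite divff ?mulr1// gt_eqF.
have cmp j k : (0 < j)%N -> (0 < k)%N -> rho j - e j <= rho k + e k.
  move=> j0 k0; have := rr j k j0 k0; have := rr k j k0 j0.
  rewrite mulnC !ler_norml => /andP[h1 h2] /andP[h3 h4]; lra.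
pose A := [set x : R | exists2 k, (0 < k)%N & x = rho k + e k].
have A0 : A !=set0 by exists (rho 1 + e 1); exists 1%N.
have Alb j : (0 < j)%N -> lbound A (rho j - e j).
  by move=> j0 x [k k0 ->]; exact: cmp.
have hlb : has_lbound A by exists (rho 1 - e 1); exact: Alb.
pose c := inf A.
have cge j : (0 < j)%N -> rho j - e j <= c by move=> j0; apply: lb_le_inf => //; exact: Alb.
have cle j : (0 < j)%N -> c <= rho j + e j.
  by move=> j0; apply: ge_inf => //; exists j.
have c8 : 1 / 8 <= c.
  apply: lb_le_inf => // x [k k0 ->].
  have k2 : 0 < (k ^ 2)%:R :> R by rewrite ltr0n expn_gt0 k0.
  have : 1 / 8 <= rho k by rewrite /rho ler_pdivlMr//; have := gcount_ge R (k ^ 2); lra.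
  have : 0 <= e k by rewrite /e !mulr_ge0 ?invr_ge0 ?powR_ge0// ltW.
  by lra.
have sq j : (0 < j)%N -> `|gcount (j ^ 2) - c * (j ^ 2)%:R| <= C * (j ^ 2)%:R `^ (3 / 4).
  move=> j0; have k2 : 0 < (j ^ 2)%:R :> R by rewrite ltr0n expn_gt0 j0.
  have h1 := cge j j0; have h2 := cle j j0.
  have -> : gcount (j ^ 2) - c * (j ^ 2)%:R = (rho j - c) * (j ^ 2)%:R.
    by rewrite mulrBl /rho divfK// gt_eqF.
  have -> : C * (j ^ 2)%:R `^ (3 / 4) = e j * (j ^ 2)%:R by rewrite /e divfK// gt_eqF.
  rewrite normrM [X in _ * X]gtr0_norm// ler_pM2r// ler_norml.
  by apply/andP; split; lra.
exists c, (3 * c + 4 * C); split; [lra|lra|move=> K].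
have [->|K0] := posnP K.
  have -> : gcount 0 = 0 by [].
  by rewrite mulr0 subr0 normr0 mulr_ge0 ?powR_ge0//; lra.
have [s /andP[s1 s2]] := nat_sqrt_exists K.
have s0 : (0 < s)%N by nia.
have K1 : 1 <= K%:R :> R by rewrite ler1n.
have b1 := sq s s0; have b2 := sq s.+1 isT.
have m1 := gcount_mono R s1; have m2 := gcount_mono R (ltnW s2).
have p1 : (s ^ 2)%:R `^ (3 / 4) <= K%:R `^ (3 / 4) :> R.
  by apply: ge0_ler_powR; rewrite ?nnegrE ?ler_nat//; lra.
have p2 : (s.+1 ^ 2)%:R `^ (3 / 4) <= 4 * K%:R `^ (3 / 4) :> R.
  apply: le_trans (_ : (4 * K%:R) `^ (3 / 4) <= _).
    apply: ge0_ler_powR; [lra|by rewrite nnegrE|by rewrite nnegrE mulr_ge0|].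
    by rewrite -natrM ler_nat; nia.
  rewrite powRM// ler_wpM2r ?powR_ge0//.
  by rewrite -[leRHS]powRr1//; apply: ler_powR; lra.
have p3 : s%:R <= K%:R `^ (3 / 4) :> R.
  apply: le_trans (_ : K%:R `^ (2^-1) <= _); last by apply: ler_powR => //; lra.
  rewrite powR12_sqrt// -[leLHS]ger0_norm// -sqrtr_sqr ler_wsqrtr// -natrX ler_nat//.
have q1 : (s ^ 2)%:R <= K%:R :> R by rewrite ler_nat.
have q2 : (s.+1 ^ 2)%:R <= (s ^ 2)%:R + 3 * s%:R :> R.
  by rewrite -natrM -natrD ler_nat sqr_succ_le.
have q3 : K%:R <= (s.+1 ^ 2)%:R :> R by rewrite ler_nat ltnW.
move: b1 b2; rewrite !ler_norml => /andP[b1 b1'] /andP[b2 b2'].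
have c0 : 0 <= c by lra.
have w1 := ler_wpM2l c0 q1; have w2 := ler_wpM2l c0 q2; have w3 := ler_wpM2l c0 q3.
have w4 := ler_wpM2l c0 p3; have w5 := ler_wpM2l (ltW C0) p1.
have w6 := ler_wpM2l (ltW C0) p2.
have w7 : 0 <= C * K%:R `^ (3 / 4) by rewrite mulr_ge0 ?powR_ge0// ltW.
apply/andP; split; lra.
Qed.

End CountAsymptotics.

(** * Chebyshev's upper bound for rational and Gaussian primes *)

Section Chebyshev.
Variable R : realType.

Lemma prod_primes_dvd (s : seq nat) N : uniq s -> all prime s ->
  all (fun q => q %| N)%N s -> (\prod_(q <- s) q %| N)%N.
Proof.
elim: s => [|q s IH] /=; first by rewrite big_nil dvd1n.
case/andP => qs us /andP[pq ps] /andP[qN sN].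
rewrite big_cons Gauss_dvd ?qN ?IH//.
rewrite big_seq; elim/big_ind: _ => [|x y hx hy|i hi]; first exact: coprimen1.
  by rewrite coprimeMr hx.
rewrite prime_coprime// dvdn_prime2//; last exact: (allP ps).
by apply: contraNneq qs => ->.
Qed.

Lemma central_bin_le n : ('C(n.*2, n) <= 2 ^ n.*2)%N.
Proof.
have -> : (2 ^ n.*2 = \sum_(i < n.*2.+1) 'C(n.*2, i))%N.
  rewrite -[2%N]/(1 + 1)%N expnDn; apply: eq_bigr => i _.
  by rewrite !exp1n !muln1.
have h : (n < n.*2.+1)%N by lia.
by rewrite (bigD1 (Ordinal h)) //= leq_addr.
Qed.

Definition theta (n : nat) : R := \sum_(1 <= q < n.+1 | prime q) ln q%:R.

(** The product of the primes between n + 1 and 2 n divides the central binomial coefficient, which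
    is at most 2^(2 n). *)
Lemma theta_double n : theta n.*2 <= theta n + n.*2%:R * ln 2.
Proof.
have nn : (n.+1 <= n.*2.+1)%N by lia.
rewrite /theta (big_cat_nat (n := n.+1))//= lerD2l.
pose s := [seq q <- index_iota n.+1 n.*2.+1 | prime q].
have -> : \sum_(n.+1 <= q < n.*2.+1 | prime q) ln q%:R = ln (\prod_(q <- s) q)%N%:R :> R.
  rewrite -[LHS]big_filter -/s; have : all prime s by exact: filter_all.
  elim: s => [|q s IH] /=; first by rewrite !big_nil ln1.
  case/andP => pq ps; rewrite !big_cons natrM IH// lnM// posrE ltr0n.
    exact: prime_gt0.
  by rewrite big_seq prodn_cond_gt0// => i /(allP ps)/prime_gt0.
have hd : (\prod_(q <- s) q %| 'C(n.*2, n))%N.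
  apply: prod_primes_dvd; [exact/filter_uniq/iota_uniq|exact: filter_all|].
  apply/allP => q; rewrite mem_filter mem_index_iota => /andP[pq /andP[q1 q2]].
  have n2 : (n <= n.*2)%N by lia.
  have := bin_fact n2; have -> : (n.*2 - n = n)%N by lia.
  have qf : (q %| n.*2 `!)%N by apply: dvdn_fact; rewrite prime_gt0.
  have qn : coprime q (n`! * n`!).
    rewrite prime_coprime// Euclid_dvdM// orbb; apply/negP.
    rewrite fact_prod big_seq; elim/big_ind: _ => [|x y hx hy|i].
    - by rewrite dvdn1; move: (prime_gt1 pq) => /[swap] /eqP ->.
    - by rewrite Euclid_dvdM// => /orP[].
    - by rewrite mem_index_iota => hi /dvdn_leq; lia.
  by move=> e; rewrite -(Gauss_dvdl _ qn) e.
have s0 : (0 < \prod_(q <- s) q)%N.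
  by rewrite big_seq prodn_cond_gt0// => i; rewrite mem_filter => /andP[/prime_gt0].
have : (\prod_(q <- s) q <= 2 ^ n.*2)%N.
  apply: leq_trans (central_bin_le n); apply: dvdn_leq hd.
  by rewrite bin_gt0; lia.
rewrite -(ler_nat R) natrX => h; rewrite mulr_natl -lnXn// ler_ln// posrE ?exprn_gt0//.
by rewrite ltr0n.
Qed.

Lemma theta_mono m n : (m <= n)%N -> theta m <= theta n.
Proof.
move=> mn; have mn' : (m.+1 <= n.+1)%N by [].
rewrite /theta [leRHS](big_cat_nat (n := m.+1))//= lerDl sumr_ge0// => q /prime_gt0 q0.
by rewrite ln_ge0// ler1n.
Qed.

Lemma ln2_le1 : ln 2 <= 1 :> R.
Proof. by have := @ln_le_sub1 R 2 (ltr0n _ _); lra. Qed.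

Lemma theta_le n : theta n <= 4 * n%:R.
Proof.
have [k] := ubnP n; elim: k n => // k IH n nk.
have [n1|n1] := leqP n 1.
  rewrite /theta big1_seq ?mulr_ge0// => q; rewrite mem_index_iota => /andP[/prime_gt1]; lia.
(* With m the upper half of n, the doubling bound gives 4 m + 2 m = 6 m, which is at most 4 n as
   soon as n >= 2. *)
have [m [hm mk m1 m2]] : exists m, [/\ (n <= m.*2)%N, (m < k)%N, (0 < m)%N & (m.*2 * 3 <= 4 * n)%N].
  by exists (uphalf n); split; have := odd_double_half n; rewrite uphalf_half; lia.
apply: le_trans (theta_mono hm) _; apply: le_trans (theta_double m) _.
have h1 := IH m mk.
have h2 : m.*2%:R * ln 2 <= m.*2%:R * 1 :> R by apply: ler_wpM2l => //; exact: ln2_le1.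
have h3 : 3 * m.*2%:R <= 4 * n%:R :> R by rewrite -!natrM ler_nat mulnC.
have h4 : m.*2%:R = 2 * m%:R :> R by rewrite -mul2n natrM.
lra.
Qed.

(** [p] divides its norm, the product of [p] and its conjugate, hence one of the rational prime
    factors of that norm. *)
Lemma cprime_dvd_rational p : cprime p ->
  exists q : nat, [/\ prime q, (q <= gn p)%N & gdvd p (q%:Z +i* 0)].
Proof.
move=> cp; have pp := cprime_gprime cp.
suff H n : (1 < n)%N -> gdvd p (n%:Z +i* 0) ->
    exists q : nat, [/\ prime q, (q <= n)%N & gdvd p (q%:Z +i* 0)].
  apply: H; first exact: gprime_gn.
  by exists (gconj p); rewrite gmul_conj -gnE.
have [k] := ubnP n; elim: k n => // k IH n nk n1 pn.
have pd := pdiv_prime n1; have [qn|qn] := eqVneq (pdiv n) n.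
  by exists n; split => //; rewrite -qn.
have /dvdnP[m nE] := pdiv_dvd n.
  have qgt := prime_gt1 pd.
  have e : (n%:Z +i* 0 : gaussInt) = (m%:Z +i* 0 : gaussInt) * ((pdiv n)%:Z +i* 0 : gaussInt).
    by rewrite gmulE !mulr0 mul0r subr0 addr0 -PoszM -nE.
  move: pn; rewrite e; case: pp => _ _ h /h{h} [hm|hq].
    have m1 : (1 < m)%N.
      case: m nE qn {e hm} => [|[|m]]// nE; first by rewrite nE in n1.
      by rewrite {2}nE mul1n eqxx.
    have [|q [h1 h2 h3]] := IH m _ m1 hm; first by nia.
    by exists q; split => //; nia.
  by exists (pdiv n); split => //; apply: dvdn_leq; [lia|exact: pdiv_dvd].
Qed.

(** Each Gaussian prime is charged to a rational prime q <= K that it divides. By [lgn_factor] the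
    primes dividing q have total weight at most ln N(q) = 2 ln q, so twice the rational bound
    suffices. *)
Lemma gauss_theta_le K : \sum_(p <- gnball K | cprime p) lgn R p <= 8 * K%:R.
Proof.
apply: le_trans (_ : \sum_(p <- gnball K | cprime p)
   \sum_(1 <= q < K.+1 | prime q && gdvdb p (q%:Z +i* 0)) lgn R p <= _).
  rewrite big_seq_cond [leRHS]big_seq_cond; apply: ler_sum => p /andP[].
  rewrite mem_gnball => /andP[_ pK] cp.
  have [q [pq qp pdq]] := cprime_dvd_rational cp.
  have qK : q \in index_iota 1 K.+1.
    by rewrite mem_index_iota prime_gt0//=; lia.
  rewrite big_mkcond (bigD1_seq q) ?iota_uniq//= ifT; last by rewrite pq; apply/asboolP.
  by rewrite lerDl sumr_ge0// => i _; case: ifP => // _; exact: lgn_ge0.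
under eq_bigr do rewrite big_mkcondr.
rewrite exchange_big /=.
apply: le_trans (_ : \sum_(1 <= q < K.+1 | prime q) 2 * ln q%:R <= _); last first.
  by rewrite -mulr_sumr; have := theta_le K; rewrite /theta; lra.
rewrite big_seq_cond [leRHS]big_seq_cond; apply: ler_sum => q /andP[].
rewrite mem_index_iota => /andP[q1 qK] pq.
have gq : gn (q%:Z +i* 0) = (q ^ 2)%N by have := absz_sqrD q%:Z 0; rewrite addn0.
have q0 : (q%:Z +i* 0 : gaussInt) != 0 by rewrite -gn_gt0 gq expn_gt0 q1.
have -> : 2 * ln q%:R = lgn R (q%:Z +i* 0).
  by rewrite /lgn gq natrX lnXn ?ltr0n// mulr_natl.
have qB : (gn (q%:Z +i* 0) <= K ^ 2)%N by rewrite gq leq_exp2r//; lia.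
rewrite (lgn_factor R q0 qB) (@gnball_widen _ K (K ^ 2)); last by nia.
rewrite big_mkcond [leRHS]big_mkcond; apply: ler_sum => p _.
have [cp|//] := boolP (cprime p); rewrite andTb.
case: ifP => _; last by rewrite mulrn_wge0// lgn_ge0.
case: asboolP => [pdq|_]; last by rewrite mulrn_wge0// lgn_ge0.
have : (0 < gval (K ^ 2) p (q%:Z +i* 0))%N.
  rewrite /gval big_ltn_cond ?expr1; last by nia.
  by rewrite ifT//; apply/asboolP.
by case: (gval _ _ _) => // v _; rewrite mulrS lerDl mulrn_wge0// lgn_ge0.
Qed.

End Chebyshev.

(** * Chebyshev and Mertens for Gaussian primes *)

Section PrimeSums.
Variable R : realType.
Local Notation lgn := (lgn R).
Local Notation gcount := (gcount R).

Definition lam (p : gaussInt) : R := lgn p / (gn p)%:R.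

Lemma lam_ge0 p : 0 <= lam p.
Proof. by rewrite divr_ge0// lgn_ge0. Qed.

Lemma sum_ln_defect K : \sum_(n <- gnball K) (ln K%:R - lgn n) <= 30 * K%:R.
Proof.
apply: le_trans (_ : 30 * \sum_(1 <= k < K.+1) (ln K%:R - ln k%:R) <= _); last first.
  by rewrite ler_pM2l// sum_ln_ratio.
apply: (@gnball_sum_le R (fun k => ln K%:R - ln k%:R)) => k /andP[k0 kK].
  by rewrite subr_ge0 ler_ln ?posrE ?ltr0n ?ler_nat//; lia.
by rewrite lerD2l lerN2 ler_ln ?posrE ?ltr0n ?ler_nat.
Qed.

(** This controls the error of the lattice count at K / N(p), summed over p. Partial summation
    against Chebyshev gives 8 * K^(3/4) * 4 K^(1/4). *)
Lemma sum_lgn_powR K :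
  \sum_(p <- gnball K | cprime p) (K%:R / (gn p)%:R) `^ (3 / 4) * lgn p <= 32 * K%:R.
Proof.
have [->|K0] := posnP K; first by rewrite mulr0 /gnball big_nil.
apply: le_trans (@gnball_abel_linear R _ cprime 8 (fun k => (K%:R / k%:R) `^ (3 / 4)) K _ _ _ _) _.
- by move=> p _; exact: lgn_ge0.
- by move=> j _; exact: gauss_theta_le.
- by move=> k _; exact: powR_ge0.
- move=> k /andP[k0 _]; apply: ge0_ler_powR; [lra|by rewrite nnegrE|by rewrite nnegrE|].
  by rewrite ler_wpM2l// lef_pV2 ?posrE ?ltr0n// ler_nat.
have -> : \sum_(1 <= k < K.+1) (K%:R / k%:R) `^ (3 / 4) =
   K%:R `^ (3 / 4) * \sum_(1 <= k < K.+1) k%:R `^ (1 / 4 - 1) :> R.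
  rewrite mulr_sumr; apply: eq_big_nat => k /andP[k0 _].
  rewrite powRM ?invr_ge0//; congr (_ * _).
  rewrite -powR_inv1// -powRrM; congr (_ `^ _); lra.
have q : 0 < (1 / 4 : R) <= 1 by lra.
have := ler_wpM2l (powR_ge0 K%:R (3 / 4)) (sum_powR_le K q).
have -> : K%:R `^ (3 / 4) * (K%:R `^ (1 / 4) / (1 / 4)) = 4 * K%:R :> R.
  have e : 3 / 4 + 1 / 4 = 1 :> R by lra.
  rewrite mulrA -powRD; last by rewrite e oner_eq0.
  by rewrite e powRr1//; lra.
by lra.
Qed.

Lemma geom_tail (x : R) n : 0 <= x -> x <= 1 / 2 -> \sum_(2 <= j < n) x ^+ j <= 2 * x ^+ 2.
Proof.
move=> x0 x1; have [n2|n2] := leqP n 2.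
  by rewrite big_geq// mulr_ge0// exprn_ge0.
suff : \sum_(2 <= j < n) x ^+ j + 2 * x ^+ n <= 2 * x ^+ 2.
  by have := exprn_ge0 n x0; lra.
elim: n n2 => // n IH; rewrite ltnS leq_eqVlt => /orP[/eqP <-|n2].
  rewrite big_nat1 exprS; have := exprn_ge0 2 x0; nra.
rewrite big_nat_recr//=; last by lia.
have := IH n2; rewrite (exprS x n); have xn := exprn_ge0 n x0.
have : 2 * (x * x ^+ n) <= x ^+ n by nra.
lra.
Qed.

Lemma sum_inv_sq K : \sum_(1 <= k < K.+1) (k%:R ^+ 2)^-1 <= 2 :> R.
Proof.
have [->|K0] := posnP K; first by rewrite big_geq.
rewrite big_ltn// expr1n invr1.
have -> : \sum_(2 <= k < K.+1) (k%:R ^+ 2)^-1 = \sum_(2 <= k < K.+1) k%:R `^ (-1 - 1) :> R.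
  apply: eq_big_nat => k /andP[k0 _].
  rewrite -powR_mulrn// -powRN; congr (_ `^ _); lra.
have := @sum_powR_tail R 1 1 K.+1 ltr01 isT; rewrite powR1 divr1; lra.
Qed.

(** The geometric tail is at most 2 ln N(p) / N(p)^2; partial summation with the Chebyshev constant
    8 and the bound 2 for the sum of 1 / k^2 gives 32. *)
Lemma sum_prime_powers K :
  \sum_(p <- gnball K | cprime p) \sum_(2 <= j < K.+1) lgn p / (gn p)%:R ^+ j <= 32.
Proof.
apply: le_trans (_ : \sum_(p <- gnball K | cprime p) 2 * (((gn p)%:R ^+ 2)^-1 * lgn p) <= _).
  apply: ler_sum => p cp; have p1 := gprime_gn (cprime_gprime cp).
  have -> : \sum_(2 <= j < K.+1) lgn p / (gn p)%:R ^+ j =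
      lgn p * \sum_(2 <= j < K.+1) ((gn p)%:R^-1) ^+ j.
    by rewrite mulr_sumr; apply: eq_bigr => j _; rewrite exprVn.
  have i0 : 0 <= (gn p)%:R^-1 :> R by rewrite invr_ge0.
  have i2 : (gn p)%:R^-1 <= 1 / 2 :> R.
    by rewrite div1r lef_pV2 ?posrE ?ltr0n ?ler_nat//; lia.
  apply: le_trans (ler_wpM2l (lgn_ge0 R p) (geom_tail K.+1 i0 i2)) _.
  by rewrite exprVn; lra.
rewrite -mulr_sumr.
have h := @gnball_abel_linear R lgn cprime 8 (fun k => (k%:R ^+ 2)^-1) K _ _ _ _.
have {h} := h _ _ _ _.
have a1 : forall n, cprime n -> 0 <= lgn n by move=> *; exact: lgn_ge0.
have a2 j : (j <= K)%N -> \sum_(n <- gnball j | cprime n) lgn n <= 8 * j%:R.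
  by move=> _; exact: gauss_theta_le.
have a3 k : (0 < k <= K)%N -> 0 <= (k%:R ^+ 2)^-1 :> R by rewrite invr_ge0 exprn_ge0.
have a4 k : (0 < k < K)%N -> (k.+1%:R ^+ 2)^-1 <= (k%:R ^+ 2)^-1 :> R.
  move=> /andP[k0 _]; rewrite lef_pV2 ?posrE ?exprn_gt0 ?ltr0n//.
  by rewrite ler_pXn2r ?nnegrE// ler_nat.
move=> /(_ a1 a2 a3 a4); have := sum_inv_sq K; lra.
Qed.

Lemma log_identity_primes (G : gaussInt -> R[i]) K :
  (forall m n, m != 0 -> n != 0 -> G (m * n) = G m * G n) ->
  nc (\sum_(n <- gnball K) (lgn n)%:C * G n -
      \sum_(p <- gnball K | cprime p)
        (lgn p)%:C * G p * \sum_(m <- gnball (K %/ gn p)) G m) <=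
  \sum_(p <- gnball K | cprime p) \sum_(2 <= j < K.+1)
     lgn p * nc (G p) ^+ j * nc (\sum_(m <- gnball (K %/ gn p ^ j)) G m).
Proof.
move=> GM; have [->|K0] := posnP K.
  by rewrite /gnball !big_nil subrr nc0.
rewrite (sum_mul_lgn (real_complex R) K GM) /= -sumrB.
apply: le_trans (nc_sum _ _ _) _; apply: ler_sum => p cp.
rewrite big_ltn// !expr1 expn1 addrC addKr.
apply: le_trans (nc_sum _ _ _) _; apply: ler_sum_nat => j /andP[j2 _].
have GX : G (p ^+ j) = G p ^+ j.
  have p0 := gprime_neq0 (cprime_gprime cp).
  case: j j2 => // j _; elim: j => [|j IH]; first by rewrite !expr1.
  by rewrite exprS GM ?gexpf_neq0// IH [RHS]exprS.
by rewrite GX !ncM ncX nc_real (ger0_norm (lgn_ge0 R p)).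
Qed.

Lemma nc_sum_gnball_le (f : gaussInt -> R[i]) K : (forall n, n != 0 -> nc (f n) <= 1) ->
  nc (\sum_(n <- gnball K) f n) <= gcount K.
Proof.
move=> f1; apply: le_trans (nc_sum _ _ _) _.
rewrite /gcount -sum1_size natr_sum big_seq [leRHS]big_seq; apply: ler_sum => n.
by rewrite mem_gnball => /andP[n0 _]; apply: f1; rewrite -gn_gt0.
Qed.

Lemma divn_real_bounds K d : (0 < d)%N ->
  ((K %/ d)%:R <= K%:R / d%:R :> R) /\ (K%:R / d%:R - 1 <= (K %/ d)%:R :> R).
Proof.
move=> d0; have dR : 0 < d%:R :> R by rewrite ltr0n.
rewrite ler_pdivlMr// lerBlDr ler_pdivrMr// natr1 -!natrM !ler_nat; split.
  exact: leq_trunc_div.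
exact/ltnW/ltn_ceil.
Qed.

(** Two replacements, each costing O(K): ln N(n) by ln K, because the sum of ln (K / N(n)) is O(K),
    and prime powers by primes, because higher powers have a convergent weight. *)
Lemma sum_log_primes : exists2 C : R, 0 < C & forall (f : gaussInt -> R[i]) K,
  (forall m n, m != 0 -> n != 0 -> f (m * n) = f m * f n) ->
  (forall n, n != 0 -> nc (f n) = 1) ->
  nc ((ln K%:R)%:C * \sum_(n <- gnball K) f n -
      \sum_(p <- gnball K | cprime p)
        (lgn p)%:C * f p * \sum_(m <- gnball (K %/ gn p)) f m) <= C * K%:R.
Proof.
exists (30 + 30 * 32) => [|f K fM f1]; first by lra.
have f1' n : n != 0 -> nc (f n) <= 1 by move=> /f1 ->.
apply: le_trans (nc_sub_trans (\sum_(n <- gnball K) (lgn n)%:C * f n) _ _) _.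
rewrite mulrDl; apply: lerD.
  rewrite mulr_sumr -sumrB; apply: le_trans (nc_sum _ _ _) _.
  apply: le_trans (sum_ln_defect K); rewrite big_seq [leRHS]big_seq.
  apply: ler_sum => n; rewrite mem_gnball => /andP[n0 nK].
  rewrite -mulrBl -rmorphB ncM nc_real f1 ?mulr1 -?gn_gt0//.
  rewrite ger0_norm// subr_ge0 ler_ln ?posrE ?ltr0n ?ler_nat//; lia.
apply: le_trans (log_identity_primes K fM) _.
apply: le_trans (_ : \sum_(p <- gnball K | cprime p)
    \sum_(2 <= j < K.+1) 30 * K%:R * (lgn p / (gn p)%:R ^+ j) <= _).
  apply: ler_sum => p cp; apply: ler_sum => j _.
  have p0 := gprime_neq0 (cprime_gprime cp).
  have pg : (0 < gn p ^ j)%N by rewrite expn_gt0 gn_gt0 p0.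
  rewrite f1// expr1n mulr1.
  have h1 := nc_sum_gnball_le (K %/ gn p ^ j) f1'.
  have h2 := gcount_le R (K %/ gn p ^ j).
  have [h3 _] := divn_real_bounds K pg.
  rewrite mulrCA; apply: ler_wpM2l; first exact: lgn_ge0.
  rewrite natrX in h3; lra.
have -> : \sum_(p <- gnball K | cprime p)
    \sum_(2 <= j < K.+1) 30 * K%:R * (lgn p / (gn p)%:R ^+ j) =
    30 * K%:R * \sum_(p <- gnball K | cprime p)
    \sum_(2 <= j < K.+1) (lgn p / (gn p)%:R ^+ j).
  by rewrite mulr_sumr; apply: eq_bigr => p _; rewrite mulr_sumr.
have : 0 <= 30 * K%:R :> R by rewrite mulr_ge0.
by move=> w; have := ler_wpM2l w (sum_prime_powers K); lra.
Qed.

(** The case [f = 1] of [sum_log_primes], with every count replaced by its main term c K. The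
    unknown density divides out, so only its positivity matters. *)
Lemma mertens : exists2 C : R, 0 < C & forall K, (0 < K)%N ->
  `|\sum_(p <- gnball K | cprime p) lam p - ln K%:R| <= C.
Proof.
have [C1 C10 h1] := sum_log_primes.
have [c [C2 [c0 C20 h2]]] := gcount_asymptotic R.
exists ((C1 + 8 * c + C2 * 32 + 4 * C2) / c) => [|K K0].
  by rewrite divr_gt0//; lra.
have KR : 0 < K%:R :> R by rewrite ltr0n.
have := h1 (fun=> 1) K _ _.
have a1 : forall m n : gaussInt, m != 0 -> n != 0 -> (1 : R[i]) = 1 * 1 by rewrite mulr1.
have a2 : forall n : gaussInt, n != 0 -> nc (1 : R[i]) = 1 by rewrite nc1.
move=> /(_ a1 a2).
have cnt k : \sum_(n <- gnball k) (1 : R[i]) = (gcount k)%:C.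
  by rewrite -(chisum0 R); apply: eq_bigr => n _; rewrite expr0.
rewrite cnt.
have -> : \sum_(p <- gnball K | cprime p) (lgn p)%:C * 1 * \sum_(m <- gnball (K %/ gn p)) 1 =
  (\sum_(p <- gnball K | cprime p) lgn p * gcount (K %/ gn p))%:C :> R[i].
  by rewrite rmorph_sum; apply: eq_bigr => p _; rewrite cnt mulr1 rmorphM.
rewrite -rmorphM -rmorphB nc_real => e1.
have e2 : `|\sum_(p <- gnball K | cprime p) lgn p * gcount (K %/ gn p) -
    c * K%:R * \sum_(p <- gnball K | cprime p) lam p| <= (8 * c + C2 * 32) * K%:R.
  rewrite mulr_sumr -sumrB; apply: le_trans (ler_norm_sum _ _ _) _.
  apply: le_trans (_ : \sum_(p <- gnball K | cprime p)
     (c * lgn p + C2 * ((K%:R / (gn p)%:R) `^ (3 / 4) * lgn p)) <= _).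
    rewrite big_seq_cond [leRHS]big_seq_cond; apply: ler_sum => p /andP[].
    rewrite mem_gnball => /andP[pg pK] cp.
    have [d1 d2] := divn_real_bounds K pg; have hh := h2 (K %/ gn p)%N.
    have -> : lgn p * gcount (K %/ gn p) - c * K%:R * lam p =
      lgn p * (c * ((K %/ gn p)%:R - K%:R / (gn p)%:R) +
        (gcount (K %/ gn p) - c * (K %/ gn p)%:R)).
      by rewrite /lam; ring.
    rewrite normrM ger0_norm ?lgn_ge0//.
    have -> : c * lgn p + C2 * ((K%:R / (gn p)%:R) `^ (3 / 4) * lgn p) =
      lgn p * (c + C2 * (K%:R / (gn p)%:R) `^ (3 / 4)) by ring.
    apply: ler_wpM2l; first exact: lgn_ge0.
    apply: le_trans (ler_normD _ _) _; apply: lerD.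
      rewrite normrM ger0_norm ?(ltW c0)// ler_piMr ?(ltW c0)//.
      by rewrite ler_norml; apply/andP; split; lra.
    apply: le_trans hh _; apply: ler_wpM2l; first exact: ltW.
    by apply: ge0_ler_powR; [lra|by rewrite nnegrE|by rewrite nnegrE|].
  rewrite big_split /= -!mulr_sumr.
  have g1 := ler_wpM2l (ltW c0) (gauss_theta_le R K).
  have g2 := ler_wpM2l (ltW C20) (sum_lgn_powR K).
  lra.
have lnK : 0 <= ln K%:R :> R by rewrite ln_ge0// ler1n.
have e3 : `|ln K%:R * gcount K - c * K%:R * ln K%:R| <= 4 * C2 * K%:R.
  have -> : ln K%:R * gcount K - c * K%:R * ln K%:R =
     ln K%:R * (gcount K - c * K%:R) by ring.
  rewrite normrM ger0_norm//.
  (* It makes ln K times the error K^(3/4) of the count O(K). *)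
  have l4 : ln K%:R <= 4 * K%:R `^ (1 / 4) :> R.
    have p0 : 0 < K%:R `^ (1 / 4) :> R by rewrite powR_gt0.
    have := ln_le_sub1 p0; rewrite ln_powR; lra.
  apply: le_trans (ler_pM _ _ l4 (h2 K)) _ => //.
  have e : 1 / 4 + 3 / 4 = 1 :> R by lra.
  have : K%:R `^ (1 / 4) * K%:R `^ (3 / 4) = K%:R :> R.
    by rewrite -powRD ?e ?powRr1// oner_eq0.
  move=> ee; rewrite mulrACA -mulrA.
  have -> : K%:R `^ (1 / 4) * (K%:R `^ (3 / 4)) = K%:R :> R by [].
  lra.
rewrite ler_pdivlMr// -(ler_pM2r KR).
have -> : `|\sum_(p <- gnball K | cprime p) lam p - ln K%:R| * c * K%:R =
  `|c * K%:R * \sum_(p <- gnball K | cprime p) lam p - c * K%:R * ln K%:R|.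
  rewrite -mulrBr normrM ger0_norm ?mulr_ge0 ?(ltW c0)//; ring.
move: e1 e2 e3; rewrite !ler_norml.
set X := \sum_(p <- gnball K | cprime p) lgn p * _.
move=> /andP[? ?] /andP[? ?] /andP[? ?]; apply/andP; split; lra.
Qed.

End PrimeSums.

(** * Tails of sums weighted by powers of the norm *)

Section TailSums.
Variable R : realType.
Local Notation lgn := (lgn R).

Lemma ler_powR_nat (a : R) m n : 0 <= a -> (m <= n)%N -> m%:R `^ a <= n%:R `^ a :> R.
Proof. by move=> a0 mn; apply: ge0_ler_powR; rewrite ?nnegrE ?ler_nat. Qed.

Lemma ler_powRN_nat (a : R) m n : 0 <= a -> (0 < m)%N -> (m <= n)%N ->
  n%:R `^ (- a) <= m%:R `^ (- a) :> R.
Proof.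
move=> a0 m0 mn; rewrite !powRN lef_pV2 ?posrE ?powR_gt0 ?ltr0n//; last by lia.
exact: ler_powR_nat.
Qed.

Lemma gnball_split (V : nmodType) m K (P : pred gaussInt) (F : gaussInt -> V) : (m <= K)%N ->
  \sum_(n <- gnball K | P n) F n =
  \sum_(n <- gnball m | P n) F n + \sum_(n <- gnball K | P n && (m < gn n)%N) F n.
Proof.
move=> mK; rewrite (bigID (fun n => gn n <= m)%N) /= -(gnball_widen _ _ mK).
by congr (_ + _); apply: eq_bigl => n; rewrite ltnNge.
Qed.

Lemma gnball_gt_nil (V : nmodType) m K (P : pred gaussInt) (F : gaussInt -> V) : (K <= m)%N ->
  \sum_(n <- gnball K | P n && (m < gn n)%N) F n = 0.
Proof.
move=> Km; rewrite big1_seq// => n /andP[/andP[_ h]].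
by rewrite mem_gnball; lia.
Qed.

Lemma harmonic_le K : (0 < K)%N -> \sum_(1 <= k < K.+1) k%:R^-1 <= 1 + ln K%:R :> R.
Proof.
elim: K => // -[|K] IH _; first by rewrite big_nat1 invr1 ln1 addr0.
rewrite big_nat_recr//=; have {}IH := IH isT.
have k0 : 0 < K.+1%:R :> R by []. have k1 : 0 < K.+2%:R :> R by [].
have r0 : 0 < K.+2%:R / K.+1%:R :> R by rewrite divr_gt0.
have := ln_ge_1subV r0; rewrite ln_div ?posrE//.
have -> : 1 - (K.+2%:R / K.+1%:R)^-1 = K.+2%:R^-1 :> R.
  have e : K.+2%:R = K.+1%:R + 1 :> R by rewrite natr1.
  rewrite invf_div e; move: (K.+1%:R : R) k0 => x x0.
  have x1 : x + 1 != 0 by rewrite gt_eqF//; lra.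
  by apply: (mulIf x1); rewrite mulrBl mulVf// divfK//; ring.
move=> h; apply: le_trans (lerD IH h) _; lra.
Qed.

Lemma sum_inv_gn K : (0 < K)%N -> \sum_(n <- gnball K) (gn n)%:R^-1 <= 30 * (1 + ln K%:R) :> R.
Proof.
move=> K0; apply: le_trans (@gnball_sum_le R (fun k => k%:R^-1) K _ _) _.
- by move=> k _; rewrite invr_ge0.
- by move=> k /andP[k0 _]; rewrite lef_pV2 ?posrE ?ltr0n// ler_nat.
by rewrite ler_pM2l// harmonic_le.
Qed.

Lemma powR_inv_decr (d : R) k : 0 <= d -> (0 < k)%N ->
  k.+1%:R `^ (-1 - d) <= k%:R `^ (-1 - d) :> R.
Proof.
move=> d0 k0.
have -> : -1 - d = - (1 + d) by ring.
rewrite !powRN lef_pV2 ?posrE ?powR_gt0 ?ltr0n//.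
by apply: ge0_ler_powR; rewrite ?nnegrE ?ler_nat//; lra.
Qed.

Lemma powR_inv_le (d : R) k : 0 <= d -> (0 < k)%N -> k%:R `^ (-1 - d) <= k%:R^-1 :> R.
Proof.
move=> d0 k0; rewrite -powR_inv1//; apply: ler_powR; first by rewrite ler1n.
by lra.
Qed.

Lemma sum_powR_gn (d : R) K : 0 < d ->
  \sum_(n <- gnball K) (gn n)%:R `^ (-1 - d) <= 30 * (1 + d^-1) :> R.
Proof.
move=> d0; apply: le_trans (@gnball_sum_le R (fun k => k%:R `^ (-1 - d)) K _ _) _.
- by move=> k _; exact: powR_ge0.
- by move=> k /andP[k0 _]; apply: powR_inv_decr => //; exact: ltW.
rewrite ler_pM2l//; have [->|K0] := posnP K.
  by rewrite big_geq// addr_ge0// invr_ge0 ltW.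
rewrite big_ltn// powR1 lerD2l.
by have := @sum_powR_tail R d 1 K.+1 d0 isT; rewrite powR1 div1r.
Qed.

Lemma tail_powR_gn (d e : R) : 0 < d -> 0 < e -> exists2 Y, (0 < Y)%N & forall Z X, (Y <= Z)%N ->
  \sum_(n <- gnball X | (Z < gn n)%N) (gn n)%:R `^ (-1 - d) <= e.
Proof.
move=> d0 e0.
pose b := e / (30 * (1 + d^-1)).
have dV : 0 < d^-1 by rewrite invr_gt0.
have b0 : 0 < b by rewrite divr_gt0// mulr_gt0// addr_gt0.
(* Beyond this point the norm to the power -d is at most [b]. Partial summation leaves a boundary
   term 30 b and a sum 30 b / d, which together equal [e]. *)
exists (Num.truncn (b `^ (- d^-1))).+1 => // Z X YZ.
have [XZ|ZX] := leqP X Z.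
  have := @gnball_gt_nil R Z X xpredT (fun n => (gn n)%:R `^ (-1 - d)) XZ.
  by move=> /= ->; exact: ltW.
apply: le_trans (ler_norm _) _; rewrite -nc_real rmorph_sum /=.
have -> : \sum_(n <- gnball X | (Z < gn n)%N) ((gn n)%:R `^ (-1 - d))%:C =
    \sum_(n <- gnball X | xpredT n && (Z < gn n)%N) ((gn n)%:R `^ (-1 - d))%:C * 1 :> R[i].
  by apply: eq_bigr => n _; rewrite mulr1.
apply: le_trans (@gnball_abel R (fun=> 1) xpredT (fun j => 30 * j%:R) (fun k => k%:R `^ (-1 - d)) Z X ZX _ _ _) _.
- move=> j _; apply: le_trans (nc_sum _ _ _) _; rewrite nc1.
  apply: le_trans (gnball_count_le R j); rewrite [leRHS](bigID (fun n => Z < gn n)%N) /=.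
  by rewrite lerDl sumr_ge0.
- by move=> k _; exact: powR_ge0.
- by move=> k h; apply: powR_inv_decr; [exact: ltW|lia].
have Z0 : (0 < Z)%N by lia.
have -> : \sum_(Z.+2 <= k < X.+1) (30 * k%:R - 30 * k.-1%:R) * k%:R `^ (-1 - d) =
    30 * \sum_(Z.+2 <= k < X.+1) k%:R `^ (-1 - d) :> R.
  rewrite mulr_sumr; apply: eq_big_nat => k /andP[k1 _].
  by case: k k1 => // k _; rewrite -mulrBr /= -natr1; ring.
have h1 := @sum_powR_tail R d Z.+1 X.+1 d0 isT.
have Zp : 0 < Z%:R :> R by rewrite ltr0n.
have h2 : Z.+1%:R * Z.+1%:R `^ (-1 - d) = Z.+1%:R `^ (- d) :> R.
  rewrite -[X in X * _]powRr1// -powRD ?pnatr_eq0 ?implybT//; congr (_ `^ _); ring.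
have h3 : Z.+1%:R `^ (- d) <= b.
  rewrite powRN -[leRHS]invrK lef_pV2 ?posrE ?powR_gt0 ?invr_gt0//.
  have : b `^ (- d^-1) <= Z.+1%:R.
    apply/ltW/(lt_le_trans (truncnS_gt _)); rewrite ler_nat.
    by apply: leq_trans YZ _.
  move=> h; have : (b `^ (- d^-1)) `^ d <= Z.+1%:R `^ d.
    by apply: ge0_ler_powR; rewrite ?nnegrE ?powR_ge0//; exact: ltW.
  by rewrite -powRrM mulNr mulVf ?gt_eqF// powR_inv1// ltW.
rewrite -mulrA h2.
have -> : e = 30 * b + 30 * (b / d).
  by rewrite /b; field; apply/andP; split; rewrite gt_eqF// addr_gt0.
apply: lerD; first by rewrite ler_pM2l.
rewrite ler_pM2l//; apply: le_trans h1 _; rewrite ler_pM2r//.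
Qed.

(* [Q] plays the role of the analytic conductor of [g]. *)
Definition small (g : gaussInt -> R[i]) (Q : R) : Prop :=
  forall K, nc (\sum_(n <- gnball K) g n) <= Q * K%:R `^ (3 / 4).

(** Partial summation with the majorant 2 Q j^(3/4) for sums starting after m: the boundary term
    costs 2 Q m^(-1/4), and the sum of the k^(-5/4) costs 2 Q * 4 m^(-1/4). *)
Lemma tail_small g Q (phi : nat -> R) m K : small g Q -> 0 <= Q -> (0 < m)%N ->
  (forall k, (m < k <= K)%N -> 0 <= phi k <= k%:R^-1) ->
  (forall k, (m < k < K)%N -> phi k.+1 <= phi k) ->
  nc (\sum_(n <- gnball K | (m < gn n)%N) (phi (gn n))%:C * g n) <= 10 * Q * m%:R `^ (- (1 / 4)).
Proof.
move=> gs Q0 m0 phi0 phid.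
have [Km|mK] := leqP K m.
  have := @gnball_gt_nil _ m K xpredT (fun n => (phi (gn n))%:C * g n) Km.
  by move=> /= ->; rewrite nc0 !mulr_ge0 ?powR_ge0.
apply: le_trans (@gnball_abel R g xpredT (fun j => 2 * Q * j%:R `^ (3 / 4)) phi m K mK _ _ _) _.
- move=> j /andP[mj jK]; have := @gnball_split _ m j xpredT g (ltnW mj) => /= e.
  have -> : \sum_(n <- gnball j | (m < gn n)%N) g n =
     \sum_(n <- gnball j) g n - \sum_(n <- gnball m) g n by rewrite e addrC addKr.
  apply: le_trans (ncB _ _) _; have h1 := gs j; have h2 := gs m.
  have : Q * m%:R `^ (3 / 4) <= Q * j%:R `^ (3 / 4).
    by apply: ler_wpM2l => //; apply: ler_powR_nat; [lra|exact: ltnW].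
  lra.
- by move=> k h; case/andP: (phi0 k h).
- exact: phid.
have e14 k : (0 < k)%N -> k%:R `^ (3 / 4 - 1) = k%:R `^ (- (1 / 4)) :> R.
  by move=> _; congr (_ `^ _); lra.
have e54 k : (0 < k)%N -> k%:R `^ (3 / 4 - 1) * k%:R^-1 = k%:R `^ (- 1 - 1 / 4) :> R.
  move=> k0; rewrite -(powR_inv1 (ler0n R k)) -powRD ?pnatr_eq0 -?lt0n ?k0 ?implybT//.
  by congr (_ `^ _); lra.
have h1 : m.+1%:R `^ (3 / 4) * phi m.+1 <= m%:R `^ (- (1 / 4)).
  have /andP[_ p1] : 0 <= phi m.+1 <= m.+1%:R^-1 by apply: phi0; lia.
  apply: le_trans (_ : m.+1%:R `^ (3 / 4) * m.+1%:R^-1 <= _).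
    by apply: ler_wpM2l => //; exact: powR_ge0.
  rewrite -(powR_inv1 (ler0n R m.+1)) -powRD ?pnatr_eq0 ?implybT// e14// !powRN.
  by rewrite -!powRN; apply: ler_powRN_nat => //; lra.
have h2 : \sum_(m.+2 <= k < K.+1) (2 * Q * k%:R `^ (3 / 4) - 2 * Q * k.-1%:R `^ (3 / 4)) * phi k <=
    2 * Q * (4 * m%:R `^ (- (1 / 4))).
  apply: le_trans (_ : \sum_(m.+2 <= k < K.+1) 2 * Q * (k%:R `^ (-1 - 1 / 4)) <= _).
    apply: ler_sum_nat => k /andP[k1 kK]; have k0 : (0 < k)%N by lia.
    have -> : (2 * Q * k%:R `^ (3 / 4) - 2 * Q * k.-1%:R `^ (3 / 4)) * phi k =
      2 * Q * ((k%:R `^ (3 / 4) - k.-1%:R `^ (3 / 4)) * phi k) by ring.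
    apply: ler_wpM2l; first by rewrite mulr_ge0.
    have q34 : 0 <= (3 / 4 : R) <= 1 by lra.
    have /andP[p0 p1] : 0 <= phi k <= k%:R^-1 by apply: phi0; lia.
    rewrite -e54//; apply: ler_pM => //; last exact: powR_diff_le.
    by rewrite subr_ge0; apply: ler_powR_nat; [lra|lia].
  rewrite -mulr_sumr; apply: ler_wpM2l; first by rewrite mulr_ge0.
  have q0 : 0 < (1 / 4 : R) by lra.
  apply: le_trans (@sum_powR_tail R (1 / 4) m.+1 K.+1 q0 isT) _.
  have -> : m.+1%:R `^ (- (1 / 4)) / (1 / 4) = 4 * m.+1%:R `^ (- (1 / 4)) :> R by field.
  by rewrite ler_pM2l//; apply: ler_powRN_nat => //; lra.
have := ler_wpM2l (_ : 0 <= 2 * Q) h1; rewrite mulr_ge0// => /(_ isT).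
rewrite mulrA; lra.
Qed.

End TailSums.

(** * The 3-4-1 argument *)

Section Euler.
Variable R : realType.
Variable w : gaussInt -> R[i].
Hypothesis wM : forall m n, m != 0 -> n != 0 -> w (m * n) = w m * w n.
Hypothesis wtail : forall e : R, 0 < e -> exists2 Y, (0 < Y)%N & forall Z X, (Y <= Z)%N ->
  \sum_(n <- gnball X | (Z < gn n)%N) nc (w n) <= e.

Definition coprime_to (P : seq gaussInt) (n : gaussInt) : bool :=
  all (fun p => ~~ gdvdb p n) P.

Definition wsum (X : nat) : R[i] := \sum_(n <- gnball X) w n.

Definition wsum_coprime (P : seq gaussInt) (X : nat) : R[i] :=
  \sum_(n <- gnball X | coprime_to P n) w n.

Lemma wsum_coprime_cons p P X : cprime p -> all cprime P -> p \notin P ->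
  wsum_coprime (p :: P) X = wsum_coprime P X - w p * wsum_coprime P (X %/ gn p).
Proof.
move=> cp cP pP; have p0 := gprime_neq0 (cprime_gprime cp).
apply/eqP; rewrite eq_sym subr_eq eq_sym; apply/eqP.
rewrite /wsum_coprime [RHS](bigID (fun n => gdvdb p n)) /= addrC; congr (_ + _).
  by apply: eq_bigl => n; rewrite andbC.
have -> : \sum_(n <- gnball X | coprime_to P n && gdvdb p n) w n =
    \sum_(n <- gnball X | gdvdb p n) if coprime_to P n then w n else 0.
  by rewrite -big_mkcondr; apply: eq_bigl => n; rewrite andbC.
rewrite sum_gdvd// mulr_sumr -big_mkcond /=.
rewrite big_seq_cond [RHS]big_seq_cond; apply: eq_big => [m|m /andP[]].
  congr (_ && _); apply: eq_in_all => q qP; congr (~~ _).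
  apply: asbool_equiv_eq; have cq := allP cP q qP.
  have qp : ~ gdvd q p by apply: cprime_ndvd => //; apply: contraNneq pP => <-.
  by have := @gprime_exp_dvd q p m 1 (cprime_gprime cq) qp; rewrite !expr1 => -[? ?]; split.
by rewrite mem_gnball => /andP[m0 _] _; rewrite wM// -gn_gt0.
Qed.

(** A finite Euler product without infinite series: removing the multiples of one more prime p
    multiplies the sum by 1 - w p, up to the difference between the sums to X and to X / N(p), which
    [wtail] makes small. *)
Lemma wsum_coprime_limit P : uniq P -> all cprime P -> forall e : R, 0 < e ->
  exists X0, forall X, (X0 <= X)%N ->
    nc (wsum_coprime P X - \prod_(p <- P) (1 - w p) * wsum X) <= e.
Proof.
elim: P => [_ _ e e0|p P IH /= /andP[pP uP] /andP[cp cP] e e0].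
  by exists 0%N => X _; rewrite big_nil mul1r subrr nc0; exact: ltW.
have p0 := gprime_neq0 (cprime_gprime cp).
have pg : (0 < gn p)%N by rewrite gn_gt0.
pose A := nc (\prod_(q <- P) (1 - w q)); pose M := nc (w p).
have A0 : 0 <= A := nc_ge0 _. have M0 : 0 <= M := nc_ge0 _.
pose e1 := e / (1 + M + M * A).
have D0 : 0 < 1 + M + M * A by rewrite !ltr_wpDr ?mulr_ge0.
have e10 : 0 < e1 by rewrite divr_gt0.
have [X0 hX0] := IH uP cP e1 e10; have [Y Y0 hY] := wtail e10.
exists ((maxn X0 Y).+1 * gn p)%N => X hX.
have X1 : (X0 <= X)%N.
  by apply: leq_trans hX; apply: leq_trans (leq_pmulr _ pg); exact: leqW (leq_maxl _ _).
have X2 : (maxn X0 Y <= X %/ gn p)%N by rewrite leq_divRL//; apply: leq_trans hX; rewrite leq_mul2r leqnSn orbT.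
rewrite wsum_coprime_cons// big_cons.
have -> : wsum_coprime P X - w p * wsum_coprime P (X %/ gn p) -
    (1 - w p) * \prod_(q <- P) (1 - w q) * wsum X =
  (wsum_coprime P X - \prod_(q <- P) (1 - w q) * wsum X) -
  w p * ((wsum_coprime P (X %/ gn p) - \prod_(q <- P) (1 - w q) * wsum (X %/ gn p)) -
    \prod_(q <- P) (1 - w q) * (wsum X - wsum (X %/ gn p))) by ring.
have h1 := hX0 X X1; have h2 := hX0 (X %/ gn p)%N; have {}h2 := h2 _.
have {h2} h2 := h2 (leq_trans (leq_maxl _ _) X2).
have h3 : nc (wsum X - wsum (X %/ gn p)) <= e1.
  have := @gnball_split _ _ _ xpredT w (leq_div X (gn p)) => /= eX.
  rewrite /wsum eX addrC addKr; apply: le_trans (nc_sum _ _ _) _.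
  by apply: hY; apply: leq_trans X2; exact: leq_maxr.
apply: le_trans (ncB _ _) _; rewrite ncM.
have h4 : nc (wsum_coprime P (X %/ gn p) - \prod_(q <- P) (1 - w q) * wsum (X %/ gn p) -
    \prod_(q <- P) (1 - w q) * (wsum X - wsum (X %/ gn p))) <= e1 + A * e1.
  apply: le_trans (ncB _ _) _; rewrite ncM; apply: lerD => //.
  by apply: ler_wpM2l.
have h5 := ler_wpM2l M0 h4.
have -> : e = e1 + M * (e1 + A * e1) by rewrite /e1; field; rewrite gt_eqF.
by apply: lerD.
Qed.

Lemma coprime_to_small y n : (0 < gn n)%N -> coprime_to [seq p <- gnball y | cprime p] n ->
  gn n = 1%N \/ (y < gn n)%N.
Proof.
move=> n0 hn; have [n1|n1] := leqP (gn n) 1; first by left; lia.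
right; rewrite ltnNge; apply/negP => ny.
have [p cp pn] := cprime_divisor n1.
have nn0 : n != 0 by rewrite -gn_gt0.
have := allP hn p; rewrite mem_filter cp mem_gnball.
have := gdvd_leq nn0 pn; have := gprime_gn (cprime_gprime cp) => p1 pl.
have -> : (0 < gn p <= y)%N by lia.
by move=> /(_ isT)/negP; apply; apply/asboolP.
Qed.

Lemma sum_units (V : nmodType) (F : gaussInt -> V) :
  \sum_(n <- gnball 1) F n = F 1 + F gI + F (-1) + F (- gI).
Proof.
have -> : \sum_(n <- gnball 1) F n = \sum_(n <- [:: 1; gI; -1; - gI]) F n.
  apply: perm_big; apply: uniq_perm; [exact: gnball_uniq|by []|move=> n].
  rewrite mem_gnball; apply/idP/idP.
    move=> h; have {h}/gn1_exp[k k4 ->] : gn n = 1%N by lia.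
    by case: k k4 => [|[|[|[|]]]].
  by rewrite !inE => /or4P[] /eqP ->.
by rewrite !big_cons big_nil addr0 !addrA.
Qed.

(** After removing the multiples of all primes of norm at most y, the four units remain, each with
    weight 1, and a tail of size at most 1. With an error 1 in the product formula, the product has
    modulus at least 4 - 1 - 1. *)
Lemma euler_lower : w gI = 1 -> exists y0, forall y, (y0 <= y)%N ->
  exists X0, forall X, (X0 <= X)%N ->
  1 <= nc (\prod_(p <- gnball y | cprime p) (1 - w p)) * nc (wsum X).
Proof.
move=> wI.
have I0 : gI != 0 by [].
have w1 : w 1 = 1.
  have : w (gI ^+ 4) = w gI ^+ 4 by rewrite !exprS expr0 !mulr1 !wM// wI !mulr1.
  by rewrite gI4 wI expr1n.
have wN1 : w (-1) = 1 by rewrite -gI2 expr2 wM// wI mulr1.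
have wNI : w (- gI) = 1 by rewrite -mulN1r wM// wI wN1 mulr1.
have [Y Y0 hY] := wtail (ltr01 : 0 < (1 : R)).
exists Y => y Yy; set P := [seq p <- gnball y | cprime p].
have cP : all cprime P by exact: filter_all.
have uP : uniq P by exact/filter_uniq/gnball_uniq.
have [X1 hX1] := wsum_coprime_limit uP cP (ltr01 : 0 < (1 : R)).
exists (maxn X1 1) => X hX.
have := hX1 X (leq_trans (leq_maxl _ _) hX).
have -> : \prod_(p <- gnball y | cprime p) (1 - w p) = \prod_(p <- P) (1 - w p).
  by rewrite big_filter.
rewrite -ncM; set z := _ * wsum X.
have X1' : (1 <= X)%N := leq_trans (leq_maxr _ _) hX.
have : nc (wsum_coprime P X - 4) <= 1.
  rewrite /wsum_coprime (gnball_split _ _ X1').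
  have -> : \sum_(n <- gnball 1 | coprime_to P n) w n = 4.
    rewrite big_mkcond sum_units.
    have cu n : gn n = 1%N -> coprime_to P n.
      move=> n1; apply/allP => p; rewrite mem_filter => /andP[cp _].
      apply/asboolPn => pn; have := gdvd_leq (_ : n != 0) pn.
      rewrite -gn_gt0 n1 => /(_ isT); have := gprime_gn (cprime_gprime cp); lia.
    by rewrite !cu// wI w1 wN1 wNI; ring.
  rewrite addrC addKr; apply: le_trans (nc_sum _ _ _) _.
  apply: le_trans (hY y X Yy); rewrite big_mkcond [leRHS]big_mkcond.
  rewrite big_seq [leRHS]big_seq; apply: ler_sum => n; rewrite mem_gnball => /andP[n0 _].
  case: ifP => [/andP[cn n1]|_]; last by case: ifP => // _; exact: nc_ge0.
  by case: (coprime_to_small n0 cn) => [|->//]; lia.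
move=> h1 h2; have := nc_sub_trans (wsum_coprime P X) 4 z.
rewrite (nc_subC 4 (wsum_coprime P X)) => h3; have := nc_le_sub 4 z; rewrite nc_nat; lra.
Qed.

End Euler.

Section LowerBound.
Variable R : realType.
Local Notation lgn := (lgn R).

Definition damp (d : R) (g : gaussInt -> R[i]) (n : gaussInt) : R[i] :=
  ((gn n)%:R `^ (-1 - d))%:C * g n.

Lemma dampM d g m n : (g (m * n) = g m * g n) -> damp d g (m * n) = damp d g m * damp d g n.
Proof.
move=> gM; rewrite /damp gM gnM natrM powRM// rmorphM /=; ring.
Qed.

Lemma nc_damp d g n : nc (g n) = 1 -> nc (damp d g n) = (gn n)%:R `^ (-1 - d).
Proof. by move=> g1; rewrite /damp ncM g1 mulr1 nc_real ger0_norm// powR_ge0. Qed.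

Lemma damp_tail d g : 0 < d -> (forall n, n != 0 -> nc (g n) = 1) ->
  forall e : R, 0 < e -> exists2 Y, (0 < Y)%N & forall Z X, (Y <= Z)%N ->
  \sum_(n <- gnball X | (Z < gn n)%N) nc (damp d g n) <= e.
Proof.
move=> d0 g1 e e0; have [Y Y0 hY] := tail_powR_gn d0 e0.
exists Y => // Z X YZ; apply: le_trans (hY Z X YZ).
rewrite big_seq_cond [leRHS]big_seq_cond; apply: ler_sum => n /andP[].
rewrite mem_gnball => /andP[n0 _] _; rewrite nc_damp// g1// -gn_gt0//.
Qed.

(* The classical 3-4-1 inequality, with [1 - x] replaced by [expR (- x)]. *)
Lemma three_four_one (r : R) (u : R[i]) : 0 <= r -> nc u = 1 ->
  (nc (1 - r%:C) ^+ 3 * nc (1 - r%:C * u) ^+ 4 * nc (1 - r%:C * u ^+ 2)) ^+ 2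
  <= expR (8 * r ^+ 2).
Proof.
move=> r0 u1; set c := Re u.
have u2 : c ^+ 2 + Im u ^+ 2 = 1 by rewrite -ncE u1 expr1n.
have sqE (v : R[i]) : nc v = 1 -> nc (1 - r%:C * v) ^+ 2 = 1 - 2 * r * Re v + r ^+ 2.
  move=> v1; have v2 := ncE v; rewrite v1 expr1n in v2.
  rewrite ncE ReD ImD; have -> : Re (- (r%:C * v)) = - (r * Re v) by rewrite -ReZ; case: (r%:C * v).
  have -> : Im (- (r%:C * v)) = - (r * Im v) by rewrite -ImZ; case: (r%:C * v).
  rewrite [Re 1]/(1 : R) [Im 1]/(0 : R) add0r.
  have -> : (1 - r * Re v) ^+ 2 + (- (r * Im v)) ^+ 2 =
     1 - 2 * r * Re v + r ^+ 2 * (Re v ^+ 2 + Im v ^+ 2) by ring.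
  by rewrite -v2 mulr1.
have e1 : nc (1 - r%:C) ^+ 2 = 1 - 2 * r + r ^+ 2.
  by have := sqE 1 (nc1 R); rewrite !mulr1.
have e2 := sqE u u1; rewrite -/c in e2.
have e3 : nc (1 - r%:C * u ^+ 2) ^+ 2 = 1 - 2 * r * (2 * c ^+ 2 - 1) + r ^+ 2.
  rewrite sqE; last by rewrite ncX u1 expr1n.
  by have -> : Re (u ^+ 2) = 2 * c ^+ 2 - 1
    by rewrite expr2 ReM -/c; have := u2; rewrite !expr2; lra.
have -> : (nc (1 - r%:C) ^+ 3 * nc (1 - r%:C * u) ^+ 4 * nc (1 - r%:C * u ^+ 2)) ^+ 2 =
  (nc (1 - r%:C) ^+ 2) ^+ 3 * (nc (1 - r%:C * u) ^+ 2) ^+ 4 * nc (1 - r%:C * u ^+ 2) ^+ 2.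
  by ring.
have x1 : 0 <= nc (1 - r%:C) ^+ 2 by rewrite exprn_ge0// nc_ge0.
have x2 : 0 <= nc (1 - r%:C * u) ^+ 2 by rewrite exprn_ge0// nc_ge0.
have x3 : 0 <= nc (1 - r%:C * u ^+ 2) ^+ 2 by rewrite exprn_ge0// nc_ge0.
have b1 : nc (1 - r%:C) ^+ 2 <= expR (- 2 * r + r ^+ 2).
  by apply: le_trans (expR_ge1Dx _); rewrite e1; lra.
have b2 : nc (1 - r%:C * u) ^+ 2 <= expR (- 2 * r * c + r ^+ 2).
  by apply: le_trans (expR_ge1Dx _); rewrite e2; lra.
have b3 : nc (1 - r%:C * u ^+ 2) ^+ 2 <= expR (- 2 * r * (2 * c ^+ 2 - 1) + r ^+ 2).
  by apply: le_trans (expR_ge1Dx _); rewrite e3; lra.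
apply: le_trans (_ : expR (- 2 * r + r ^+ 2) ^+ 3 * expR (- 2 * r * c + r ^+ 2) ^+ 4 *
   expR (- 2 * r * (2 * c ^+ 2 - 1) + r ^+ 2) <= _).
  apply: ler_pM => //; first by rewrite mulr_ge0// exprn_ge0.
  apply: ler_pM; [exact: exprn_ge0|exact: exprn_ge0| |].
    by rewrite ler_pXn2r ?nnegrE ?expR_ge0.
  by rewrite ler_pXn2r ?nnegrE ?expR_ge0.
rewrite -!expRM_natl -!expRD ler_expR.
have : 0 <= 4 * r * (1 + c) ^+ 2 by apply: mulr_ge0; [apply: mulr_ge0|exact: sqr_ge0].
by lra.
Qed.

Lemma sum_inv_sq_gn K : \sum_(n <- gnball K) ((gn n)%:R `^ (-1)) ^+ 2 <= 60 :> R.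
Proof.
apply: le_trans (@gnball_sum_le R (fun k => (k%:R `^ (-1)) ^+ 2) K _ _) _.
- by move=> k _; rewrite exprn_ge0// powR_ge0.
- move=> k /andP[k0 _]; rewrite ler_pXn2r ?nnegrE ?powR_ge0//.
  by apply: ler_powRN_nat.
have -> : \sum_(1 <= k < K.+1) (k%:R `^ (-1)) ^+ 2 = \sum_(1 <= k < K.+1) (k%:R ^+ 2)^-1 :> R.
  by apply: eq_bigr => k _; rewrite powR_inv1// exprVn.
by have := sum_inv_sq R K; lra.
Qed.

(** The 3-4-1 inequality bounds the finite products of 1 - w p from above, and [euler_lower]
    transfers this to the sums. The squared product is at most exp (8 * 60), since the squares of
    the inverse norms sum to at most 60; hence the constant exp 240. *)
Lemma damped_three_four_one : exists2 C : R, 0 < C &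
  forall (g : gaussInt -> R[i]) (d : R),
  (forall m n, m != 0 -> n != 0 -> g (m * n) = g m * g n) ->
  (forall n, n != 0 -> nc (g n) = 1) -> g gI = 1 -> 0 < d ->
  exists X0, forall X, (X0 <= X)%N ->
  1 <= C * nc (wsum (damp d (fun=> 1)) X) ^+ 3 * nc (wsum (damp d g) X) ^+ 4 *
       nc (wsum (damp d (fun n => g n ^+ 2)) X).
Proof.
exists (expR 240) => [|g d gM g1 gI1 d0]; first exact: expR_gt0.
have I1 (h : gaussInt -> R[i]) : h gI = 1 -> damp d h gI = 1.
  by move=> hI; rewrite /damp hI gnI powR1 mulr1.
pose h0 (n : gaussInt) : R[i] := 1.
pose h2 n := g n ^+ 2.
have M0 m n : m != 0 -> n != 0 -> damp d h0 (m * n) = damp d h0 m * damp d h0 n.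
  by move=> *; apply: dampM; rewrite mulr1.
have Mg m n : m != 0 -> n != 0 -> damp d g (m * n) = damp d g m * damp d g n.
  by move=> *; apply: dampM; exact: gM.
have M2 m n : m != 0 -> n != 0 -> damp d h2 (m * n) = damp d h2 m * damp d h2 n.
  by move=> m0 n0; apply: dampM; rewrite /h2 gM// exprMn.
have n0 n : n != 0 -> nc (h0 n) = 1 by rewrite nc1.
have n2 n : n != 0 -> nc (h2 n) = 1 by move=> /g1 e; rewrite ncX e expr1n.
have [y0 E0] := euler_lower M0 (damp_tail d0 n0) (I1 h0 erefl).
have [yg Eg] := euler_lower Mg (damp_tail d0 g1) (I1 g gI1).
have h2I : h2 gI = 1 by rewrite /h2 gI1 expr1n.
have [y2 E2] := euler_lower M2 (damp_tail d0 n2) (I1 h2 h2I).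
pose y := maxn y0 (maxn yg y2).
have [X0 L0] := E0 y (leq_maxl _ _).
have [Xg Lg] := Eg y (leq_trans (leq_maxl _ _) (leq_maxr _ _)).
have [X2 L2] := E2 y (leq_trans (leq_maxr _ _) (leq_maxr _ _)).
exists (maxn X0 (maxn Xg X2)) => X; rewrite !geq_max => /and3P[k0 kg k2].
have {L0} l0 := L0 X k0. have {Lg} lg := Lg X kg. have {L2} l2 := L2 X k2.
set P0 := nc (\prod_(p <- _ | _) _) in l0; set Pg := nc (\prod_(p <- _ | _) _) in lg.
set P2 := nc (\prod_(p <- _ | _) _) in l2.
set F0 := nc (wsum _ X) in l0; set Fg := nc (wsum _ X) in lg.
set F2 := nc (wsum _ X) in l2.
have p0 : 0 <= P0 := nc_ge0 _. have pg : 0 <= Pg := nc_ge0 _. have p2 : 0 <= P2 := nc_ge0 _.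
have f0 : 0 <= F0 := nc_ge0 _. have fg : 0 <= Fg := nc_ge0 _. have f2 : 0 <= F2 := nc_ge0 _.
have PP : P0 ^+ 3 * Pg ^+ 4 * P2 <= expR 240.
  have nprod (F : gaussInt -> R[i]) : nc (\prod_(p <- gnball y | cprime p) F p) =
      \prod_(p <- gnball y | cprime p) nc (F p).
    by elim/big_rec2: _ => [|p a b _ <-]; [exact: nc1|exact: ncM].
  rewrite -(@ler_pXn2r _ 2)// ?nnegrE ?mulr_ge0 ?exprn_ge0 ?expR_ge0//.
  rewrite /P0 /Pg /P2 !nprod -!prodrXl -!big_split -prodrXl.
  apply: le_trans (_ : \prod_(p <- gnball y | cprime p) expR (8 * ((gn p)%:R `^ (-1)) ^+ 2) <= _).
    apply: ler_prod => p cp; apply/andP; split.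
      by rewrite exprn_ge0 ?mulr_ge0 ?exprn_ge0 ?nc_ge0.
    have pn0 := gprime_neq0 (cprime_gprime cp).
    have e0 : damp d h0 p = ((gn p)%:R `^ (-1 - d))%:C := mulr1 _.
    rewrite e0; apply: le_trans (three_four_one (powR_ge0 _ _) (g1 p pn0)) _.
    rewrite ler_expR ler_pM2l//.
    rewrite ler_pXn2r ?nnegrE ?powR_ge0//; apply: ler_powR; last lra.
    by rewrite ler1n gn_gt0.
  rewrite -expRM_natl -expR_sum; apply: le_trans (_ : expR (8 * 60) <= _).
    rewrite ler_expR -mulr_sumr ler_pM2l//; apply: le_trans (sum_inv_sq_gn y).
    by rewrite big_mkcond; apply: ler_sum => p _; case: ifP => // _; exact: sqr_ge0.
  by rewrite ler_expR; lra.
apply: le_trans (_ : (P0 * F0) ^+ 3 * (Pg * Fg) ^+ 4 * (P2 * F2) <= _).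
  have q0 : 1 <= (P0 * F0) ^+ 3 by exact: exprn_ege1.
  have qg : 1 <= (Pg * Fg) ^+ 4 by exact: exprn_ege1.
  have q1 : 1 <= (P0 * F0) ^+ 3 * (Pg * Fg) ^+ 4.
    by rewrite -[leLHS]mulr1; apply: ler_pM.
  by rewrite -[leLHS]mulr1; apply: ler_pM.
have -> : (P0 * F0) ^+ 3 * (Pg * Fg) ^+ 4 * (P2 * F2) =
  (P0 ^+ 3 * Pg ^+ 4 * P2) * (F0 ^+ 3 * Fg ^+ 4 * F2) by ring.
have -> : expR 240 * nc (wsum (damp d (fun=> 1)) X) ^+ 3 * nc (wsum (damp d g) X) ^+ 4 *
  nc (wsum (damp d (fun n => g n ^+ 2)) X) = expR 240 * (F0 ^+ 3 * Fg ^+ 4 * F2) by rewrite !mulrA.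
by apply: ler_wpM2r; rewrite // !mulr_ge0 ?exprn_ge0.
Qed.

End LowerBound.

Section LogPowers.
Variable R : realType.

Lemma ln_exp_le (A : R) (n : nat) : exists Q0, forall Q, Q0 <= Q -> A * ln Q ^+ n <= Q.
Proof.
exists (expR (Num.max 1 (A * (n.+1)`!%:R))) => Q hQ.
have Q0 : 0 < Q by apply: lt_le_trans hQ; exact: expR_gt0.
have hl : Num.max 1 (A * (n.+1)`!%:R) <= ln Q.
  by rewrite -[leLHS]expRK ler_ln// posrE// expR_gt0.
have l1 : 1 <= ln Q by apply: le_trans hl; rewrite le_max lexx.
have lA : A * (n.+1)`!%:R <= ln Q by apply: le_trans hl; rewrite le_max lexx orbT.
have l0 : 0 <= ln Q by lra.
have h := expR_ge1Dxn n l0; rewrite lnK ?posrE// in h.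
have f0 : 0 < (n.+1)`!%:R :> R by rewrite ltr0n fact_gt0.
have h2 : ln Q ^+ n.+1 <= Q * (n.+1)`!%:R by rewrite -ler_pdivrMr//; lra.
have x0 : 0 <= ln Q ^+ n by exact: exprn_ge0.
have lpos : 0 < ln Q by lra.
rewrite -(ler_pM2l lpos); have -> : ln Q * (A * ln Q ^+ n) = A * ln Q ^+ n.+1.
  by rewrite exprS; ring.
have [A0|A0] := leP 0 A; last first.
  apply: le_trans (_ : 0 <= _); last by rewrite mulr_ge0// ltW.
  by rewrite nmulr_rle0// exprn_ge0.
apply: le_trans (ler_wpM2l A0 h2) _; rewrite mulrCA mulrC; apply: ler_wpM2r => //.
exact: ltW.
Qed.

End LogPowers.

Section TwistedPrimeSums.
Variable R : realType.
Local Notation lgn := (lgn R).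
Local Notation lam := (lam R).

Section Fixed.
Variables (g : gaussInt -> R[i]) (Q : R).
Hypothesis g1 : forall n, n != 0 -> nc (g n) = 1.
Hypothesis gs : small g Q.
Hypothesis lQ1 : 1 <= ln Q.

Let l := ln Q.
(* Beyond norm [Q ^+ 8] the tail of the sum of [g n / gn n] is O(1/Q). *)
Definition cutoff : nat := (Num.truncn (Q ^+ 8)).+1.
Let m0 := cutoff.

Lemma cutoff_Q : 2 <= Q.
Proof.
have Q0 : 0 < Q by rewrite ltNge; apply/negP => /ln0 e; move: lQ1; rewrite e; lra.
by move: lQ1 (ln_le_sub1 Q0); lra.
Qed.

Lemma cutoff_ge : Q ^+ 8 <= m0%:R.
Proof. exact/ltW/truncnS_gt. Qed.

Lemma cutoff_le : m0%:R <= Q ^+ 9.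
Proof.
have Q2 := cutoff_Q; have Q8 : 1 <= Q ^+ 8 by apply: exprn_ege1; lra.
rewrite /m0 /cutoff -natr1.
have : (Num.truncn (Q ^+ 8))%:R <= Q ^+ 8 by rewrite truncn_le//; lra.
rewrite (exprS Q 8); nra.
Qed.

Lemma ln_cutoff : ln m0%:R <= 9 * l.
Proof.
have Q2 := cutoff_Q; have Q0 : 0 < Q by lra.
by rewrite /l mulr_natl -lnXn// ler_ln ?posrE ?exprn_gt0// ?cutoff_le// ltr0n.
Qed.

Lemma cutoff_powR : Q ^+ 2 * m0%:R `^ (- (1 / 4)) <= 1.
Proof.
have Q2 := cutoff_Q; have Q0 : 0 < Q by lra.
have h : Q ^+ 2 <= m0%:R `^ (1 / 4).
  have -> : Q ^+ 2 = (Q ^+ 8) `^ (1 / 4).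
    rewrite -(powR_mulrn 8 (ltW Q0)) -(powR_mulrn 2 (ltW Q0)) -powRrM; congr (_ `^ _); lra.
  have q4 : 0 <= 1 / 4 :> R by lra.
  apply: (ge0_ler_powR q4); rewrite ?nnegrE ?ler0n ?exprn_ge0 ?(ltW Q0)//; exact: cutoff_ge.
have m0p : 0 < m0%:R `^ (1 / 4) :> R by rewrite powR_gt0// ltr0n.
by rewrite powRN ler_pdivrMr// (mul1r (_ `^ _)).
Qed.

Lemma tail_cutoff d X : 0 <= d ->
  nc (\sum_(n <- gnball X | (m0 < gn n)%N) damp d g n) <= 10 / Q.
Proof.
move=> d0; have Q2 := cutoff_Q; have Q0 : 0 < Q by lra.
apply: le_trans (@tail_small R g Q (fun k => k%:R `^ (-1 - d)) m0 X gs (ltW Q0) _ _ _) _ => //.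
- by move=> k h; rewrite powR_ge0 powR_inv_le//; lia.
- by move=> k h; apply: powR_inv_decr => //; lia.
rewrite ler_pdivlMr//; have := cutoff_powR; rewrite expr2; lra.
Qed.

Lemma head_cutoff d X : 0 <= d -> (X <= m0)%N ->
  \sum_(n <- gnball X) nc (damp d g n) <= 300 * l.
Proof.
move=> d0 X0; have [->|Xp] := posnP X.
  by rewrite /gnball big_nil; have l1 : 1 <= l by []; lra.
apply: le_trans (_ : \sum_(n <- gnball X) (gn n)%:R^-1 <= _).
  rewrite big_seq [leRHS]big_seq; apply: ler_sum => n; rewrite mem_gnball => /andP[n0 _].
  by rewrite nc_damp ?powR_inv_le// g1// -gn_gt0.
apply: le_trans (sum_inv_gn R Xp) _.
have : ln X%:R <= ln m0%:R :> R by rewrite ler_ln ?posrE ?ltr0n// ler_nat.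
have := ln_cutoff; move: lQ1; rewrite -/l; lra.
Qed.

Lemma wsum_damp_cutoff d X : 0 <= d -> (m0 <= X)%N ->
  nc (wsum (damp d g) X - wsum (damp d g) m0) <= 10 / Q.
Proof.
move=> d0 hX; rewrite /wsum (gnball_split _ _ hX) addrC addKr /=.
exact: tail_cutoff.
Qed.

Lemma wsum_damp_le d X : 0 <= d -> nc (wsum (damp d g) X) <= 310 * l.
Proof.
move=> d0; have Q2 := cutoff_Q; have Q0 : 0 < Q by lra.
have l1 : 1 <= l by [].
have head Z : (Z <= m0)%N -> nc (wsum (damp d g) Z) <= 300 * l.
  by move=> hZ; apply: le_trans (nc_sum _ _ _) (head_cutoff d0 hZ).
have [h|h] := leqP X m0; first by have := head X h; lra.
have := head m0 (leqnn _); have := wsum_damp_cutoff d0 (ltnW h).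
have := nc_le_sub (wsum (damp d g) X) (wsum (damp d g) m0).
have : 10 / Q <= 10 by rewrite ler_pdivrMr//; lra.
lra.
Qed.

(** Up to the cutoff, 1 - N(n)^(-d) <= d ln N(n) <= 9 d l, and the undamped terms have total modulus
    at most 300 l. *)
Lemma wsum_undamp d : 0 <= d ->
  nc (wsum (damp d g) m0 - wsum (damp 0 g) m0) <= d * (30 * 90) * l ^+ 2.
Proof.
move=> d0; have l1 : 1 <= l by []. 
rewrite /wsum -sumrB; apply: le_trans (nc_sum _ _ _) _.
apply: le_trans (_ : \sum_(n <- gnball m0) d * (9 * l) * nc (damp 0 g n) <= _).
  rewrite big_seq [leRHS]big_seq; apply: ler_sum => n; rewrite mem_gnball => /andP[n0 nm].
  have nR : 0 < (gn n)%:R :> R by rewrite ltr0n.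
  rewrite /damp -mulrBl -rmorphB ncM [leRHS]mulrA ncM mulrA; apply: ler_wpM2r; first exact: nc_ge0.
  rewrite !nc_real subr0 distrC.
  have -> : (gn n)%:R `^ (-1) - (gn n)%:R `^ (-1 - d) =
     (gn n)%:R `^ (-1) * (1 - (gn n)%:R `^ (- d)) :> R.
    by rewrite mulrBr mulr1 -powRD ?(gt_eqF nR) ?implybT.
  rewrite normrM mulrC; apply: ler_wpM2r => //.
  have ln0 : 0 <= ln (gn n)%:R :> R by rewrite ln_ge0// ler1n.
  have lnle : ln (gn n)%:R <= 9 * l.
    by apply: le_trans ln_cutoff; rewrite ler_ln ?posrE ?ltr0n// ler_nat.
  rewrite ger0_norm; last first.
    rewrite subr_ge0 -[leRHS](powRr0 (gn n)%:R); apply: ler_powR; first by rewrite ler1n.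
    lra.
  have := expR_ge1Dx (- d * ln (gn n)%:R : R); rewrite -[X in _ <= X -> _]/(expR _).
  rewrite /powR gt_eqF// => h; have := ler_wpM2l d0 lnle; lra.
rewrite -mulr_sumr; have h := head_cutoff (lexx 0) (leqnn m0).
have -> : d * (30 * 90) * l ^+ 2 = d * (9 * l) * (300 * l) by ring.
by apply: ler_wpM2l => //; rewrite !mulr_ge0//; lra.
Qed.

Lemma wsum_damp_near d X K : 0 <= d -> (m0 <= X)%N -> (m0 <= K)%N ->
  nc (wsum (damp d g) X) <= nc (wsum (damp 0 g) K) + 20 / Q + d * (30 * 90) * l ^+ 2.
Proof.
move=> d0 hX hK.
have h1 := wsum_damp_cutoff d0 hX; have h2 := wsum_damp_cutoff (lexx 0) hK.
have h3 := wsum_undamp d0.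
have := nc_le_sub (wsum (damp d g) X) (wsum (damp d g) m0).
have := nc_le_sub (wsum (damp d g) m0) (wsum (damp 0 g) m0).
have := nc_le_sub (wsum (damp 0 g) m0) (wsum (damp 0 g) K); rewrite (nc_subC _ (wsum _ K)).
lra.
Qed.

End Fixed.

(* The 3-4-1 inequality at [1 + d], with [d] a small multiple of [ln Q ^- 9], so that
   moving back to 1 costs less than the bound obtained. *)
Lemma wsum_lower : exists a Q0 : R, [/\ 0 < a, expR 1 <= Q0 &
  forall (g : gaussInt -> R[i]) Q, Q0 <= Q ->
  (forall m n, m != 0 -> n != 0 -> g (m * n) = g m * g n) ->
  (forall n, n != 0 -> nc (g n) = 1) -> g gI = 1 ->
  small g Q -> small (fun n => g n ^+ 2) Q ->
  forall K, (cutoff Q <= K)%N -> a <= nc (wsum (damp 0 g) K) * ln Q ^+ 7].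
Proof.
have [C4 C40 h341] := damped_three_four_one R.
pose C5 := C4 * 60 ^+ 3 * 310.
have C50 : 0 < C5.
  apply: mulr_gt0; last lra.
  by apply: mulr_gt0 => //; apply: exprn_gt0; lra.
(* If the bound failed, the argument below would give c0^3 <= C5 * 81 * (2700 c0)^4; the choice c0 =
   1 / D contradicts this. *)
pose D := 1 + C5 * 81 * (30 * 90) ^+ 4.
have C5D : 0 < C5 * 81 * (30 * 90) ^+ 4.
  apply: mulr_gt0; first lra.
  by apply: exprn_gt0; lra.
have D0 : 1 < D by rewrite /D ltrDl.
pose c0 := D^-1; have c00 : 0 < c0 by rewrite invr_gt0; lra.
have c01 : c0 <= 1 by rewrite invf_le1; lra.
pose a := (30 * 90) * c0; have a0 : 0 < a by rewrite mulr_gt0.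
have [Q1 hQ1] := ln_exp_le (20 / a) 7.
exists a, (Num.max Q1 (expR 1)); split => //; first by rewrite le_max lexx orbT.
move=> g Q; rewrite ge_max => /andP[QQ1 Qe] gM g1 gI1 gs g2s K hK.
have Q0 : 0 < Q by apply: lt_le_trans Qe; exact: expR_gt0.
have l1 : 1 <= ln Q by rewrite -[leLHS]expRK ler_ln// posrE// expR_gt0.
set l := ln Q in l1 *; have l0 : 0 < l by lra.
(* The exponent 9 balances two quantities: the 3-4-1 inequality gives a lower bound of order (d^3 /
   l)^(1/4) = l^(-7) at 1 + d, and the return to 1 costs d l^2 = l^(-7). *)
pose d := c0 * l ^- 9.
have l9 : 0 < l ^+ 9 by exact: exprn_gt0.
have d0 : 0 < d by rewrite mulr_gt0// invr_gt0.
have d1 : d <= 1.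
  by rewrite /d ler_pdivrMr// mul1r; apply: le_trans c01 _; exact: exprn_ege1.
have [X0 hX0] := h341 g d gM g1 gI1 d0.
pose X := maxn X0 (cutoff Q).
have hX := hX0 X (leq_maxl _ _).
have g21 n : n != 0 -> nc (g n ^+ 2) = 1 by move=> n0; rewrite ncX g1// expr1n.
have F2 := wsum_damp_le g21 g2s l1 X (ltW d0).
have Fg := wsum_damp_near g1 gs l1 (ltW d0) (leq_maxr X0 _) hK.
rewrite -/X -/l in Fg F2.
have F1 : nc (wsum (damp d (fun=> (1 : R[i]))) X) <= 60 / d.
  apply: le_trans (nc_sum _ _ _) _; apply: le_trans (_ : 30 * (1 + d^-1) <= _).
    apply: le_trans (sum_powR_gn X d0); rewrite big_seq [leRHS]big_seq; apply: ler_sum => n _.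
    by rewrite nc_damp// nc1.
  have : 1 <= d^-1 by rewrite -[leLHS]invr1 lef_pV2// posrE.
  lra.
rewrite leNgt; apply/negP => hlt.
set f0 := nc (wsum _ X) in F1 hX; set fg := nc (wsum _ X) in Fg hX.
set f2 := nc (wsum _ X) in F2 hX.
have l7 : 0 < l ^+ 7 by exact: exprn_gt0.
have fgl : fg * l ^+ 7 <= 3 * a.
  have e1 : 20 / Q * l ^+ 7 <= a.
    have := hQ1 Q QQ1; rewrite -/l => h.
    rewrite mulrAC ler_pdivrMr//; move: h.
    have -> : 20 / a * l ^+ 7 = (20 * l ^+ 7) / a by ring.
    by rewrite ler_pdivrMr// (mulrC a).
  have e2 : d * (30 * 90) * l ^+ 2 * l ^+ 7 = a.
    rewrite -mulrA -exprD /d /a.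
    transitivity (30 * 90 * c0 * (l ^- 9 * l ^+ 9)); first by ring.
    by rewrite mulVf ?gt_eqF// mulr1.
  have := ler_wpM2r (ltW l7) Fg.
  rewrite [X in _ <= X -> _]mulrDl e2 [X in _ <= X + _ -> _]mulrDl; lra.
have f00 : 0 <= f0 := nc_ge0 _. have fg0 : 0 <= fg := nc_ge0 _. have f20 : 0 <= f2 := nc_ge0 _.
have k1 : C4 * f0 ^+ 3 * fg ^+ 4 * f2 <= C4 * (60 / d) ^+ 3 * fg ^+ 4 * (310 * l).
  apply: ler_pM => //; first by rewrite !mulr_ge0 ?exprn_ge0// ltW.
  apply: ler_wpM2r; first exact: exprn_ge0.
  apply: ler_wpM2l; first exact: ltW.
  by rewrite ler_pXn2r ?nnegrE// divr_ge0// ltW.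
have k2 : d ^+ 3 <= C5 * fg ^+ 4 * l.
  have := le_trans hX k1.
  have -> : C4 * (60 / d) ^+ 3 * fg ^+ 4 * (310 * l) = (C5 * fg ^+ 4 * l) / d ^+ 3.
    by rewrite /C5 expr_div_n; ring.
  by rewrite ler_pdivlMr ?exprn_gt0// mul1r.
have k3 : fg ^+ 4 * l ^+ 28 <= 81 * a ^+ 4.
  have -> : fg ^+ 4 * l ^+ 28 = (fg * l ^+ 7) ^+ 4 by rewrite exprMn -exprM.
  have -> : 81 * a ^+ 4 = (3 * a) ^+ 4 by ring.
  by rewrite ler_pXn2r ?nnegrE ?mulr_ge0// ?ltW.
have k4 : d ^+ 3 * l ^+ 27 = c0 ^+ 3.
  have -> : l ^+ 27 = (l ^+ 9) ^+ 3 by rewrite -exprM.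
  by rewrite -exprMn /d divfK// gt_eqF.
have k5 : c0 ^+ 3 <= C5 * (81 * a ^+ 4).
  have l27 : 0 <= l ^+ 27 by rewrite exprn_ge0// ltW.
  have := ler_wpM2r l27 k2; rewrite k4 => /le_trans; apply.
  have -> : C5 * fg ^+ 4 * l * l ^+ 27 = C5 * (fg ^+ 4 * l ^+ 28) by rewrite (exprS l 27); ring.
  by rewrite ler_pM2l.
have k6 : C5 * (81 * a ^+ 4) = c0 ^+ 3 * (C5 * 81 * (30 * 90) ^+ 4 * c0).
  by rewrite /a; ring.
have k7 : C5 * 81 * (30 * 90) ^+ 4 * c0 < 1.
  rewrite /c0 -/(_ / D) ltr_pdivrMr; last exact: lt_trans ltr01 D0.
  by rewrite mul1r /D ltrDr ltr01.
have c3 : 0 < c0 ^+ 3 by exact: exprn_gt0.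
move: k5; rewrite k6 leNgt => /negP; apply.
by rewrite -[ltRHS]mulr1 ltr_pM2l.
Qed.

End TwistedPrimeSums.

(** * Prime sums twisted by a multiplicative function with small partial sums *)

Section TwistedMertens.
Variable R : realType.
Local Notation lgn := (lgn R).
Local Notation lam := (lam R).

Lemma ler_ln_nat m n : (0 < m)%N -> (m <= n)%N -> ln m%:R <= ln n%:R :> R.
Proof.
by move=> m0 mn; rewrite ler_ln ?posrE ?ltr0n ?ler_nat//; exact: leq_trans mn.
Qed.

Lemma nc_sum_lam_le (F : gaussInt -> R[i]) (P : pred gaussInt) (B : R) K :
  (forall p, cprime p -> P p -> (gn p <= K)%N -> nc (F p) <= B) ->
  nc (\sum_(p <- gnball K | cprime p && P p) (lam p)%:C * F p) <=
  B * \sum_(p <- gnball K | cprime p && P p) lam p.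
Proof.
move=> h; apply: le_trans (nc_sum _ _ _) _; rewrite mulr_sumr big_seq_cond [leRHS]big_seq_cond.
apply: ler_sum => p /andP[]; rewrite mem_gnball => /andP[_ pK] /andP[cp Pp].
by rewrite ncM nc_real ger0_norm ?lam_ge0// mulrC ler_wpM2r ?lam_ge0// h.
Qed.

Lemma sum_cprime_xpredT (V : nmodType) (F : gaussInt -> V) K :
  \sum_(p <- gnball K | cprime p) F p = \sum_(p <- gnball K | cprime p && xpredT p) F p.
Proof. by apply: eq_bigl => p; rewrite andbT. Qed.

(** The head up to the cutoff is trivial. In the tail the weight ln k / k, divided by Q, is below 1
    / k because ln K <= Q, and it decreases because k is past e; so [tail_small] applies and the
    factor Q is recovered from Q^2 * cutoff^(-1/4) <= 1. *)
Lemma sum_lgn_damp (g : gaussInt -> R[i]) (Q : R) K :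
  (forall n, n != 0 -> nc (g n) = 1) -> small g Q -> 1 <= ln Q -> ln K%:R <= Q ->
  nc (\sum_(n <- gnball K) (lgn n)%:C * damp 0 g n) <= 2700 * ln Q ^+ 2 + 10.
Proof.
move=> g1 gs l1 KQ; have Q2 := cutoff_Q l1; have Q0 : 0 < Q by lra.
pose m0 := cutoff Q; set l := ln Q in l1 *.
have head X : (X <= m0)%N ->
    nc (\sum_(n <- gnball X) (lgn n)%:C * damp 0 g n) <= 2700 * l ^+ 2.
  move=> Xm; apply: le_trans (nc_sum _ _ _) _.
  apply: le_trans (_ : \sum_(n <- gnball X) 9 * l * nc (damp 0 g n) <= _).
    rewrite big_seq [leRHS]big_seq; apply: ler_sum => n; rewrite mem_gnball => /andP[n0 nX].
    rewrite ncM nc_real ger0_norm ?lgn_ge0//; apply: ler_wpM2r; first exact: nc_ge0.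
    apply: le_trans (ln_cutoff l1); rewrite ler_ln ?posrE ?ltr0n// ler_nat.
    exact: leq_trans nX Xm.
  rewrite -mulr_sumr.
  have -> : 2700 * l ^+ 2 = 9 * l * (300 * l) by ring.
  by apply: ler_wpM2l; [lra|exact: (head_cutoff g1 l1 (lexx 0) Xm)].
have [h|h] := leqP K m0; first by have := head K h; lra.
rewrite (gnball_split _ _ (ltnW h)); apply: le_trans (ncD _ _) _; apply: lerD; first exact: head.
pose phi k : R := ln k%:R / (Q * k%:R).
have -> : \sum_(n <- gnball K | (m0 < gn n)%N) (lgn n)%:C * damp 0 g n =
    Q%:C * \sum_(n <- gnball K | (m0 < gn n)%N) (phi (gn n))%:C * g n.
  rewrite mulr_sumr; apply: eq_bigr => n mn.
  have nR : 0 < (gn n)%:R :> R by rewrite ltr0n (leq_ltn_trans _ mn).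
  rewrite /damp subr0 powR_inv1 ?ltW// /phi /lgn !mulrA -!rmorphM /=; congr (_%:C * _).
  by field; rewrite !gt_eqF.
have Q1 : 1 <= Q by lra.
have Q12 := ler_weXn2l Q1 (isT : (2 <= 8)%N).
have Q11 : Q <= Q ^+ 8 by rewrite -[leLHS]expr1; exact: ler_weXn2l.
have m02 : (2 <= m0)%N.
  by rewrite -(ler_nat R); apply: le_trans (cutoff_ge Q); exact: le_trans Q11.
have mpow : (3 <= m0)%N.
  rewrite -(ler_nat R); apply: le_trans (cutoff_ge Q).
  by apply: le_trans Q12; rewrite expr2; nra.
have kp k : (m0 < k)%N -> (0 < k)%N by exact: leq_ltn_trans.
have ln1 k : (m0 < k)%N -> 1 <= ln k%:R :> R.
  move=> mk; rewrite -[leLHS]expRK ler_ln ?posrE ?expR_gt0 ?ltr0n ?kp//.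
  apply: le_trans (_ : Q <= _); first by rewrite -[leRHS](lnK Q0) ler_expR.
  apply: le_trans (_ : m0%:R <= _); last by rewrite ler_nat ltnW.
  exact: le_trans (cutoff_ge Q).
rewrite ncM nc_real ger0_norm ?(ltW Q0)// mulrC -ler_pdivlMr//.
apply: le_trans (@tail_small R g Q phi m0 K gs (ltW Q0) _ _ _) _ => //.
- move=> k /andP[mk kK]; have kR : 0 < k%:R :> R by rewrite ltr0n kp.
  have l1k := ln1 k mk.
  have -> : phi k = ln k%:R / Q * k%:R^-1 by rewrite /phi invfM mulrA.
  have lQ : 0 <= ln k%:R / Q by apply: divr_ge0; lra.
  have kV : 0 <= k%:R^-1 :> R by rewrite invr_ge0.
  apply/andP; split; first exact: mulr_ge0.
  rewrite -[leRHS]mul1r; apply: ler_wpM2r => //; rewrite ler_pdivrMr// mul1r.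
  by apply: le_trans KQ; apply: ler_ln_nat => //; exact: kp.
- move=> k /andP[mk kK]; have kR : 0 < k%:R :> R by rewrite ltr0n kp.
  have l1k := ln1 k mk; rewrite /phi !invfM !(mulrC Q^-1) !mulrA ler_pM2r ?invr_gt0//.
  have k1R : 0 < k.+1%:R :> R by [].
  have e1 : k.+1%:R = k%:R + 1 :> R by rewrite natr1.
  rewrite ler_pdivrMr// mulrAC ler_pdivlMr// [X in _ <= _ * X]e1 mulrDr mulr1.
  have r0 : 0 < k.+1%:R / k%:R :> R by rewrite divr_gt0.
  have := ln_le_sub1 r0; rewrite ln_div ?posrE// => h2.
  have : (ln k.+1%:R - ln k%:R) * k%:R <= 1 :> R.
    apply: le_trans (ler_wpM2r (ltW kR) h2) _; rewrite mulrBl divfK ?gt_eqF// -natr1; lra.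
  rewrite mulrBl; lra.
rewrite ler_pdivlMr//; have := cutoff_powR l1; rewrite expr2; lra.
Qed.

(* With [s K] the sum of [g n / gn n] up to [K], the sum of [lam p * g p * s (K / gn p)]
   is close to [s K] times the sum to be bounded, and [wsum_lower] allows division by [s K]. *)
Lemma twisted_mertens : exists C Q0 : R, [/\ 0 < C, expR 1 <= Q0 &
  forall (g : gaussInt -> R[i]) Q K, Q0 <= Q ->
  (forall m n, m != 0 -> n != 0 -> g (m * n) = g m * g n) ->
  (forall n, n != 0 -> nc (g n) = 1) -> g gI = 1 ->
  small g Q -> small (fun n => g n ^+ 2) Q -> ln K%:R <= Q ->
  nc (\sum_(p <- gnball K | cprime p) (lam p)%:C * g p) <= C * ln Q ^+ 9].
Proof.
have [Cm Cm0 hm] := mertens R.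
have [a [Q0 [a0 Q0e hw]]] := wsum_lower R.
pose C1 := 2700 + 10 + 310 * 32 + 20 + 20 * Cm + 620 * (10 + 2 * Cm).
have C10 : 0 < C1 by rewrite /C1; lra.
exists (C1 / a + 18 + Cm), Q0; split => //.
  by have : 0 < C1 / a; [exact: divr_gt0|lra].
move=> g Q K QQ0 gM g1 gI1 gs g2s KQ.
have Qe : expR 1 <= Q by exact: le_trans QQ0.
have Q0' : 0 < Q by apply: lt_le_trans Qe; exact: expR_gt0.
have l1 : 1 <= ln Q by rewrite -[leLHS]expRK ler_ln// posrE// expR_gt0.
have hwK := hw g Q QQ0 gM g1 gI1 gs g2s K.
pose m0 := cutoff Q; have Q2 := cutoff_Q l1; have lm := ln_cutoff l1; rewrite -/m0 in lm.
have hs := wsum_damp_le g1 gs l1 _ (lexx 0).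
have hd X := @wsum_damp_cutoff R g Q gs l1 0 X (lexx 0).
have hL := sum_lgn_damp g1 gs l1 KQ.
set l := ln Q in l1 lm hs hd hL hwK *.
have l0 : 0 < l by exact: lt_le_trans l1.
have l9 : l <= l ^+ 9 by rewrite -[leLHS]expr1 ler_weXn2l.
have l2 : l <= l ^+ 2 by rewrite -[leLHS]expr1 ler_weXn2l.
have CA : 0 < C1 / a by exact: divr_gt0.
have [->|K0] := posnP K.
  rewrite /gnball big_nil nc0; apply: mulr_ge0; first by rewrite !addr_ge0 ?ltW.
  by rewrite exprn_ge0// ltW.
have m0p : (0 < m0)%N by [].
have mR : 0 < m0%:R :> R by rewrite ltr0n.
have mert X : (0 < X)%N -> \sum_(p <- gnball X | cprime p) lam p <= ln X%:R + Cm.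
  by move=> /hm; rewrite ler_distl => /andP[].
have mert' X : (0 < X)%N -> ln X%:R - Cm <= \sum_(p <- gnball X | cprime p) lam p.
  by move=> /hm; rewrite ler_distl => /andP[].
(* For these K the trivial bound ln K + O(1) from [mertens] is already O(ln Q). *)
have [hK|hK] := leqP K (m0 * m0).
  rewrite sum_cprime_xpredT.
  have F1 p : cprime p -> xpredT p -> (gn p <= K)%N -> nc (g p) <= 1.
    by move=> cp _ _; rewrite g1//; exact/gprime_neq0/cprime_gprime.
  apply: le_trans (nc_sum_lam_le F1) _; rewrite mul1r -sum_cprime_xpredT.
  apply: le_trans (mert K K0) _.
  have : ln K%:R <= ln (m0 * m0)%:R :> R by rewrite ler_ln ?posrE ?ltr0n ?muln_gt0 ?m0p// ler_nat.
  rewrite natrM lnM ?posrE// => h.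
  apply: le_trans (_ : (18 + Cm) * l <= _).
    by move: lm l1 Cm0 h; clear; nra.
  have A0 : 0 <= C1 / a + 18 + Cm by move: CA Cm0; clear; lra.
  apply: le_trans (ler_wpM2l A0 l9); apply: ler_wpM2r; first exact: ltW.
  by move: CA; clear; lra.
pose G := damp 0 g.
have GM m n : m != 0 -> n != 0 -> G (m * n) = G m * G n by move=> m0' n0; apply: dampM; exact: gM.
have GE n : n != 0 -> G n = ((gn n)%:R^-1)%:C * g n.
  by move=> n0; rewrite /G /damp subr0 powR_inv1.
have nG n : n != 0 -> nc (G n) = (gn n)%:R^-1.
  by move=> n0; rewrite GE// ncM g1// mulr1 nc_real ger0_norm// invr_ge0.
have hid := log_identity_primes K GM.
set E := \sum_(p <- gnball K | cprime p) \sum_(2 <= j < K.+1) _ in hid.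
have hE : E <= 310 * 32 * l.
  apply: le_trans (_ : 310 * l * \sum_(p <- gnball K | cprime p)
      \sum_(2 <= j < K.+1) lgn p / (gn p)%:R ^+ j <= _); last first.
    have := sum_prime_powers R K => h.
    have -> : 310 * 32 * l = 310 * l * 32 by ring.
    by apply: (ler_wpM2l _ h); apply: mulr_ge0; [exact: ler0n|exact: ltW].
  rewrite mulr_sumr; apply: ler_sum => p cp; rewrite mulr_sumr; apply: ler_sum => j _.
  rewrite nG ?exprVn; last exact/gprime_neq0/cprime_gprime.
  rewrite mulrC; apply: ler_wpM2r; last exact: hs.
  by rewrite mulr_ge0 ?lgn_ge0// invr_ge0 exprn_ge0.
pose T p := wsum G (K %/ gn p).
set S2 := \sum_(p <- gnball K | cprime p) _ in hid.
have S2E : S2 = \sum_(p <- gnball K | cprime p) (lam p)%:C * (g p * T p).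
  apply: eq_bigr => p cp; rewrite GE; last exact/gprime_neq0/cprime_gprime.
  by rewrite /lam rmorphM /= !mulrA.
pose s := wsum G K.
have S2B : S2 - s * \sum_(p <- gnball K | cprime p) (lam p)%:C * g p =
    \sum_(p <- gnball K | cprime p) (lam p)%:C * (g p * (T p - s)).
  by rewrite S2E mulr_sumr -sumrB; apply: eq_bigr => p _; ring.
(* For primes of norm at most Z the sum to K / N(p) reaches the cutoff, so it differs from [s] by at
   most 20 / Q, and the total is bounded as ln K <= Q. The remaining primes have weight O(l), with a
   difference O(l) each. *)
pose Z := (K %/ m0)%N.
have Zm : (m0 <= Z)%N by rewrite /Z leq_divRL// ltnW.
have ZK : (Z <= K)%N by exact: leq_div.
have Z0 : (0 < Z)%N by exact: leq_trans Zm.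
have hnear : nc (\sum_(p <- gnball Z | cprime p) (lam p)%:C * (g p * (T p - s))) <=
    20 / Q * (Q + Cm).
  rewrite sum_cprime_xpredT.
  have F1 p : cprime p -> xpredT p -> (gn p <= Z)%N -> nc (g p * (T p - s)) <= 20 / Q.
    move=> cp _ pZ; rewrite ncM g1 ?mul1r; last exact/gprime_neq0/cprime_gprime.
    have p0 : (0 < gn p)%N by rewrite gn_gt0; exact/gprime_neq0/cprime_gprime.
    have hp : (m0 <= K %/ gn p)%N.
      by rewrite leq_divRL// mulnC -leq_divRL.
    have h1 := hd _ hp; have h2 := hd _ (leq_trans Zm ZK).
    apply: le_trans (nc_sub_trans (wsum G m0) _ _) _.
    by move: h1 h2; rewrite (nc_subC _ s) /T /s -/m0 -/G; clear; lra.
  apply: le_trans (nc_sum_lam_le F1) _; apply: ler_wpM2l; first exact: divr_ge0 (ler0n _ _) (ltW Q0').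
  rewrite -sum_cprime_xpredT; apply: le_trans (mert Z Z0) _.
  by rewrite lerD2r; apply: le_trans KQ; apply: ler_ln_nat.
have hfar : nc (\sum_(p <- gnball K | cprime p && (Z < gn p)%N) (lam p)%:C * (g p * (T p - s))) <=
    620 * l * (9 * l + 1 + 2 * Cm).
  have F1 p : cprime p -> (Z < gn p)%N -> (gn p <= K)%N -> nc (g p * (T p - s)) <= 620 * l.
    move=> cp _ _; rewrite ncM g1 ?mul1r; last exact/gprime_neq0/cprime_gprime.
    apply: le_trans (ncB _ _) _; have := hs K; have := hs (K %/ gn p)%N; rewrite /T /s /G; clear; lra.
  apply: le_trans (nc_sum_lam_le F1) _; apply: ler_wpM2l.
    by apply: mulr_ge0; [exact: ler0n|exact: ltW].
  have := @gnball_split _ Z K (@cprime) lam ZK.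
  have := mert K K0; have := mert' Z Z0.
  have : ln K%:R <= ln Z%:R + (1 + ln m0%:R) :> R.
    have h2 : K%:R <= Z%:R * (2 * m0%:R) :> R.
      rewrite -!natrM ler_nat; have := ltn_ceil K m0p; rewrite -/Z.
      move=> /ltnW/leq_trans; apply; rewrite mulnA leq_mul2r; apply/orP; right.
      by rewrite mulnC mul2n -addnn -[X in (X <= _)%N]addn1 leq_add2l.
    have Zr : 0 < Z%:R :> R by rewrite ltr0n.
    apply: le_trans (_ : ln (Z%:R * (2 * m0%:R)) <= _).
      by rewrite ler_ln ?posrE ?ltr0n ?mulr_gt0.
    rewrite lnM ?posrE ?mulr_gt0// lnM ?posrE//; have := ln2_le1 R; clear; lra.
  by move: lm Cm0; clear; lra.
have hS2 : nc (S2 - s * \sum_(p <- gnball K | cprime p) (lam p)%:C * g p) <=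
    20 / Q * (Q + Cm) + 620 * l * (9 * l + 1 + 2 * Cm).
  rewrite S2B (gnball_split _ _ ZK); apply: le_trans (ncD _ _) _; exact: lerD.
set M := \sum_(p <- gnball K | cprime p) _ in hS2 *.
have hQ : 20 / Q * (Q + Cm) <= 20 + 20 * Cm.
  rewrite mulrDr divfK ?gt_eqF// lerD2l ler_wpM2r ?(ltW Cm0)// ler_pdivrMr//.
  by move: Q2; clear; lra.
have hsM : nc (s * M) <= C1 * l ^+ 2.
  set L := \sum_(n <- gnball K) _ in hid.
  have hL' : nc L <= 2700 * l ^+ 2 + 10 by exact: hL.
  have t1 : nc (s * M) <= nc (S2 - s * M) + (nc (L - S2) + nc L).
    rewrite [X in nc X <= _](_ : _ = - (S2 - s * M) - (L - S2) + L); last by ring.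
    apply: le_trans (ncD _ _) _; rewrite addrA lerD2r.
    by apply: le_trans (ncB _ _) _; rewrite ncN.
  have l21 : 1 <= l ^+ 2 by exact: le_trans l2.
  have x1 : Cm * l <= Cm * l ^+ 2 by rewrite ler_pM2l.
  have x2 : Cm <= Cm * l ^+ 2 by rewrite -[leLHS]mulr1 ler_pM2l.
  have x3 : 620 * l * (9 * l + 1 + 2 * Cm) = 620 * 9 * l ^+ 2 + 620 * l + 1240 * (Cm * l).
    by ring.
  have x4 : C1 * l ^+ 2 = (2700 + 10 + 310 * 32 + 20 + 6200) * l ^+ 2 + 1260 * (Cm * l ^+ 2).
    by rewrite /C1; ring.
  rewrite x4; rewrite x3 in hS2.
  by move: t1 hS2 hQ hid hE hL' l21 x1 x2 l2 l1 Cm0; clear; lra.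
have hlow : a <= nc s * l ^+ 7 by apply: hwK; exact: leq_trans ZK.
(* The exponent is 2 + 7: the product [s * M] is O(l^2), and [|s|] is at least [a] times l^(-7). *)
have sp : a * nc M <= C1 * l ^+ 9.
  apply: le_trans (ler_wpM2r (nc_ge0 _) hlow) _.
  rewrite mulrAC -ncM (exprD l 2 7) mulrA; apply: ler_wpM2r => //.
  by rewrite exprn_ge0// ltW.
have l9p : 0 <= l ^+ 9 by rewrite exprn_ge0// ltW.
apply: le_trans (_ : C1 / a * l ^+ 9 <= _).
  by rewrite mulrAC ler_pdivlMr// mulrC.
apply: ler_wpM2r => //; move: Cm0; clear; lra.
Qed.

End TwistedMertens.

(** * The characters (n / |n|)^m * N(n)^(i t) *)

Section TwistedCharacters.
Variable R : realType.
Local Notation lgn := (lgn R).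

(** Partial summation: from k to k + 1 the twist moves by at most |t| / k, so comparing the twisted
    sum with [expi (t * ln K)] times the plain one costs |t| times the sum of B k^(3/4 - 1). *)
Lemma expi_twist_sum (F : gaussInt -> R[i]) (B t : R) K : 0 <= B ->
  (forall k, nc (\sum_(n <- gnball k) F n) <= B * k%:R `^ (3 / 4)) ->
  nc (\sum_(n <- gnball K) F n * expi (t * lgn n)) <= B * (1 + 2 * `|t|) * K%:R `^ (3 / 4).
Proof.
move=> B0 hB; pose S k := \sum_(n <- gnball k) F n.
suff h : nc (\sum_(n <- gnball K) F n * expi (t * lgn n) - expi (t * ln K%:R) * S K) <=
    B * `|t| * \sum_(1 <= k < K) k%:R `^ (3 / 4 - 1).
  have h2 : \sum_(1 <= k < K) k%:R `^ (3 / 4 - 1) <= 2 * K%:R `^ (3 / 4) :> R.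
    apply: le_trans (_ : \sum_(1 <= k < K.+1) k%:R `^ (3 / 4 - 1) <= _).
      have [->|K0] := posnP K; first by rewrite !big_geq.
      by rewrite [leRHS]big_nat_recr//= lerDl powR_ge0.
    apply: le_trans (sum_powR_le K _) _; first by apply/andP; split; lra.
    rewrite mulrC; apply: ler_wpM2r; [exact: powR_ge0|lra].
  have := nc_le_sub (\sum_(n <- gnball K) F n * expi (t * lgn n)) (expi (t * ln K%:R) * S K).
  rewrite [nc (expi _ * _)]ncM nc_expi mul1r; have := hB K.
  have := ler_wpM2l (mulr_ge0 B0 (normr_ge0 t)) h2; rewrite -/(S K); move: h; clear; lra.
elim: K => [|K IH].
  by rewrite /S /gnball !big_nil mulr0 subrr nc0 !mulr_ge0// sumr_ge0// => k _; exact: powR_ge0.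
have [->|K0] := posnP K.
  rewrite /S; have -> : \sum_(n <- gnball 1) F n * expi (t * lgn n) =
     expi (t * ln 1) * \sum_(n <- gnball 1) F n.
    rewrite mulr_sumr big_seq [RHS]big_seq; apply: eq_bigr => n; rewrite mem_gnball => h.
    by rewrite mulrC /lgn (_ : gn n = 1%N)//; lia.
  by rewrite subrr nc0 !mulr_ge0// sumr_ge0// => k _; exact: powR_ge0.
rewrite big_nat_recr//= mulrDr.
have KR : 0 < K%:R :> R by rewrite ltr0n.
set w := expi (t * ln K.+1%:R) in IH *.
have sE : \sum_(n <- gnball K.+1) F n * expi (t * lgn n) =
    \sum_(n <- gnball K) F n * expi (t * lgn n) + w * \sum_(n <- shell K.+1) F n.
  rewrite gnball_recr big_cat /=; congr (_ + _); rewrite mulr_sumr /shell !big_filter.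
  by apply: eq_bigr => n /eqP e; rewrite mulrC /lgn e.
rewrite sE [S K.+1]/S gnball_recr big_cat /= -/(S K).
set X := \sum_(n <- gnball K) _ in IH *; set Y := \sum_(n <- shell _) _.
have -> : X + w * Y - w * (S K + Y) =
    (X - expi (t * ln K%:R) * S K) + (expi (t * ln K%:R) - w) * S K by ring.
apply: le_trans (ncD _ _) _; apply: lerD; first exact: IH.
rewrite ncM.
have h1 : nc (expi (t * ln K%:R) - w) <= `|t| / K%:R.
  apply: le_trans (nc_expi_lip _ _) _; rewrite -mulrBr normrM ler_wpM2l//.
  rewrite distrC ger0_norm; last by rewrite subr_ge0 ler_ln ?posrE// ler_nat.
  rewrite -ln_div ?posrE//; apply: le_trans (ln_le_sub1 _) _; first by rewrite divr_gt0.
  by rewrite -natr1 mulrDl divff ?gt_eqF// mul1r addrC addKr.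
apply: le_trans (ler_pM (nc_ge0 _) (nc_ge0 _) h1 (hB K)) _.
rewrite le_eqVlt; apply/orP; left; apply/eqP.
have -> : K%:R `^ (3 / 4 - 1) = K%:R `^ (3 / 4) / K%:R :> R.
  rewrite -[X in _ = _ / X](powRr1 (ler0n R K)) -powRN -powRD//.
  by rewrite (gt_eqF KR) implybT.
by ring.
Qed.

Definition twist (m : nat) (t : R) (n : gaussInt) : R[i] := dir R n ^+ m * expi (t * lgn n).

Lemma nc_twist m t n : n != 0 -> nc (twist m t n) = 1.
Proof. by move=> n0; rewrite ncM nc_expi mulr1 ncX nc_dir// expr1n. Qed.

Lemma twistM m t n k : n != 0 -> k != 0 -> twist m t (n * k) = twist m t n * twist m t k.
Proof.
by move=> n0 k0; rewrite /twist dirM exprMn lgnM// mulrDr expiD mulrACA.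
Qed.

Lemma twist_sqr m t n : twist m t n ^+ 2 = twist (2 * m) (2 * t) n.
Proof. by rewrite /twist exprMn -exprM (mulnC m) -expi_mulrn mulrA. Qed.

(** Triviality on units, which makes the four units add up in [euler_lower]. *)
Lemma twist_gI m t : (4 %| m)%N -> twist m t gI = 1.
Proof.
move=> /dvdnP[k ->]; rewrite /twist dirI /lgn gnI ln1 mulr0 expi0 mulr1 mulnC exprM.
by rewrite (_ : 'i ^+ 4 = 1) ?expr1n// (exprM _ 2 2) sqr_i sqrrN expr1n.
Qed.

Lemma small_twist : exists2 C : R, 0 < C & forall m t, (0 < m)%N ->
  small (twist m t) (C * m.+1%:R * (1 + 2 * `|t|)).
Proof.
have [C C0 hC] := chisum_bound R; exists C => // m t m0 K.
apply: (@expi_twist_sum (fun n => dir R n ^+ m)).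
  by rewrite mulr_ge0// ltW.
move=> [|k]; first by rewrite /gnball big_nil nc0 !mulr_ge0// ?powR_ge0// ltW.
exact: hC.
Qed.

Lemma sum_twist : exists C Q0 : R, [/\ 0 < C, 0 < Q0 &
  forall m t Q K, (0 < m)%N -> (4 %| m)%N -> Q0 <= Q -> Q0 * m.+1%:R * (1 + `|t|) <= Q ->
  ln K%:R <= Q ->
  nc (\sum_(p <- gnball K | cprime p) (lam R p)%:C * twist m t p) <= C * ln Q ^+ 9].
Proof.
have [C [Q0 [C0 Q0e hC]]] := twisted_mertens R.
have [C1 C10 h1] := small_twist.
(* The factor 8 also covers the squared twist, whose parameters 2 m and 2 t satisfy (2 m + 1)(1 + 4
   |t|) <= 8 (m + 1)(1 + |t|). *)
exists C, (Q0 + 8 * C1); split => //; first by rewrite addr_gt0 ?mulr_gt0//; apply: lt_le_trans Q0e; exact: expR_gt0.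
have Q00 : 0 < Q0 by apply: lt_le_trans Q0e; exact: expR_gt0.
move=> m t Q K m0 m4 QQ0 hQ KQ.
have small_le (g : gaussInt -> R[i]) q : small g q -> q <= Q -> small g Q.
  move=> gs qQ k; apply: le_trans (gs k) _; apply: ler_wpM2r => //; exact: powR_ge0.
have t0 := normr_ge0 t; have mR : 0 < m.+1%:R :> R by [].
have mt : 0 <= m.+1%:R * (1 + `|t|) by rewrite mulr_ge0//; lra.
have hQ' : 8 * C1 * (m.+1%:R * (1 + `|t|)) <= Q.
  apply: le_trans hQ; rewrite -(mulrA (Q0 + _)); apply: ler_wpM2r => //; lra.
apply: hC => //.
- by lra.
- by move=> n k n0 k0; exact: twistM.
- by move=> n n0; exact: nc_twist.
- exact: twist_gI.
- apply: small_le (h1 m t m0) _; apply: le_trans hQ'; rewrite -mulrA.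
  have : m.+1%:R * (1 + 2 * `|t|) <= 2 * (m.+1%:R * (1 + `|t|)) by nra.
  by move=> /(ler_wpM2l (ltW C10)); nra.
have -> : (fun n => twist m t n ^+ 2) = twist (2 * m) (2 * t).
  by apply/funext => n; exact: twist_sqr.
have m20 : (0 < 2 * m)%N by rewrite muln_gt0.
apply: small_le (h1 _ _ m20) _; apply: le_trans hQ'; rewrite -mulrA.
have : (2 * m).+1%:R * (1 + 2 * `|2 * t|) <= 8 * (m.+1%:R * (1 + `|t|)).
  have : (2 * m).+1%:R <= 2 * m.+1%:R :> R by rewrite -natrM ler_nat mulnS -addn1 addnC leq_add2r.
  rewrite normrM (ger0_norm (_ : 0 <= 2))//; nra.
by move=> /(ler_wpM2l (ltW C10)); nra.
Qed.

End TwistedCharacters.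

(** * Jackson's kernel and Lipschitz weights *)

Section FiniteFourier.
Variable R : realType.
Variable M : nat.
Hypothesis M0 : (0 < M)%N.

Definition grid (j l : nat) : R[i] := expi (2 * pi * (j * l)%:R / M%:R).

Lemma gridC j l : grid j l = grid l j.
Proof. by rewrite /grid mulnC. Qed.

Lemma gridX j l : grid j l = grid j 1 ^+ l.
Proof. by rewrite /grid -expi_mulrn muln1 natrM; congr expi; ring. Qed.

Lemma nc_grid j l : nc (grid j l) = 1.
Proof. exact: nc_expi. Qed.

Lemma expi_neq1 (y : R) : 0 < y < pi -> expi (2 * y) != 1.
Proof.
move=> h; apply/eqP => /(congr1 (fun z => Re z)) /=; rewrite mulr_natl cos_mulr2n.
have := cos2Dsin2 y; by have := sin_gt0_pi h; nra.
Qed.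

Lemma mulC_conj (z w : R[i]) : z * w^*%C = (w * z^*%C)^*%C.
Proof.
case: z w => a b [c d]; apply/eqP; rewrite eq_complex /=.
by apply/andP; split; apply/eqP; ring.
Qed.

Lemma grid_M j : grid j M = 1.
Proof.
rewrite /grid natrM mulrA mulfK ?pnatr_eq0 -?lt0n// mulrC expi_mulrn.
by rewrite /expi mulr_natl cos2pi sin2pi expr1n.
Qed.

Lemma grid_orth j k : (j < k < M)%N -> \sum_(l < M) grid k l * (grid j l)^*%C = 0.
Proof.
move=> /andP[jk kM]; pose d := (k - j)%N.
have e l : grid k l * (grid j l)^*%C = grid d 1 ^+ l.
  rewrite -gridX /grid expi_conj -expiD; congr expi.
  by rewrite /d mulnBl natrB ?leq_mul2r ?(ltnW jk) ?orbT//; ring.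
rewrite (eq_bigr _ (fun l _ => e _)).
have d1 : grid d 1 != 1.
  rewrite /grid (_ : _ / _ = 2 * (pi * d%:R / M%:R)); last by rewrite muln1; ring.
  have MR : 0 < M%:R :> R by rewrite ltr0n.
  apply: expi_neq1; rewrite ltr_pdivrMr// divr_gt0 ?mulr_gt0 ?pi_gt0 ?ltr0n ?subn_gt0//=.
  by rewrite ltr_pM2l ?pi_gt0// ltr_nat /d; lia.
have := subrX1 (grid d 1) M; rewrite -gridX grid_M subrr => /esym/eqP.
by rewrite mulf_eq0 subr_eq0 (negbTE d1) => /eqP.
Qed.

Lemma grid_orth_neq j k : j != k -> (j < M)%N -> (k < M)%N ->
  \sum_(l < M) grid k l * (grid j l)^*%C = 0.
Proof.
move=> jk jM kM; have [lt|lt|/eqP] := ltngtP j k; last by rewrite (negbTE jk).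
  by rewrite grid_orth ?lt.
rewrite (eq_bigr _ (fun (l : 'I_M) _ => mulC_conj (grid k l) (grid j l))).
by rewrite -rmorph_sum grid_orth ?lt// rmorph0.
Qed.

(** The bound K <= M keeps the frequencies distinct modulo M, so that the off-diagonal terms vanish
    by orthogonality. *)
Lemma grid_parseval (s : nat -> R[i]) K : (K <= M)%N ->
  \sum_(j < M) nc (\sum_(l < K) s l * grid j l) ^+ 2 = M%:R * \sum_(l < K) nc (s l) ^+ 2.
Proof.
move=> KM; apply: (@complexI R); rewrite rmorphM !rmorph_sum /= mulr_sumr.
transitivity (\sum_(j < M) \sum_(l < K) \sum_(k < K)
    (s l * (s k)^*%C) * (grid l j * (grid k j)^*%C)).
  apply: eq_bigr => j _; rewrite -mul_conj rmorph_sum mulr_suml; apply: eq_bigr => l _.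
  rewrite mulr_sumr; apply: eq_bigr => k _; rewrite rmorphM (gridC j l) (gridC j k).
  by rewrite mulrACA.
have kM (k : 'I_K) : (k < M)%N by exact: leq_trans KM.
rewrite exchange_big; apply: eq_bigr => l _; rewrite exchange_big.
transitivity (\sum_(k < K) (s l * (s k)^*%C) * \sum_(j < M) grid l j * (grid k j)^*%C).
  by apply: eq_bigr => k _; rewrite mulr_sumr.
transitivity (\sum_(k < K) if k == l then (M%:R)%:C * (nc (s l) ^+ 2)%:C else 0).
  apply: eq_bigr => k _; case: eqVneq => [->|kl]; last by rewrite grid_orth_neq ?mulr0 ?kM.
  rewrite mul_conj mulrC (eq_bigr (fun=> 1)); last by move=> j _; rewrite mul_conj nc_grid expr1n.
  by rewrite sumr_const card_ord rmorph_nat.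
by rewrite -big_mkcond big_pred1_eq.
Qed.

End FiniteFourier.

Section Triangle.
Variable n : nat.

(** The number of ways to write l as a sum of two integers in [0, n): the coefficients of the
    squared geometric sum. *)
Definition tri (l : nat) : nat := \sum_(a < n) (a <= l < a + n)%N.

Lemma sum_tri (K : comNzRingType) (z : K) :
  \sum_(l < 2 * n) (tri l)%:R * z ^+ l = (\sum_(l < n) z ^+ l) ^+ 2.
Proof.
transitivity (\sum_(l < 2 * n) \sum_(a < n) (a <= l < a + n)%N%:R * z ^+ l).
  by apply: eq_bigr => l _; rewrite /tri natr_sum mulr_suml.
rewrite exchange_big /= expr2 mulr_suml; apply: eq_bigr => a _.
rewrite mulr_sumr -(big_mkord xpredT (fun l => z ^+ a * z ^+ l)).
rewrite -(big_mkord xpredT (fun l => (a <= l < a + n)%N%:R * z ^+ l)).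
have an := ltn_ord a.
rewrite (@big_cat_nat _ _ _ a)//=; last by lia.
rewrite big_nat big1 ?add0r => [|l /andP[_ la]]; last by rewrite leqNgt la mul0r.
rewrite (@big_cat_nat _ _ _ (a + n))//=; [|by lia|by lia].
rewrite [X in _ + X]big_nat [X in _ + X]big1 ?addr0 => [|l /andP[la _]]; last first.
  by rewrite ltnNge la andbF mul0r.
rewrite -{1}[a : nat]add0n [in X in \sum_(_ <= _ < X) _]addnC big_addn addnK; apply: eq_big_nat => l h.
by rewrite leq_addl (addnC a) ltn_add2r (andP h).2 mul1r addnC exprD.
Qed.

Lemma tri_sum (R : comNzRingType) : \sum_(l < 2 * n) (tri l)%:R = n%:R ^+ 2 :> R.
Proof.
have := @sum_tri R 1; rewrite (eq_bigr (fun l : 'I__ => (tri l)%:R)).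
  by move=> ->; rewrite (eq_bigr (fun=> 1)) ?sumr_const ?card_ord// => l _; rewrite expr1n.
by move=> l _; rewrite expr1n mulr1.
Qed.

Lemma tri_sum_sqr (R : realFieldType) : n%:R ^+ 3 <= 2 * \sum_(l < 2 * n) (tri l)%:R ^+ 2 :> R.
Proof.
(* n / 2 is the average of the 2 n coefficients, so this is the Cauchy-Schwarz lower bound for their
   squares. *)
have : 0 <= \sum_(l < 2 * n) ((tri l)%:R - n%:R / 2) ^+ 2 :> R.
  by apply: sumr_ge0 => l _; exact: sqr_ge0.
rewrite (eq_bigr (fun l : 'I__ => (tri l)%:R ^+ 2 - n%:R * (tri l)%:R + n%:R ^+ 2 / 4)).
  rewrite big_split /= sumrB -mulr_sumr tri_sum sumr_const card_ord -[X in _ + X]mulr_natl natrM.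
  have -> : n%:R ^+ 3 = n%:R * n%:R ^+ 2 :> R by rewrite exprS.
  lra.
by move=> l _; field.
Qed.

End Triangle.

Section LipschitzTest.
Variable R : realType.

Lemma pi_le4 : pi <= 4 :> R.
Proof. by have := pihalf_lt2 R; lra. Qed.

(** With z = y / 2 in [0, 2], z - z^3 / 6 <= sin z gives sin z >= z / 3, and 1 - cos y = 2 sin(z)^2
    >= y^2 / 18. *)
Lemma one_sub_cos_ge (y : R) : `|y| <= pi -> y ^+ 2 <= 18 * (1 - cos y).
Proof.
wlog y0 : y / 0 <= y => [H|].
  have [/H//|/ltW y0] := leP 0 y.
  by have := H (- y); rewrite cosN sqrrN normrN oppr_ge0 => /(_ y0).
rewrite ger0_norm// => ypi; have := pi_le4.
have -> : y = (y / 2) *+ 2 by rewrite -mulr_natr divfK.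
rewrite cos_mulr2n; set z := y / 2 => p4.
have z0 : 0 <= z by rewrite divr_ge0.
have z2 : z <= 2 by rewrite /z; lra.
have h : z / 3 <= sin z.
  apply: le_trans (sin_ge z0).
  have : z * z <= 4 by nra.
  rewrite (exprS z 2) expr2; nra.
have := cos2Dsin2 z; rewrite -mulr_natr exprMn; nra.
Qed.

(** A function on [0, pi] composed with this map is its even extension to the circle, which has no
    jump; a periodic extension would have one. *)
Definition fold_angle (t : R) : R := if t <= pi then t else 2 * pi - t.

Lemma fold_angle_bound t : 0 <= t <= 2 * pi -> 0 <= fold_angle t <= pi.
Proof.
move=> /andP[t0 t2]; rewrite /fold_angle; case: (leP t pi) => h; apply/andP; split; lra.
Qed.

(* Reflecting the circle to [0, pi] does not increase distances. *)
Lemma fold_angle_dist x t : 0 <= x <= pi -> 0 <= t <= 2 * pi ->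
  (x - fold_angle t) ^+ 2 <= 18 * (1 - cos (t - x)).
Proof.
move=> /andP[x0 x1] ht; have /andP[r0 r1] := fold_angle_bound ht.
apply: le_trans (one_sub_cos_ge _) _; first by rewrite ler_norml; apply/andP; split; lra.
rewrite ler_pM2l// lerD2l lerN2; move: r0 r1; rewrite /fold_angle.
case: (leP t pi) => h r0 r1; first by rewrite -cosN opprB.
have -> : cos (x - (2 * pi - t)) = cos (x + t).
  rewrite (_ : x + t = x - (2 * pi - t) + pi + pi); last by ring.
  by rewrite !cosDpi opprK.
move: ht => /andP[t0 t2]; rewrite (cosB t x) (cosD x t).
have s1 : 0 <= sin x by apply: sin_ge0_pi; rewrite x0.
have s2 : sin t <= 0.
  rewrite -oppr_ge0 -sinDpi (_ : t + pi = t - pi + pi + pi); last by ring.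
  rewrite !sinDpi opprK; apply: sin_ge0_pi; apply/andP; split; lra.
nra.
Qed.

Definition geo (n : nat) (z : R[i]) : R[i] := \sum_(l < n) z ^+ l.

Definition node (n j : nat) : R := 2 * pi * j%:R / n%:R.

Lemma gridE n j : grid R n j 1 = expi (node n j).
Proof. by rewrite /grid muln1. Qed.

Lemma conj_mul_conj (z w : R[i]) : (z^*%C * w)^*%C = z * w^*%C.
Proof.
case: z w => a b [c d]; apply/eqP; rewrite eq_complex /=.
by apply/andP; split; apply/eqP; ring.
Qed.

Section Kernel.
Variable n : nat.
Hypothesis n0 : (0 < n)%N.
Let M := (2 * n)%N.

Let M0 : (0 < M)%N. Proof. by rewrite muln_gt0. Qed.

Lemma expi_nodeB x j : expi (node M j - x) = expi (- x) * grid R M j 1.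
Proof. by rewrite gridE expiD mulrC. Qed.

Lemma sum_geo_sqr (x : R) : \sum_(j < M) nc (geo n (expi (node M j - x))) ^+ 2 = M%:R * n%:R.
Proof.
have nM : (n <= M)%N by rewrite /M; lia.
have := grid_parseval M0 (fun l => expi (- x) ^+ l) nM.
rewrite (eq_bigr (fun j : 'I_M => nc (geo n (expi (node M j - x))) ^+ 2)); last first.
  move=> j _; congr (nc _ ^+ 2); apply: eq_bigr => l _.
  by rewrite expi_nodeB exprMn -gridX.
move=> ->; congr (_ * _); rewrite (eq_bigr (fun=> 1)) ?sumr_const ?card_ord// => l _.
by rewrite ncX nc_expi !expr1n.
Qed.

Lemma jacksonE (x : R) (j : nat) : nc (geo n (expi (node M j - x))) ^+ 4 =
  nc (\sum_(l < M) (tri n l)%:R * expi (- x) ^+ l * grid R M j l) ^+ 2.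
Proof.
rewrite (eq_bigr (fun l : 'I_M => (tri n l)%:R * expi (node M j - x) ^+ l)).
  by rewrite sum_tri -/(geo _ _) ncX -exprM.
by move=> l _; rewrite expi_nodeB exprMn -gridX mulrA.
Qed.

Lemma jackson_total (x : R) : \sum_(j < M) nc (geo n (expi (node M j - x))) ^+ 4 =
  M%:R * \sum_(l < M) (tri n l)%:R ^+ 2.
Proof.
rewrite (eq_bigr _ (fun (j : 'I_M) _ => jacksonE x j)).
rewrite (grid_parseval M0 (fun l => (tri n l)%:R * expi (- x) ^+ l) (leqnn _)).
congr (_ * _); apply: eq_bigr => l _.
by rewrite ncM nc_nat ncX nc_expi expr1n mulr1.
Qed.

(** Summing the geometric series gives |expi y - 1| * |geo| <= 2, that is |geo|^2 (1 - cos y) <= 2.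
    This takes care of half of the fourth power, and [sum_geo_sqr] of the other half. *)
Lemma jackson_moment (x : R) :
  \sum_(j < M) nc (geo n (expi (node M j - x))) ^+ 4 * (1 - cos (node M j - x)) <= 2 * M%:R * n%:R.
Proof.
rewrite -mulrA -(sum_geo_sqr x) mulr_sumr; apply: ler_sum => j _.
set y := _ - x; set D := nc _.
have h : D ^+ 2 * (1 - cos y) <= 2.
  have e : nc (expi y - 1) ^+ 2 = 2 * (1 - cos y).
    by rewrite -expi0 nc_expiB subr0.
  have : nc (expi y - 1) * D <= 2.
    rewrite -ncM -subrX1; apply: le_trans (ncB _ _) _.
    by rewrite ncX nc_expi expr1n nc1.
  have D0 : 0 <= D := nc_ge0 _; have E0 := nc_ge0 (expi y - 1).
  move=> h; have : (nc (expi y - 1) * D) ^+ 2 <= 4.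
    by rewrite expr2; have := mulr_ge0 E0 D0; nra.
  rewrite exprMn e; lra.
have -> : D ^+ 4 * (1 - cos y) = D ^+ 2 * (1 - cos y) * D ^+ 2 by rewrite (exprD D 2 2); ring.
by rewrite ler_wpM2r// exprn_ge0// nc_ge0.
Qed.

Lemma jackson_coef : n%:R ^+ 3 <= 2 * \sum_(l < M) (tri n l)%:R ^+ 2 :> R.
Proof. exact: tri_sum_sqr. Qed.

Lemma grid_fourier_sum (w : nat -> R[i]) l : (forall j, (j < M)%N -> nc (w j) <= 1) ->
  \sum_(k < M) nc (\sum_(j < M) w j * grid R M j l * (grid R M j k)^*%C) ^+ 2 <= M%:R ^+ 2.
Proof.
move=> w1; rewrite (eq_bigr (fun k : 'I_M =>
    nc (\sum_(j < M) (w j * grid R M j l)^*%C * grid R M k j) ^+ 2)); last first.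
  move=> k _; rewrite -[in RHS]nc_conj rmorph_sum; congr (nc _ ^+ 2).
  by apply: eq_bigr => j _; rewrite (gridC _ M k j); exact/esym/conj_mul_conj.
rewrite (grid_parseval M0 (fun j => (w j * grid R M j l)^*%C) (leqnn _)) expr2 ler_wpM2l//.
apply: le_trans (_ : \sum_(j < M) 1 <= _); last by rewrite sumr_const card_ord.
apply: ler_sum => j _; rewrite nc_conj ncM nc_grid mulr1.
by rewrite expr_le1 ?nc_ge0// w1.
Qed.

End Kernel.

End LipschitzTest.

Section LipschitzSum.
Variable R : realType.

(* [W] is replaced by its Jackson mean over [2 * q ^ 2] nodes; Cauchy-Schwarz and Parseval
   then cost only a factor [q] on the Fourier side. *)
Lemma lipschitz_test (I : eqType) (s : seq I) (P : pred I) (b : I -> R[i])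
    (u : I -> R) (W : I -> R[i]) (w : R -> R[i]) (V L e B S : R) (q : nat) :
  0 < V -> 0 <= L -> 0 <= e -> (0 < q)%N ->
  (forall i, i \in s -> P i -> 0 <= u i <= V) ->
  (forall v, 0 <= v <= V -> nc (w v) <= 1) ->
  (forall i v, i \in s -> P i -> 0 <= v <= V -> nc (W i - w v) <= L * `|u i - v| + e) ->
  (forall l k, (l < 2 * q ^ 2)%N -> (k < 2 * q ^ 2)%N ->
     nc (\sum_(i <- s | P i) b i * expi ((l%:R - k%:R) * (pi / V) * u i)) <= B) ->
  \sum_(i <- s | P i) nc (b i) <= S ->
  nc (\sum_(i <- s | P i) b i * W i) <= 2 * B * q%:R + S * (20 * L * V / q%:R ^+ 2 + e).
Proof.
move=> V0 L0 e0 q0 uV w1 hW hB hS.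
pose n := (q ^ 2)%N; pose M := (2 * n)%N.
have n0 : (0 < n)%N by rewrite expn_gt0 q0.
have pi0 := pi_gt0 R.
have nR : 0 < n%:R :> R by rewrite ltr0n.
have qR : 0 < q%:R :> R by rewrite ltr0n.
have nq : n%:R = q%:R ^+ 2 :> R by rewrite natrX.
have MR : 0 < M%:R :> R by rewrite ltr0n muln_gt0.
have ME : M%:R = 2 * n%:R :> R by rewrite natrM.
pose J i (j : nat) := nc (geo n (expi (node R M j - pi / V * u i))) ^+ 4.
(* [0, V] is rescaled to [0, pi] and extended evenly, so every node of the circle gives a sample
   point of [w]. *)
pose v j := V / pi * fold_angle (node R M j).
pose S2 : R := \sum_(l < M) (tri n l)%:R ^+ 2.
have S20 : n%:R ^+ 3 <= 2 * S2 := jackson_coef R n.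
have n3 : 0 < n%:R ^+ 3 :> R by exact: exprn_gt0.
have S2p : 0 < S2 by lra.
have JT i : \sum_(j < M) J i j = M%:R * S2 by exact: jackson_total.
have J0 i j : 0 <= J i j by rewrite exprn_ge0// nc_ge0.
have nodeb j : (j < M)%N -> 0 <= node R M j <= 2 * pi.
  move=> jM; rewrite /node divr_ge0 ?mulr_ge0 ?(ltW pi0)//=.
  by rewrite ler_pdivrMr// ler_pM2l ?mulr_gt0// ler_nat ltnW.
have vb j : (j < M)%N -> 0 <= v j <= V.
  move=> jM; have /andP[r0 r1] := fold_angle_bound (nodeb j jM).
  have Vp : 0 < V / pi by rewrite divr_gt0.
  rewrite /v mulr_ge0// ?(ltW Vp)//= -[leRHS](divfK (lt0r_neq0 pi0)).
  by rewrite ler_pM2l.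
have approx i : i \in s -> P i ->
    \sum_(j < M) J i j * nc (W i - w (v j)) <= M%:R * S2 * (20 * L * V / n%:R + e).
  move=> si Pi; pose x := pi / V * u i.
  have /andP[u0 u1] := uV i si Pi.
  have xb : 0 <= x <= pi.
    rewrite mulr_ge0 ?divr_ge0 ?(ltW pi0) ?(ltW V0)//=.
    by rewrite /x mulrAC ler_pdivrMr// ler_pM2l.
  apply: le_trans (_ : \sum_(j < M) (L * (V / pi) * (9 * n%:R) *
      (J i j * (1 - cos (node R M j - x))) + (L * (V / pi) / (2 * n%:R) + e) * J i j) <= _).
    apply: ler_sum => j _.
    have h1 := hW i (v j) si Pi (vb j (ltn_ord j)).
    have h2 := fold_angle_dist xb (nodeb j (ltn_ord j)).
    set r := fold_angle _ in h2.
    have uv : `|u i - v j| = V / pi * `|x - r|.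
      have Vp : 0 <= V / pi by rewrite divr_ge0 ?(ltW pi0) ?(ltW V0).
      have -> : u i - v j = V / pi * (x - r).
        rewrite /x /v -/r mulrBr; congr (_ - _).
        by rewrite !mulrA divfK ?(gt_eqF pi0)// divff ?(gt_eqF V0)// mul1r.
      by rewrite normrM ger0_norm.
    (* The inequality |y| <= n y^2 / 2 + 1 / (2 n) trades the distance for its square, which the
       second moment of the kernel controls. *)
    have h3 : `|x - r| <= 9 * n%:R * (1 - cos (node R M j - x)) + (2 * n%:R)^-1.
      have : 0 <= (n%:R * `|x - r| - 1) ^+ 2 by exact: sqr_ge0.
      rewrite sqrrB1 exprMn real_normK ?num_real// => h3.
      have h4 : n%:R ^+ 2 * (x - r) ^+ 2 <= n%:R ^+ 2 * (18 * (1 - cos (node R M j - x))).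
        by rewrite ler_pM2l// exprn_gt0.
      have nn : 0 < 2 * n%:R :> R by rewrite mulr_gt0.
      rewrite -(ler_pM2l nn) mulrDr divff ?gt_eqF//.
      have := expr2 (n%:R : R); nra.
    have LV : 0 <= L * (V / pi) by rewrite mulr_ge0 ?divr_ge0 ?(ltW pi0) ?(ltW V0).
    have h4 : nc (W i - w (v j)) <= L * (V / pi) * (9 * n%:R * (1 - cos (node R M j - x)) + (2 * n%:R)^-1) + e.
      apply: le_trans h1 _; rewrite lerD2r uv mulrA; exact: ler_wpM2l.
    apply: le_trans (ler_wpM2l (J0 i j) h4) _.
    by rewrite le_eqVlt; apply/orP; left; apply/eqP; ring.
  rewrite big_split -!mulr_sumr /= JT.
  have h5 := jackson_moment n0 x; rewrite -/M in h5.
  have LV : 0 <= L * (V / pi) by rewrite mulr_ge0 ?divr_ge0 ?(ltW pi0) ?(ltW V0).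
  have c0 : 0 <= L * (V / pi) * (9 * n%:R) by apply: mulr_ge0 => //; rewrite mulr_ge0 ?ler0n.
  have h6 := ler_wpM2l c0 h5.
  have h7 : L * (V / pi) * (9 * n%:R) * (2 * M%:R * n%:R) <= L * (V / pi) * (M%:R * S2) * (36 / n%:R).
    have -> : L * (V / pi) * (9 * n%:R) * (2 * M%:R * n%:R) = L * (V / pi) * M%:R * (18 * n%:R ^+ 2) by ring.
    have -> : L * (V / pi) * (M%:R * S2) * (36 / n%:R) = L * (V / pi) * M%:R * (S2 * 36 / n%:R) by ring.
    apply: ler_wpM2l; first by rewrite mulr_ge0 ?(ltW MR).
    rewrite ler_pdivlMr// -mulrA -exprSr; lra.
  have h8 : L * (V / pi) <= L * V / 2.
    rewrite -mulrA; apply: ler_wpM2l => //; apply: ler_wpM2l; first exact: ltW.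
    by rewrite lef_pV2 ?posrE//; exact: pi_ge2.
  have T0 : 0 < M%:R * S2 by rewrite mulr_gt0.
  apply: le_trans (lerD h6 (lexx _)) _; apply: le_trans (lerD h7 (lexx _)) _.
  have -> : L * (V / pi) * (M%:R * S2) * (36 / n%:R) + (L * (V / pi) / (2 * n%:R) + e) * (M%:R * S2) =
    M%:R * S2 * (L * (V / pi) * (73 / 2 / n%:R) + e).
    by rewrite invfM; set a := L * (V / pi); set iN := n%:R^-1; field.
  rewrite ler_pM2l// lerD2r.
  apply: le_trans (ler_wpM2r _ h8) _; first by rewrite divr_ge0 ?ler0n// divr_ge0.
  have -> : L * V / 2 * (73 / 2 / n%:R) = L * V / n%:R * (73 / 4).
    by set iN := n%:R^-1; field.
  have -> : 20 * L * V / n%:R = L * V / n%:R * 20 by ring.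
  apply: ler_wpM2l; last lra.
  by rewrite divr_ge0 ?mulr_ge0// ltW.
pose X1 := \sum_(i <- s | P i) b i * \sum_(j < M) (J i j)%:C * (W i - w (v j)).
pose X2 := \sum_(i <- s | P i) b i * \sum_(j < M) (J i j)%:C * w (v j).
have split : (M%:R * S2)%:C * (\sum_(i <- s | P i) b i * W i) = X1 + X2.
  rewrite /X1 /X2 -big_split mulr_sumr; apply: eq_bigr => i _ /=.
  rewrite -mulrDr -big_split /= (eq_bigr (fun j : 'I_M => (J i j)%:C * W i)); last first.
    by move=> j _; rewrite mulrBr subrK.
  by rewrite -mulr_suml -rmorph_sum /= JT mulrCA.
have hX1 : nc X1 <= S * (M%:R * S2 * (20 * L * V / n%:R + e)).
  apply: le_trans (nc_sum _ _ _) _.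
  apply: le_trans (_ : \sum_(i <- s | P i) nc (b i) * (M%:R * S2 * (20 * L * V / n%:R + e)) <= _).
    rewrite big_seq_cond [leRHS]big_seq_cond; apply: ler_sum => i /andP[si Pi].
    rewrite ncM; apply: ler_wpM2l; first exact: nc_ge0.
    apply: le_trans (nc_sum _ _ _) _; apply: le_trans (approx i si Pi).
    by apply: ler_sum => j _; rewrite ncM nc_real ger0_norm.
  rewrite -mulr_suml; apply: ler_wpM2r => //.
  apply: mulr_ge0; first by rewrite mulr_ge0 ?(ltW S2p).
  by rewrite addr_ge0// divr_ge0 ?ler0n// !mulr_ge0 ?(ltW V0).
pose Wh (l k : nat) := \sum_(j < M) w (v j) * grid R M j l * (grid R M j k)^*%C.
pose A (l k : nat) := \sum_(i <- s | P i) b i * expi ((k%:R - l%:R) * (pi / V) * u i).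
(* The kernel is expanded as the squared modulus of a trigonometric polynomial with coefficients
   [tri]. The index i then occurs only in the exponential sums [A], and the samples of [w] only in
   their discrete Fourier transform [Wh]. *)
have X2E : X2 = \sum_(l < M) \sum_(k < M) ((tri n l)%:R * (tri n k)%:R) * A l k * Wh l k.
  pose T i (j l k : nat) : R[i] := b i * expi ((k%:R - l%:R) * (pi / V) * u i) *
    ((tri n l)%:R * (tri n k)%:R) * (w (v j) * grid R M j l * (grid R M j k)^*%C).
  transitivity (\sum_(i <- s | P i) \sum_(j < M) \sum_(l < M) \sum_(k < M) T i j l k).
    apply: eq_bigr => i _; rewrite mulr_sumr; apply: eq_bigr => j _.
    rewrite /J jacksonE// -/M -mul_conj rmorph_sum mulr_suml mulr_suml mulr_sumr.
    apply: eq_bigr => l _; rewrite mulr_sumr mulr_suml mulr_sumr; apply: eq_bigr => k _.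
    have cE (a y g : R[i]) m : a^*%C = a -> (a * y ^+ m * g)^*%C = a * (y^*%C) ^+ m * g^*%C.
      by move=> ha; rewrite -[in RHS]ha -rmorphXn -2!rmorphM.
    rewrite /T; set c := (X in b i * (_ * X * _)).
    have -> : c = (tri n k)%:R * (expi (- (pi / V * u i)))^*%C ^+ k * (grid R M j k)^*%C.
      by apply: cE; exact: rmorph_nat.
    rewrite (_ : expi ((k%:R - l%:R) * (pi / V) * u i) =
        expi (- (pi / V * u i)) ^+ l * (expi (- (pi / V * u i)))^*%C ^+ k); first by ring.
    by rewrite expi_conj -!expi_mulrn -expiD; congr expi; ring.
  under eq_bigr do rewrite exchange_big.
  rewrite exchange_big; apply: eq_bigr => l _ /=.
  under eq_bigr => i _ do rewrite exchange_big.
  rewrite exchange_big; apply: eq_bigr => k _ /=.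
  transitivity (A l k * (((tri n l)%:R * (tri n k)%:R) * Wh l k)); last by ring.
  rewrite /A mulr_suml; apply: eq_bigr => i _; rewrite /Wh 2!mulr_sumr.
  by apply: eq_bigr => j _; exact/esym/mulrA.
have B0 : 0 <= B by apply: le_trans (hB 0%N 0%N _ _); rewrite ?nc_ge0// muln_gt0 n0.
have hX2 : nc X2 <= M%:R * S2 * (2 * B * q%:R).
  (* The weight in the inequality 2 a c <= tau a^2 + c^2 / tau. It balances tau * S2 against M^2 /
     tau, since S2 is of order n^3 = q^6. *)
  pose tau : R := M%:R / q%:R ^+ 3.
  have tau0 : 0 < tau by rewrite divr_gt0// exprn_gt0.
  have row l : (l < M)%N -> \sum_(k < M) (tri n k)%:R * nc (Wh l k) <= (tau * S2 + M%:R ^+ 2 / tau) / 2.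
    move=> lM; apply: le_trans (_ : \sum_(k < M) (tau * (tri n k)%:R ^+ 2 + nc (Wh l k) ^+ 2 / tau) / 2 <= _).
      apply: ler_sum => k _; set a := (tri n k)%:R; set c := nc _.
      have : 0 <= (tau * a - c) ^+ 2 / tau by rewrite divr_ge0 ?sqr_ge0// ltW.
      rewrite (_ : (tau * a - c) ^+ 2 / tau = tau * a ^+ 2 - 2 * (a * c) + c ^+ 2 / tau); first by lra.
      by field; rewrite gt_eqF.
    rewrite -mulr_suml ler_pM2r ?invr_gt0// big_split /= -mulr_sumr -mulr_suml lerD2l.
    rewrite ler_pM2r ?invr_gt0//; apply: (@grid_fourier_sum R n n0 (fun j => w (v j))) => j jM.
    exact/w1/vb.
  rewrite X2E; apply: le_trans (nc_sum _ _ _) _.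
  apply: le_trans (_ : \sum_(l < M) (tri n l)%:R * (B * ((tau * S2 + M%:R ^+ 2 / tau) / 2)) <= _).
    apply: ler_sum => l _; apply: le_trans (nc_sum _ _ _) _.
    apply: le_trans (_ : \sum_(k < M) (tri n l)%:R * (B * ((tri n k)%:R * nc (Wh l k))) <= _).
      apply: ler_sum => k _; rewrite !ncM !nc_nat.
      have -> : (tri n l)%:R * (B * ((tri n k)%:R * nc (Wh l k))) =
         (tri n l)%:R * (tri n k)%:R * B * nc (Wh l k) by ring.
      apply: ler_wpM2r; first exact: nc_ge0.
      by apply: ler_wpM2l; [rewrite mulr_ge0|exact: hB].
    rewrite -!mulr_sumr; apply: ler_wpM2l; first exact: ler0n.
    by apply: ler_wpM2l => //; exact: row.
  rewrite -mulr_suml tri_sum.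
  have q3 : 0 < q%:R ^+ 3 :> R by exact: exprn_gt0.
  have -> : M%:R ^+ 2 / tau = M%:R * q%:R ^+ 3.
    by rewrite /tau; field; rewrite !gt_eqF//.
  have -> : tau * S2 = M%:R * (S2 / q%:R ^+ 3) by rewrite /tau; ring.
  have hq : q%:R ^+ 3 <= 2 * (S2 / q%:R ^+ 3).
    rewrite mulrA ler_pdivlMr//; move: S20; rewrite nq -exprM -exprD.
    by [].
  have -> : n%:R ^+ 2 * (B * ((M%:R * (S2 / q%:R ^+ 3) + M%:R * q%:R ^+ 3) / 2)) =
     n%:R ^+ 2 * B * M%:R * ((S2 / q%:R ^+ 3 + q%:R ^+ 3) / 2) by ring.
  have -> : M%:R * S2 * (2 * B * q%:R) = n%:R ^+ 2 * B * M%:R * (2 * (S2 / q%:R ^+ 3)).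
    by rewrite nq; field; rewrite gt_eqF.
  apply: ler_wpM2l; first by apply: mulr_ge0; [apply: mulr_ge0 => //; exact: exprn_ge0 (ler0n _ _)|exact: ler0n].
  have : 0 < S2 / q%:R ^+ 3 by rewrite divr_gt0.
  lra.
have T0 : 0 < M%:R * S2 by rewrite mulr_gt0.
rewrite -(ler_pM2l T0) mulrDr -nq.
have := nc_real (M%:R * S2 : R); rewrite ger0_norm ?(ltW T0)// => e1.
rewrite -[X in X * nc _]e1 -ncM split; apply: le_trans (ncD _ _) _.
rewrite addrC; apply: lerD => //; apply: le_trans hX1 _.
by rewrite mulrCA.
Qed.

End LipschitzSum.

(** * The recursion for means *)

Section Majorant.
Variable R : realType.

Lemma Re_exp_ge (u : R[i]) k : nc u = 1 -> 1 - k%:R ^+ 2 * (1 - Re u) <= Re (u ^+ k).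
Proof.
move=> u1; have e (z : R[i]) : nc z = 1 -> nc (z - 1) ^+ 2 = 2 * (1 - Re z).
  move=> z1; have := ncE z; rewrite z1 expr1n ncE; case: z z1 => a b _ /=; rewrite oppr0 addr0; nra.
have uk1 : nc (u ^+ k) = 1 by rewrite ncX u1 expr1n.
have u1' : nc u <= 1 by rewrite u1.
have h11 : nc (1 : R[i]) <= 1 by rewrite nc1.
have := nc_expB k u1' h11; rewrite expr1n => h.
have : nc (u ^+ k - 1) ^+ 2 <= (k%:R * nc (u - 1)) ^+ 2.
  by rewrite ler_pXn2r// nnegrE ?mulr_ge0 ?nc_ge0.
rewrite exprMn !e//; lra.
Qed.

Lemma nc_geo_step (u : R[i]) n : nc u = 1 ->
  nc (geo n.+1 u) ^+ 2 = nc (geo n u) ^+ 2 + 1 + 2 * \sum_(1 <= k < n.+1) Re (u ^+ k).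
Proof.
move=> u1; rewrite {1}/geo big_ord_recr /= -/(geo n u).
have uu (z : R[i]) : nc z = 1 -> z * z^*%C = 1 by move=> z1; rewrite mul_conj z1 expr1n.
have e : Re (u ^+ n * (geo n u)^*%C) = \sum_(1 <= k < n.+1) Re (u ^+ k).
  rewrite big_add1 /= big_nat_rev /= add0n big_mkord rmorph_sum mulr_sumr Re_sum.
  apply: eq_bigr => k _; congr (Re _).
  rewrite subnSK ?ltn_ord// -{1}(subnK (ltnW (ltn_ord k))) exprD rmorphXn -mulrA -exprMn uu// expr1n mulr1.
  by [].
rewrite -e; have : nc (u ^+ n) ^+ 2 = 1 by rewrite ncX u1 !expr1n.
rewrite !ncE; case: (geo n u) => a b; case: (u ^+ n) => c d /= h.
lra.
Qed.

Lemma nc_geo_sqr (u : R[i]) n : nc u = 1 ->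
  nc (geo n u) ^+ 2 = n%:R + 2 * \sum_(1 <= k < n) (n - k)%:R * Re (u ^+ k).
Proof.
move=> u1; elim: n => [|n IH].
  by rewrite /geo big_ord0 nc0 big_geq// mulr0 addr0 expr0n.
rewrite nc_geo_step// IH -natr1.
suff -> : \sum_(1 <= k < n.+1) (n.+1 - k)%:R * Re (u ^+ k) =
   \sum_(1 <= k < n) (n - k)%:R * Re (u ^+ k) + \sum_(1 <= k < n.+1) Re (u ^+ k) by ring.
rewrite (eq_big_nat _ _ (F2 := fun k => (n - k)%:R * Re (u ^+ k) + Re (u ^+ k))); last first.
  by move=> k /andP[_ kn]; rewrite subSn// -natr1 mulrDl mul1r.
rewrite big_split /=; congr (_ + _); have [->|n0] := posnP n; first by rewrite !big_geq.
by rewrite big_nat_recr//= subnn mul0r addr0.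
Qed.

(** Each harmonic satisfies Re (u^k) >= 1 - k^2 (1 - Re u), from |u^k - 1| <= k |u - 1|; these
    bounds are summed through the step formula for the kernel. *)
Lemma nc_geo_ge (u : R[i]) n : nc u = 1 -> n%:R ^+ 2 - (1 - Re u) * n%:R ^+ 4 / 6 <= nc (geo n u) ^+ 2.
Proof.
move=> u1; have d0 : 0 <= 1 - Re u.
  by have := Re_le_nc u; rewrite u1 ler_norml; lra.
elim: n => [|n IH]; first by rewrite /geo big_ord0 nc0 !expr0n mulr0 mul0r subr0.
rewrite nc_geo_step//; set d := 1 - Re u in d0 IH *.
have sq m : 6 * \sum_(1 <= k < m.+1) k%:R ^+ 2 = m%:R * (m%:R + 1) * (2 * m%:R + 1) :> R.
  elim: m => [|m IHm]; first by rewrite big_geq// mulr0 !mul0r.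
  by rewrite big_nat_recr//= mulrDr IHm -natr1; ring.
have : n%:R - d * \sum_(1 <= k < n.+1) k%:R ^+ 2 <= \sum_(1 <= k < n.+1) Re (u ^+ k).
  have -> : n%:R = \sum_(1 <= k < n.+1) 1 :> R.
    by rewrite big_const_nat subn1 iter_addr_0.
  rewrite mulr_sumr -sumrB; apply: ler_sum => k _.
  by rewrite mulrC; exact: Re_exp_ge.
have := sq n; have n0 : 0 <= n%:R :> R by [].
rewrite -(natr1 n); set s := \sum_(_ <= _ < _) _; set t := \sum_(_ <= _ < _) _.
move: s t => s t es h.
have e : d * (6 * s) = d * (n%:R * (n%:R + 1) * (2 * n%:R + 1)) by rewrite es.
have dn : 0 <= d * n%:R by rewrite mulr_ge0.
have -> : d * (n%:R + 1) ^+ 4 / 6 = d * n%:R ^+ 4 / 6 + 2 * (d * (n%:R * (n%:R + 1) * (2 * n%:R + 1))) / 6 + (2 * (d * n%:R) + d) / 6 by field.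
rewrite -e (_ : (n%:R + 1) ^+ 2 = n%:R ^+ 2 + 2 * n%:R + 1); last by ring.
lra.
Qed.

(* The Fejer kernel [nc (geo n u) ^+ 2] is at least [2 / 3 * n ^ 2] when [Re u] is within
   [2 / n ^ 2] of 1. *)
Lemma majorant (Z : seq R[i]) n (v z0 : R[i]) : (0 < n)%N -> (forall z, z \in Z -> nc z = 1) ->
  nc v = 1 -> z0 \in Z ->
  Re (z0 * v) <= 1 - 2 / n%:R ^+ 2 + 3 / n%:R ^+ 4 * \sum_(z <- Z) nc (geo n (z * v)) ^+ 2.
Proof.
move=> n0 Z1 v1 zZ; set S := \sum_(z <- Z) _.
have nR : 0 < n%:R :> R by rewrite ltr0n.
have n2 : 0 < n%:R ^+ 2 :> R by exact: exprn_gt0.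
have n4 : 0 < n%:R ^+ 4 :> R by exact: exprn_gt0.
have u1 : nc (z0 * v) = 1 by rewrite ncM v1 Z1// mulr1.
have S0 : nc (geo n (z0 * v)) ^+ 2 <= S.
  rewrite /S (big_rem z0)//= lerDl; apply: sumr_ge0 => z _; exact: sqr_ge0.
have c0 : 0 <= 3 / n%:R ^+ 4 :> R by rewrite divr_ge0// ltW.
have Sp : 0 <= S by apply: le_trans S0; exact: sqr_ge0.
have [h|h] := leP (Re (z0 * v)) (1 - 2 / n%:R ^+ 2).
  by apply: le_trans h _; rewrite lerDl mulr_ge0.
apply: le_trans (_ : 1 <= _); first by have := Re_le_nc (z0 * v); rewrite u1 ler_norml; lra.
have := nc_geo_ge n u1 => h2.
have h3 : 2 / 3 * n%:R ^+ 2 <= S.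
  apply: le_trans S0; apply: le_trans h2.
  have : (1 - Re (z0 * v)) * n%:R ^+ 4 <= 2 / n%:R ^+ 2 * n%:R ^+ 4 by rewrite ler_pM2r//; lra.
  have -> : 2 / n%:R ^+ 2 * n%:R ^+ 4 = 2 * n%:R ^+ 2 :> R by field; rewrite gt_eqF.
  lra.
have := ler_wpM2l c0 h3.
have -> : 3 / n%:R ^+ 4 * (2 / 3 * n%:R ^+ 2) = 2 / n%:R ^+ 2 :> R by field; rewrite gt_eqF.
lra.
Qed.

Lemma majorant_fourier (Z : seq R[i]) n (v : R[i]) : (forall z, z \in Z -> nc z = 1) -> nc v = 1 ->
  \sum_(z <- Z) nc (geo n (z * v)) ^+ 2 =
  n%:R * (size Z)%:R + 2 * \sum_(1 <= k < n) (n - k)%:R * Re ((\sum_(z <- Z) z ^+ k) * v ^+ k).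
Proof.
move=> Z1 v1.
have -> : \sum_(z <- Z) nc (geo n (z * v)) ^+ 2 =
   \sum_(z <- Z) (n%:R + 2 * \sum_(1 <= k < n) (n - k)%:R * Re ((z * v) ^+ k)).
  rewrite big_seq [RHS]big_seq; apply: eq_bigr => z zZ; rewrite nc_geo_sqr//.
  by rewrite ncM v1 Z1// mulr1.
rewrite big_split /= -mulr_sumr; congr (_ + 2 * _).
  by rewrite big_const_seq count_predT iter_addr_0 mulr_natr.
rewrite exchange_big; apply: eq_bigr => k _ /=; rewrite -mulr_sumr mulr_suml Re_sum.
by congr (_ * _); apply: eq_bigr => z _; rewrite exprMn.
Qed.

(* Unlike [s ^+ k], this is homogeneous of degree 1, hence Lipschitz. *)
Definition argpow (k : nat) (s : R[i]) : R[i] := (nc s)%:C * (s / (nc s)%:C) ^+ k.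

Lemma nc_argpow k s : nc (argpow k s) = nc s.
Proof.
rewrite /argpow ncM nc_real ger0_norm ?nc_ge0//; have [->|s0] := eqVneq s 0.
  by rewrite nc0 mul0r.
by rewrite ncX ncM ncV nc_real ger0_norm ?nc_ge0// divff ?nc_eq0// expr1n mulr1.
Qed.

(** The moduli contribute 1. The phases contribute 2 k, because the difference of the phases,
    multiplied by |t|, is at most 2 |s - t|. *)
Lemma argpow_lip k s t : nc (argpow k s - argpow k t) <= (2 * k + 1)%:R * nc (s - t).
Proof.
have c1 : 1 <= (2 * k + 1)%:R :> R by rewrite ler1n addn1.
have [->|s0] := eqVneq s 0.
  rewrite /argpow nc0 mul0r !sub0r !ncN -/(argpow k t) nc_argpow ler_peMl ?nc_ge0//.
have [->|t0] := eqVneq t 0.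
  by rewrite {2}/argpow nc0 mul0r !subr0 nc_argpow ler_peMl ?nc_ge0.
have unit (z : R[i]) : z != 0 -> nc (z / (nc z)%:C) = 1.
  by move=> z0; rewrite ncM ncV nc_real ger0_norm ?nc_ge0// divff ?nc_eq0.
have cne (z : R[i]) : z != 0 -> (nc z)%:C != 0 :> R[i].
  by move=> z0; rewrite -(rmorph0 (real_complex R)) (inj_eq (@complexI R)) nc_eq0.
have eq_le1 (z : R[i]) : nc z = 1 -> nc z <= 1 by move=> ->.
rewrite /argpow; set a := s / _; set b := t / _.
have a1 : nc a = 1 by exact: unit. have b1 : nc b = 1 by exact: unit.
have -> : (nc s)%:C * a ^+ k - (nc t)%:C * b ^+ k =
  ((nc s)%:C - (nc t)%:C) * a ^+ k + (nc t)%:C * (a ^+ k - b ^+ k) by ring.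
apply: le_trans (ncD _ _) _; rewrite !ncM ncX a1 expr1n mulr1 -rmorphB !nc_real.
have h1 := nc_dist s t; rewrite (ger0_norm (nc_ge0 t)).
have h2 : nc t * nc (a - b) <= 2 * nc (s - t).
  have e : (nc t)%:C * (a - b) = (s - t) + ((nc t)%:C - (nc s)%:C) * a.
    have sE : s = (nc s)%:C * a by rewrite /a mulrC divfK// cne.
    have tE : t = (nc t)%:C * b by rewrite /b mulrC divfK// cne.
    transitivity (((nc s)%:C * a - (nc t)%:C * b) + ((nc t)%:C - (nc s)%:C) * a); first by ring.
    by rewrite -sE -tE.
  rewrite -[X in X * nc (a - b)](ger0_norm (nc_ge0 t)) -nc_real -ncM e.
  apply: le_trans (ncD _ _) _; rewrite ncM a1 mulr1 -rmorphB nc_real distrC; lra.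
have h3 := ler_wpM2l (nc_ge0 t) (nc_expB k (eq_le1 _ a1) (eq_le1 _ b1)).
have h4 := ler_wpM2l (ler0n R k) h2.
rewrite natrD natrM mulrDl mul1r; rewrite mulrCA in h3; lra.
Qed.

End Majorant.

(** * Slow variation of means *)

Section Means.
Variable R : realType.
Local Notation lgn := (lgn R).
Local Notation gcount := (gcount R).

(* The factor 30 makes the means bounded by 1. *)
Definition mean (f : gaussInt -> R[i]) (K : nat) : R[i] :=
  ((30 * K%:R)^-1)%:C * \sum_(n <- gnball K) f n.

Lemma mean_le1 f K : (forall n, n != 0 -> nc (f n) = 1) -> nc (mean f K) <= 1.
Proof.
move=> f1; have [->|K0] := posnP K.
  by rewrite /mean mulr0 invr0 mul0r nc0.
have KR : 0 < 30 * K%:R :> R by rewrite mulr_gt0// ltr0n.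
rewrite ncM nc_real ger0_norm ?invr_ge0 ?(ltW KR)// mulrC ler_pdivrMr// mul1r.
apply: le_trans (nc_sum_gnball_le _ _) (gcount_le _ _) => n n0; by rewrite f1.
Qed.

(** Changing the normalization costs a multiple of 1 - K1 / K2. The new points number c (K2 - K1) up
    to the error of the lattice count, which yields the term K1^(-1/4). Finally 1 - K1 / K2 <= ln
    (K2 / K1). *)
Lemma mean_lip : exists2 C : R, 0 < C & forall f K1 K2,
  (forall n, n != 0 -> nc (f n) = 1) -> (0 < K1)%N -> (K1 <= K2)%N ->
  nc (mean f K1 - mean f K2) <= C * (ln K2%:R - ln K1%:R) + C * K1%:R `^ (- (1 / 4)).
Proof.
have [c [C [c0 C0 hc]]] := gcount_asymptotic R.
exists (c + 1 + C) => [|f K1 K2 f1 K10 K12]; first by rewrite !addr_gt0.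
have K20 : (0 < K2)%N by exact: leq_trans K12.
have r1 : 0 < K1%:R :> R by rewrite ltr0n.
have r2 : 0 < K2%:R :> R by rewrite ltr0n.
have r12 : K1%:R <= K2%:R :> R by rewrite ler_nat.
pose S K := \sum_(n <- gnball K) f n.
have dS : nc (S K2 - S K1) <= gcount K2 - gcount K1.
  rewrite /S (gnball_split _ _ K12) addrC addKr; apply: le_trans (nc_sum _ _ _) _.
  rewrite /gcount -!sum1_size !natr_sum (gnball_split _ (fun=> 1) K12) addrC addKr.
  rewrite big_seq_cond [leRHS]big_seq_cond; apply: ler_sum => n /andP[].
  by rewrite mem_gnball gn_gt0 => /andP[n0 _] _; rewrite f1.
have hS1 : nc (S K1) <= 30 * K1%:R.
  by apply: le_trans (nc_sum_gnball_le _ _) (gcount_le _ _) => n n0; rewrite f1.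
have p34 K : (0 < K)%N -> K%:R `^ (3 / 4) = K%:R * K%:R `^ (- (1 / 4)) :> R.
  move=> K0; have KR : 0 < K%:R :> R by rewrite ltr0n.
  rewrite -[X in _ = X * _](powRr1 (ltW KR)) -powRD; first by congr (_ `^ _); lra.
  by rewrite (gt_eqF KR) implybT.
have q12 : K2%:R `^ (- (1 / 4)) <= K1%:R `^ (- (1 / 4)) :> R.
  by apply: ler_powRN_nat => //; lra.
have q1 : 0 <= K1%:R `^ (- (1 / 4)) :> R by exact: powR_ge0.
have q2 : 0 <= K2%:R `^ (- (1 / 4)) :> R by exact: powR_ge0.
have h1 := hc K1; have h2 := hc K2.
rewrite ler_norml p34// in h1; rewrite ler_norml p34// in h2.
have -> : mean f K1 - mean f K2 = ((30 * K1%:R)^-1 - (30 * K2%:R)^-1)%:C * S K1 -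
    ((30 * K2%:R)^-1)%:C * (S K2 - S K1).
  by rewrite /mean -/(S K1) -/(S K2) rmorphB; ring.
apply: le_trans (ncB _ _) _; rewrite !ncM !nc_real.
have i2 : 0 < 30 * K2%:R :> R by rewrite mulr_gt0.
have i1 : 0 < 30 * K1%:R :> R by rewrite mulr_gt0.
have i12 : (30 * K2%:R)^-1 <= (30 * K1%:R)^-1 :> R by rewrite lef_pV2 ?posrE// ler_pM2l.
rewrite (ger0_norm (_ : 0 <= (30 * K2%:R)^-1)) ?invr_ge0 ?(ltW i2)// ger0_norm ?subr_ge0//.
have dln : 1 - K1%:R / K2%:R <= ln K2%:R - ln K1%:R :> R.
  rewrite -ln_div ?posrE//; apply: le_trans (ln_ge_1subV _); last by rewrite divr_gt0.
  by rewrite invf_div.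
have t1 : ((30 * K1%:R)^-1 - (30 * K2%:R)^-1) * nc (S K1) <= 1 - K1%:R / K2%:R.
  apply: le_trans (ler_wpM2l _ hS1) _; first by rewrite subr_ge0.
  rewrite mulrBl mulVf ?gt_eqF// lerD2l lerN2 invfM -mulrA mulrCA mulrA.
  rewrite (mulrC K2%:R^-1) -!mulrA le_eqVlt; apply/orP; left; apply/eqP.
  by field; rewrite gt_eqF.
have K12' : 0 <= 1 - K1%:R / K2%:R :> R by rewrite subr_ge0 ler_pdivrMr// mul1r.
have t2 : (30 * K2%:R)^-1 * nc (S K2 - S K1) <= c * (1 - K1%:R / K2%:R) + C * K1%:R `^ (- (1 / 4)).
  rewrite mulrC ler_pdivrMr//; apply: le_trans dS _.
  have e : K1%:R / K2%:R * (30 * K2%:R) = 30 * K1%:R :> R by rewrite mulrCA divfK// gt_eqF.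
  rewrite mulrDl -(mulrA c) mulrBl (mul1r (30 * _)) e.
  move: h1 h2 => /andP[h1 _] /andP[_ h2].
  have x1 : K1%:R * K1%:R `^ (- (1 / 4)) <= K2%:R * K1%:R `^ (- (1 / 4)) :> R by exact: ler_wpM2r.
  have x2 : K2%:R * K2%:R `^ (- (1 / 4)) <= K2%:R * K1%:R `^ (- (1 / 4)) :> R by rewrite ler_pM2l.
  have x3 := ler_wpM2l (ltW C0) x1; have x4 := ler_wpM2l (ltW C0) x2.
  have x5 : 0 <= C * (K2%:R * K1%:R `^ (- (1 / 4))) by rewrite !mulr_ge0// ltW.
  have x6 : c * (K2%:R - K1%:R) <= c * (30 * K2%:R - 30 * K1%:R).
    by rewrite ler_pM2l//; move: r12; clear; lra.
  move: h1 h2 x3 x4 x5 x6; clear; lra.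
have y0 : 0 <= C * (1 - K1%:R / K2%:R) by rewrite mulr_ge0// ltW.
have y1 : (c + 1 + C) * (1 - K1%:R / K2%:R) <= (c + 1 + C) * (ln K2%:R - ln K1%:R).
  by rewrite ler_pM2l// !addr_gt0.
have y2 : 0 <= c * K1%:R `^ (- (1 / 4)) by rewrite mulr_ge0// ltW.
move: t1 t2 y0 y1 y2 q1; clear; lra.
Qed.

Lemma truncn_divr K d : (0 < d)%N -> Num.truncn (K%:R / d%:R : R) = (K %/ d)%N.
Proof.
move=> d0; have dR : 0 < d%:R :> R by rewrite ltr0n.
apply: truncn_def; rewrite ler_pdivlMr// ltr_pdivrMr// -!natrM ler_nat ltr_nat.
by rewrite leq_trunc_div ltn_ceil.
Qed.

Lemma truncn_expR_lgn K n : n != 0 -> Num.truncn (K%:R * expR (- lgn n)) = (K %/ gn n)%N.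
Proof.
move=> n0; have gR : 0 < (gn n)%:R :> R by rewrite ltr0n gn_gt0.
by rewrite expRN lnK ?posrE// truncn_divr// gn_gt0.
Qed.

Lemma ln_truncn (x : R) Z : (0 < Z)%N -> Z%:R <= x ->
  [/\ (Z <= Num.truncn x)%N, ln (Num.truncn x)%:R <= ln x & ln x <= ln (Num.truncn x)%:R + Z%:R^-1].
Proof.
move=> Z0 Zx; have ZR : 0 < Z%:R :> R by rewrite ltr0n.
have x0 : 0 < x by exact: lt_le_trans Zx.
have tle : (Num.truncn x)%:R <= x by rewrite truncn_le// ltW.
have Zt : (Z <= Num.truncn x)%N by rewrite truncn_ge_nat// ltW.
have t0 : 0 < (Num.truncn x)%:R :> R by rewrite ltr0n; exact: leq_trans Zt.
split => //; first by rewrite ler_ln ?posrE.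
rewrite -lerBlDl -ln_div ?posrE//; apply: le_trans (ln_le_sub1 _) _; first by rewrite divr_gt0.
rewrite lerBlDr ler_pdivrMr// mulrDl mul1r; apply: ltW; apply: lt_le_trans (truncnS_gt x) _.
have : 1 <= Z%:R^-1 * (Num.truncn x)%:R :> R by rewrite (mulrC _^-1) ler_pdivlMr// (mul1r Z%:R) ler_nat.
by rewrite -natr1; clear; lra.
Qed.

(** In the variable v, the mean at K / N(p) is the value at v = ln N(p) of a single function of v,
    Lipschitz up to an error. The bound by [Z] from below keeps both the rounding and the error of
    the count O(Z^(-1/4)). *)
Lemma mean_expR_lip : exists2 C : R, 0 < C & forall f K Z v1 v2,
  (forall n, n != 0 -> nc (f n) = 1) -> (0 < Z)%N ->
  Z%:R <= K%:R * expR (- v1) -> Z%:R <= K%:R * expR (- v2) ->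
  nc (mean f (Num.truncn (K%:R * expR (- v1))) - mean f (Num.truncn (K%:R * expR (- v2)))) <=
  C * `|v1 - v2| + C * Z%:R `^ (- (1 / 4)).
Proof.
have [C C0 h] := mean_lip; exists (2 * C) => [|f K Z v1 v2 f1 Z0 h1 h2]; first by rewrite mulr_gt0.
wlog : v1 v2 h1 h2 / (Num.truncn (K%:R * expR (- v1)) <= Num.truncn (K%:R * expR (- v2)))%N.
  move=> H; have [le|/ltnW le] := leqP (Num.truncn (K%:R * expR (- v1))) (Num.truncn (K%:R * expR (- v2))).
    exact: H.
  by rewrite nc_subC distrC; exact: H.
move=> le; have ZR : 0 < Z%:R :> R by rewrite ltr0n.
have K0 : 0 < K%:R :> R.
  rewrite lt_neqAle ler0n andbT eq_sym; apply: contraTneq h1 => ->.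
  by rewrite mul0r -ltNge.
have [z1 a1 b1] := ln_truncn Z0 h1; have [z2 a2 b2] := ln_truncn Z0 h2.
have lx (v : R) : ln (K%:R * expR (- v)) = ln K%:R - v.
  by rewrite lnM ?posrE ?expR_gt0 ?expRK.
rewrite !lx in a1 b1 a2 b2.
apply: le_trans (h f _ _ f1 (leq_trans Z0 z1) le) _.
set T1 := Num.truncn _ in le z1 a1 b1 *; set T2 := Num.truncn _ in le z2 a2 b2 *.
have p1 : T1%:R `^ (- (1 / 4)) <= Z%:R `^ (- (1 / 4)) :> R by apply: ler_powRN_nat => //; lra.
have p2 : Z%:R^-1 <= Z%:R `^ (- (1 / 4)) :> R.
  rewrite -powR_inv1 ?ler0n//; apply: ler_powR; [by rewrite ler1n|lra].
have v12 : v1 - v2 <= `|v1 - v2| := ler_norm _.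
have n0 := normr_ge0 (v1 - v2).
have l12 : ln T2%:R - ln T1%:R <= `|v1 - v2| + Z%:R^-1 by move: a1 b1 a2 b2 v12; clear; lra.
have := ler_wpM2l (ltW C0) l12; have := ler_wpM2l (ltW C0) p1; have := ler_wpM2l (ltW C0) p2.
have := mulr_ge0 (ltW C0) n0; clear; lra.
Qed.

End Means.

(** * Cancellation in prime sums against slowly varying means *)

Section CharacterTest.
Variable R : realType.
Local Notation lgn := (lgn R).
Local Notation lam := (lam R).

Lemma ln_pow_le_id (c C : R) n : 0 <= c -> exists2 X0, 1 <= X0 &
  forall X, X0 <= X -> C * (c * ln X) ^+ n <= X.
Proof.
move=> c0; have [X1 h] := ln_exp_le (C * c ^+ n) n.
exists (Num.max X1 1) => [|X]; first by rewrite le_max lexx orbT.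
by rewrite ge_max => /andP[h1 _]; rewrite exprMn mulrA; exact: h.
Qed.

Lemma truncnS_bounds (x : R) : 1 <= x -> x <= (Num.truncn x).+1%:R <= 2 * x.
Proof.
move=> x1; have x0 : 0 <= x by lra.
have := truncnS_gt x; have : (Num.truncn x)%:R <= x by rewrite truncn_le.
rewrite -natr1 => a b; apply/andP; split; lra.
Qed.

(** [lipschitz_test] in the variable ln N(p) on [0, V]: the kernel frequencies become twists by
    N(p)^(i t), with |t| at most 2 q^2 pi / V. The choice Z = q^8 makes the error Z^(-1/4) equal to
    q^(-2). *)
Lemma char_argpow_core (C1 : R) f K K1 Z m k q V B S :
  (forall v1 v2, Z%:R <= K%:R * expR (- v1) -> Z%:R <= K%:R * expR (- v2) ->
    nc (mean f (Num.truncn (K%:R * expR (- v1))) - mean f (Num.truncn (K%:R * expR (- v2)))) <=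
    C1 * `|v1 - v2| + C1 * Z%:R `^ (- (1 / 4))) ->
  0 < C1 -> (forall n, n != 0 -> nc (f n) = 1) -> (0 < Z)%N -> K1 = (K %/ Z)%N -> V = ln K1%:R -> 0 < V ->
  (0 < q)%N -> Z = (q ^ 8)%N ->
  (forall t, `|t| <= 2 * q%:R ^+ 2 * (pi / V) ->
     nc (\sum_(p <- gnball K1 | cprime p) (lam p)%:C * twist m t p) <= B) ->
  \sum_(p <- gnball K1 | cprime p) lam p <= S ->
  nc (\sum_(p <- gnball K1 | cprime p) (lam p)%:C * dir R p ^+ m * argpow k (mean f (K %/ gn p))) <=
  2 * B * q%:R + S * (20 * ((2 * k + 1)%:R * C1) * V / q%:R ^+ 2 + (2 * k + 1)%:R * C1 / q%:R ^+ 2).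
Proof.
move=> hlip C10 f1 Z0 K1E VE V0 q0 ZE hB hS.
have qR : 0 < q%:R :> R by rewrite ltr0n.
have k0 : 0 <= (2 * k + 1)%:R :> R by [].
have Zq : Z%:R `^ (- (1 / 4)) = (q%:R ^+ 2)^-1 :> R.
  rewrite powRN ZE natrX -[X in (X `^ _)^-1](powR_mulrn 8 (ltW qR)) -powRrM.
  by rewrite -(powR_mulrn 2 (ltW qR)); congr (_ `^ _)^-1; lra.
have K10 : 0 < K1%:R :> R.
  by rewrite ltNge; apply/negP => /ln0 e; move: V0; rewrite VE e ltxx.
have ZK v : v <= V -> Z%:R <= K%:R * expR (- v) :> R.
  move=> vV; apply: le_trans (_ : K%:R * expR (- V) <= _); last first.
    by apply: ler_wpM2l => //; rewrite ler_expR lerN2.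
  rewrite VE expRN lnK ?posrE// ler_pdivlMr// -natrM ler_nat K1E mulnC; exact: leq_trunc_div.
have ub p : p \in gnball K1 -> 0 <= lgn p <= V.
  rewrite mem_gnball => /andP[p0 pK]; rewrite lgn_ge0/= VE; exact: ler_ln_nat.
apply: (@lipschitz_test R _ (gnball K1) (@cprime) (fun p => (lam p)%:C * dir R p ^+ m) lgn
  (fun p => argpow k (mean f (K %/ gn p)))
  (fun v => argpow k (mean f (Num.truncn (K%:R * expR (- v)))))) => //.
- by rewrite mulr_ge0// ltW.
- by rewrite divr_ge0 ?exprn_ge0 ?mulr_ge0 ?(ltW C10) ?(ltW qR).
- by move=> p pK _; exact: ub.
- by move=> v _; rewrite nc_argpow; exact: mean_le1.
- move=> p v pK cp /andP[v0 vV]; have /andP[_ u1] := ub p pK.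
  apply: le_trans (argpow_lip _ _ _) _.
  rewrite -(mulrA _ C1) -(mulrA _ C1) -mulrDr; apply: ler_wpM2l => //.
  have := hlip (lgn p) v (ZK _ u1) (ZK _ vV); rewrite truncn_expR_lgn ?Zq//.
  exact/gprime_neq0/cprime_gprime.
- move=> l j lq jq.
  rewrite (eq_bigr (fun p => (lam p)%:C * twist m ((l%:R - j%:R) * (pi / V)) p)); last first.
    by move=> p _; rewrite /twist mulrA.
  apply: hB; rewrite normrM; have pV : 0 < pi / V by rewrite divr_gt0 ?pi_gt0.
  rewrite (ger0_norm (ltW pV)) ler_pM2r//.
  have := ler0n R l; have := ler0n R j.
  have : l%:R <= 2 * q%:R ^+ 2 :> R by rewrite -natrX -natrM ler_nat ltnW.
  have : j%:R <= 2 * q%:R ^+ 2 :> R by rewrite -natrX -natrM ler_nat ltnW.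
  rewrite ler_norml => *; apply/andP; split; lra.
apply: le_trans hS; rewrite big_seq_cond [leRHS]big_seq_cond; apply: ler_sum => p _.
by rewrite ncM nc_real ger0_norm ?lam_ge0// ler_piMr ?lam_ge0// nc_dirX_le1.
Qed.

(* In the proof the Lipschitz test uses [q ~ X ^ 3], the conductor is at most [X ^ 120],
   and the primes with [gn p > K / q ^ 8] are estimated trivially. *)
Lemma char_argpow (n0 : nat) : exists C X0 : R, [/\ 0 < C, 1 <= X0 &
  forall f K m k X, (forall n, n != 0 -> nc (f n) = 1) ->
  (0 < m)%N -> (4 %| m)%N -> m%:R <= n0%:R * X ^+ 100 -> (k <= n0)%N -> X0 <= X -> ln K%:R = X ^+ 5 ->
  nc (\sum_(p <- gnball K | cprime p) (lam p)%:C * dir R p ^+ m * argpow k (mean f (K %/ gn p))) <=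
  C * X ^+ 4].
Proof.
have [Cm Cm0 hm] := mertens R.
have [C1 C10 hlip] := mean_expR_lip R.
have [C2 [Q0 [C20 Q00 htw]]] := sum_twist R.
have [X1 X11 hX1] := @ln_pow_le_id 120 C2 9 (ler0n _ _).
pose L : R := (2 * n0 + 1)%:R * C1.
have L0 : 0 < L by rewrite mulr_gt0// ltr0n addn1.
(* Once X exceeds this, one factor X absorbs the constant 40 Q0 (n0 + 1) of the conductor; 200 is
   also large enough for ln Z, of order X^3, to be negligible against X^5. *)
pose P0 := 200 * (n0%:R + 1) * (Q0 + 1).
have P01 : 200 <= P0.
  have n00 : 0 <= n0%:R :> R by []. rewrite /P0; nra.
exists (4 + (1 + Cm) * (21 * L) + 10 + 2 * Cm), (X1 + P0); split; [|lra|].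
  have := mulr_gt0 (addr_gt0 ltr01 Cm0) L0; move: Cm0; clear; lra.
move=> f K m k X f1 m0 m4 mX kn XX0 KX.
have XX1 : X1 <= X by move: XX0 P01; clear; lra.
have XP : P0 <= X by move: XX0 X11; clear; lra.
have X200 : 200 <= X by exact: le_trans XP.
have X1' : 1 <= X by move: X200; clear; lra.
have X0' : 0 < X by move: X200; clear; lra.
pose q := (Num.truncn (X ^+ 3)).+1.
have /andP[q1 q2] : X ^+ 3 <= q%:R <= 2 * X ^+ 3 by apply: truncnS_bounds; exact: exprn_ege1.
have qR : 0 < q%:R :> R by [].
pose Z := (q ^ 8)%N; have Z0 : (0 < Z)%N by rewrite expn_gt0.
pose K1 := (K %/ Z)%N.
have K0 : (0 < K)%N.
  rewrite lt0n; apply: contraTneq isT => e; move: KX; rewrite e ln0// => /eqP.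
  by rewrite eq_sym expf_eq0 (gt_eqF X0').
have KR : 0 < K%:R :> R by rewrite ltr0n.
have ZR : 0 < Z%:R :> R by rewrite ltr0n.
have X3 : 1 <= X ^+ 3 by exact: exprn_ege1.
have X4 : X ^+ 3 <= X ^+ 4 by apply: ler_weXn2l.
have X53 : 200 * X ^+ 3 <= X ^+ 5.
  rewrite (exprD X 2 3) ler_pM2r ?exprn_gt0// expr2; nra.
have lnZ : ln Z%:R <= 16 * X ^+ 3 :> R.
  rewrite natrX lnXn// -[leLHS]mulr_natr.
  have := ln_le_sub1 qR; move: q2; clear; lra.
have lK1 : ln K%:R <= ln K1%:R + (1 + ln Z%:R) :> R /\ 1 <= ln K1%:R :> R.
  have b4 : (4 * Z <= K)%N.
    rewrite -(ler_nat R) -ler_ln ?posrE ?ltr0n ?muln_gt0// natrM lnM ?posrE//.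
    rewrite KX; have := @ln_le_sub1 R 4 (ltr0n _ 4); move: lnZ X53 X3; clear; lra.
  have K14 : (4 <= K1)%N by rewrite leq_divRL.
  have K10 : 0 < K1%:R :> R by rewrite ltr0n; exact: leq_trans K14.
  have h : ln K%:R <= ln K1%:R + (1 + ln Z%:R) :> R.
    have h2 : K%:R <= K1%:R * (2 * Z%:R) :> R.
      rewrite -!natrM ler_nat; have := ltn_ceil K Z0; rewrite -/K1.
      move=> /ltnW/leq_trans; apply; rewrite mulnA leq_mul2r; apply/orP; right.
      rewrite mulnC mul2n -addnn -[X in (X <= _)%N]addn1 leq_add2l; exact: leq_trans K14.
    apply: le_trans (_ : ln (K1%:R * (2 * Z%:R)) <= _).
      by rewrite ler_ln ?posrE ?mulr_gt0.
    rewrite lnM ?posrE ?mulr_gt0// lnM ?posrE//; have := ln2_le1 R; clear; lra.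
  split; [exact: h|rewrite KX in h; move: h lnZ X53 X3; clear; lra].
case: lK1 => lK1 V1; pose V := ln K1%:R : R.
have K10 : (0 < K1)%N.
  by rewrite lt0n; apply: contraTneq V1 => ->; rewrite ln0// -ltNge.
have VX : V <= X ^+ 5.
  by rewrite -KX; apply: ler_ln_nat => //; exact: leq_div.
have K1K : (K1 <= K)%N by exact: leq_div.
(* Large enough for the conductor, a constant times X^100 * X^6, and for ln K1 <= X^5; still ln Q =
   120 ln X, so the twisted prime sums are below X. *)
pose Q := X ^+ 120.
have hB t : `|t| <= 2 * q%:R ^+ 2 * (pi / V) ->
    nc (\sum_(p <- gnball K1 | cprime p) (lam p)%:C * twist m t p) <= X.
  move=> ht; have lnQ : ln Q = 120 * ln X by rewrite lnXn// mulr_natl.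
  apply: le_trans (hX1 X XX1); rewrite -lnQ; apply: htw => //.
  - apply: le_trans (_ : X ^+ 1 <= _); last by apply: ler_weXn2l.
    rewrite expr1; apply: le_trans XP; have n00 : 0 <= n0%:R :> R by [].
    rewrite /P0; nra.
  - have tX : 1 + `|t| <= 40 * X ^+ 6.
      have X6 : 1 <= X ^+ 6 by exact: exprn_ege1.
      have pV : pi / V <= 4.
        rewrite ler_pdivrMr; last by rewrite (lt_le_trans ltr01).
        have := pi_le4 R; move: V1; rewrite -/V; clear; lra.
      have q6 : q%:R ^+ 2 <= 4 * X ^+ 6.
        rewrite (_ : 4 * X ^+ 6 = (2 * X ^+ 3) ^+ 2); last by rewrite exprMn -exprM; congr (_ * _); ring.
        by rewrite ler_pXn2r ?nnegrE// mulr_ge0// exprn_ge0// ltW.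
      have : 2 * q%:R ^+ 2 * (pi / V) <= 2 * q%:R ^+ 2 * 4.
        by apply: ler_wpM2l => //; apply: mulr_ge0 => //; exact: sqr_ge0.
      move: ht X6 q6; clear; lra.
    have mX2 : m.+1%:R <= (n0%:R + 1) * X ^+ 100.
      by rewrite -natr1 mulrDl mul1r; apply: lerD => //; exact: exprn_ege1.
    apply: le_trans (_ : Q0 * ((n0%:R + 1) * X ^+ 100) * (40 * X ^+ 6) <= _).
      apply: (ler_pM _ _ _ tX); [by rewrite mulr_ge0 ?(ltW Q00)|by rewrite addr_ge0|].
      by rewrite ler_pM2l.
    have -> : Q0 * ((n0%:R + 1) * X ^+ 100) * (40 * X ^+ 6) = 40 * Q0 * (n0%:R + 1) * X ^+ 106.
      by rewrite (exprD X 100 6); ring.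
    apply: le_trans (_ : X ^+ 1 * X ^+ 106 <= _); last by rewrite -exprD; apply: ler_weXn2l.
    rewrite expr1 ler_wpM2r ?exprn_ge0 ?(ltW X0')//; apply: le_trans XP; rewrite /P0.
    have n00 : 0 <= n0%:R :> R by []. nra.
  - by apply: le_trans VX _; apply: ler_weXn2l.
have mert Y : (0 < Y)%N -> \sum_(p <- gnball Y | cprime p) lam p <= ln Y%:R + Cm.
  by move=> /hm; rewrite ler_distl => /andP[].
have mert' Y : (0 < Y)%N -> ln Y%:R - Cm <= \sum_(p <- gnball Y | cprime p) lam p.
  by move=> /hm; rewrite ler_distl => /andP[].
have V0 : 0 < V by exact: lt_le_trans V1.
have hZ v1 v2 := hlip f K Z v1 v2 f1 Z0.
have main := @char_argpow_core C1 f K K1 Z m k q V X (X ^+ 5 + Cm) hZ C10 f1 Z0 erefl erefl V0 isT erefl hB.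
have {}main := main (le_trans (mert K1 K10) (_ : _ <= _)).
have SB : V + Cm <= X ^+ 5 + Cm by rewrite lerD2r.
have {}main := main SB.
rewrite (gnball_split _ _ K1K); apply: le_trans (ncD _ _) _.
set A := nc _ in main *; set A2 := nc _.
have hA2 : A2 <= 16 * X ^+ 3 + 1 + 2 * Cm.
  apply: le_trans (nc_sum _ _ _) _.
  apply: le_trans (_ : \sum_(p <- gnball K | cprime p && (K1 < gn p)%N) lam p <= _).
    apply: ler_sum => p _; rewrite ncM nc_argpow ncM nc_real ger0_norm ?lam_ge0// -mulrA.
    by rewrite ler_piMr ?lam_ge0// mulr_ile1 ?nc_ge0 ?mean_le1 ?nc_dirX_le1.
  have := @gnball_split _ K1 K (@cprime) lam K1K.
  have := mert K K0; have := mert' K1 K10; move: lK1 lnZ; clear; lra.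
(* Total weight X^5 times Lipschitz error X^5 / X^6. *)
have h1 : (X ^+ 5 + Cm) * (20 * ((2 * k + 1)%:R * C1) * V / q%:R ^+ 2 + (2 * k + 1)%:R * C1 / q%:R ^+ 2) <=
    (1 + Cm) * (21 * L) * X ^+ 4.
  have kL : (2 * k + 1)%:R * C1 <= L by rewrite /L ler_pM2r// ler_nat leq_add2r leq_mul2l.
  have kL0 : 0 <= (2 * k + 1)%:R * C1 by rewrite mulr_ge0// ltW.
  set a := (2 * k + 1)%:R * C1 in kL kL0 *.
  have q26 : (q%:R ^+ 2)^-1 <= (X ^+ 6)^-1.
    rewrite lef_pV2 ?posrE ?exprn_gt0// (exprM X 3 2) ler_pXn2r ?nnegrE ?exprn_ge0//.
    exact: ltW.
  have X5 : 1 <= X ^+ 5 by exact: exprn_ege1.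
  have s1 : X ^+ 5 + Cm <= (1 + Cm) * X ^+ 5 by have := ler_wpM2l (ltW Cm0) X5; clear; lra.
  have s2 : 20 * a * V / q%:R ^+ 2 + a / q%:R ^+ 2 <= 21 * L * X ^+ 5 * (X ^+ 6)^-1.
    rewrite -mulrDl; apply: (ler_pM _ _ _ q26).
    - by apply: addr_ge0 => //; rewrite mulr_ge0 ?(ltW V0)// mulr_ge0.
    - by rewrite invr_ge0 exprn_ge0 ?(ltW qR).
    have b1 : a * V <= L * X ^+ 5 by apply: ler_pM => //; exact: ltW.
    have b2 : a <= L * X ^+ 5 by apply: le_trans kL _; rewrite ler_peMr// ltW.
    move: b1 b2; clear; lra.
  apply: le_trans (ler_pM _ _ s1 s2) _.
  - by rewrite addr_ge0 ?exprn_ge0 ?ltW.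
  - have q2i : 0 <= (q%:R ^+ 2)^-1 :> R by rewrite invr_ge0 exprn_ge0 ?(ltW qR).
    apply: addr_ge0; last exact: mulr_ge0.
    by apply: mulr_ge0 => //; rewrite mulr_ge0 ?(ltW V0)// mulr_ge0.
  have X0n : X != 0 by rewrite gt_eqF.
  rewrite le_eqVlt; apply/orP; left; apply/eqP.
  have -> : X ^+ 5 = X ^+ 4 * X by rewrite exprSr.
  have -> : X ^+ 6 = X ^+ 4 * X * X by rewrite !exprSr.
  by field.
have h2 : 2 * X * q%:R <= 4 * X ^+ 4.
  by rewrite (exprS X 3); move: (ler_wpM2l (ltW X0') q2); clear; lra.
have x4 : 1 <= X ^+ 4 by exact: exprn_ege1.
have cm4 : Cm <= Cm * X ^+ 4 by rewrite ler_peMr// ltW.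
have X34 : 200 * X ^+ 3 <= X ^+ 4 by rewrite (exprS X 3) ler_wpM2r// exprn_ge0// ltW.
move: main hA2 h1 h2 x4 cm4 X34; clear; lra.
Qed.

End CharacterTest.

(** * The recursive inequality for a function with few values on primes *)

Section Recursion.
Variable R : realType.
Local Notation lgn := (lgn R).
Local Notation lam := (lam R).

Lemma expr_i_eq1 m : ('i : R[i]) ^+ m = 1 -> (4 %| m)%N.
Proof.
rewrite {1}(divn_eq m 4) exprD mulnC exprM.
have i4 : ('i : R[i]) ^+ 4 = 1 by rewrite (exprM _ 2 2) sqr_i sqrrN expr1n.
rewrite i4 expr1n mul1r /dvdn; have := ltn_pmod m (isT : (0 < 4)%N).
have n11 : (-1 : R) != 1 by rewrite lt_eqF//; lra.
case: (m %% 4)%N => [|[|[|[|]]]]// _.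
- by rewrite expr1 => /eqP; rewrite eq_complex /= eq_sym oner_eq0.
- by rewrite sqr_i => /eqP; rewrite eq_complex /= (negbTE n11).
- by rewrite exprS sqr_i mulrN1 => /eqP; rewrite eq_complex /= oppr0 eq_sym oner_eq0.
Qed.

(** [sum_log_primes] divided by 30 K. Replacing the integer part of K / N(p), divided by K, by 1 /
    N(p) costs the sum of ln N(p) / K, at most 8 by Chebyshev. *)
Lemma mean_recursion : exists2 C : R, 0 < C & forall f K,
  (forall m n, m != 0 -> n != 0 -> f (m * n) = f m * f n) ->
  (forall n, n != 0 -> nc (f n) = 1) -> (0 < K)%N ->
  nc ((ln K%:R)%:C * mean f K -
      \sum_(p <- gnball K | cprime p) (lam p)%:C * f p * mean f (K %/ gn p)) <= C.
Proof.
have [C C0 h] := sum_log_primes R.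
exists (C + 8) => [|f K fM f1 K0]; first by rewrite addr_gt0.
have KR : 0 < K%:R :> R by rewrite ltr0n.
have cne (x : R) : x != 0 -> x%:C != 0 :> R[i].
  by move=> x0; rewrite -(rmorph0 (real_complex R)) (inj_eq (@complexI R)).
have SE k : (0 < k)%N -> \sum_(n <- gnball k) f n = (30 * k%:R)%:C * mean f k.
  move=> k0; rewrite /mean mulrA -rmorphM divff ?rmorph1 ?mul1r//.
  by rewrite mulf_neq0 ?pnatr_eq0 -?lt0n// pnatr_eq0.
have := h f K fM f1; rewrite {1}SE//.
pose T := \sum_(p <- gnball K | cprime p) (lgn p * ((K %/ gn p)%:R / K%:R))%:C * f p * mean f (K %/ gn p).
have -> : \sum_(p <- gnball K | cprime p) (lgn p)%:C * f p * (\sum_(m <- gnball (K %/ gn p)) f m) =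
    (30 * K%:R)%:C * T.
  rewrite /T mulr_sumr big_seq_cond [RHS]big_seq_cond; apply: eq_bigr => p /andP[].
  rewrite mem_gnball => /andP[p0 pK] _; rewrite SE ?divn_gt0//.
  have e : 30 * (K %/ gn p)%:R = 30 * K%:R * ((K %/ gn p)%:R / K%:R) :> R.
    by rewrite -mulrA (mulrC K%:R) divfK ?gt_eqF.
  by rewrite e !rmorphM; ring.
have -> : (ln K%:R)%:C * ((30 * K%:R)%:C * mean f K) - (30 * K%:R)%:C * T =
    (30 * K%:R)%:C * ((ln K%:R)%:C * mean f K - T) by ring.
rewrite ncM nc_real gtr0_norm ?mulr_gt0// -[X in X * nc _]mulrC -mulrA (mulrC C) ler_pM2l// => h1.
have h1' : nc ((ln K%:R)%:C * mean f K - T) <= C by have := nc_ge0 ((ln K%:R)%:C * mean f K - T); lra.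
apply: le_trans (nc_sub_trans T _ _) _; apply: lerD => //.
rewrite /T -sumrB; apply: le_trans (nc_sum _ _ _) _.
apply: le_trans (_ : \sum_(p <- gnball K | cprime p) K%:R^-1 * lgn p <= _); last first.
  by rewrite -mulr_sumr mulrC ler_pdivrMr//; exact: gauss_theta_le.
rewrite big_seq_cond [leRHS]big_seq_cond; apply: ler_sum => p /andP[].
rewrite mem_gnball => /andP[p0 pK] cp; have p0' : p != 0 by rewrite -gn_gt0.
rewrite -!mulrBl -rmorphB 2!ncM f1// mulr1 nc_real.
apply: le_trans (_ : `|lgn p * ((K %/ gn p)%:R / K%:R) - lam p| * 1 <= _).
  by apply: ler_wpM2l => //; exact: mean_le1.
rewrite mulr1 /lam -mulrBr normrM (ger0_norm (lgn_ge0 _ _)) mulrC ler_wpM2r ?lgn_ge0//.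
have [b1 b2] := divn_real_bounds R K p0.
have gR : 0 < (gn p)%:R :> R by rewrite ltr0n.
have -> : (K %/ gn p)%:R / K%:R - (gn p)%:R^-1 = ((K %/ gn p)%:R - K%:R / (gn p)%:R) / K%:R :> R.
  by rewrite mulrBl; congr (_ - _); rewrite mulrAC divff ?gt_eqF// mul1r.
rewrite normrM normfV (gtr0_norm KR) ler_piMl ?invr_ge0 ?ler0n// ler_norml.
by apply/andP; split; lra.
Qed.

Definition angular (a : gaussInt -> R[i]) (h : nat) (m : gaussInt) : R[i] := a m * dir R m ^+ h.

Section Values.
Variables (a : gaussInt -> R[i]) (Z : seq R[i]) (h n : nat).
Hypothesis aZ : forall p, gprime p -> a p \in Z.
Hypothesis Z1 : forall z, z \in Z -> nc z = 1.
Hypothesis Zn : (2 * size Z < n)%N.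
(* Holds for the value set of [a] on primes, which are stable under multiplication by [gI]. *)
Hypothesis ZI : perm_eq [seq a gI * z | z <- Z] Z.
Hypothesis aI : a gI * 'i ^+ h = 1.

(** Stability of [Z] under [a gI] multiplies the power sum by [a gI ^+ k]. If it is nonzero, this
    factor is 1, and [aI] then forces i^(h k) = 1. Thus only harmonics trivial on units survive, the
    ones that [sum_twist] can treat. *)
Lemma power_sum_eq0 k : ~~ (4 %| h * k)%N -> \sum_(z <- Z) z ^+ k = 0.
Proof.
move=> hk; have e : a gI ^+ k * \sum_(z <- Z) z ^+ k = \sum_(z <- Z) z ^+ k.
  rewrite -[RHS](perm_big _ ZI) big_map mulr_sumr; apply: eq_bigr => z _.
  by rewrite exprMn.
apply/eqP; apply: contraNT hk => S0; apply: expr_i_eq1.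
have aIk : a gI ^+ k = 1 by apply: (mulIf S0); rewrite mul1r.
by rewrite exprM -[LHS]mul1r -{1}aIk -exprMn aI expr1n.
Qed.

Lemma power_sum_le k : nc (\sum_(z <- Z) z ^+ k) <= n%:R.
Proof.
apply: le_trans (nc_sum _ _ _) _; apply: le_trans (_ : \sum_(z <- Z) 1 <= _).
  by rewrite big_seq [leRHS]big_seq; apply: ler_sum => z zZ; rewrite ncX Z1// expr1n.
rewrite big_const_seq count_predT iter_addr_0 ler_nat.
by apply: leq_trans (ltnW Zn); rewrite mul2n -addnn leq_addl.
Qed.

Let n0 : (0 < n)%N. Proof. by exact: leq_ltn_trans Zn. Qed.

(** The majorant applied to the phase [v] of everything but [a p]. Its constant term is at most 1 -
    2 / n^2 + 3 |Z| / n^3, which is at most 1 - 1 / (2 n^2) because 2 |Z| < n. *)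
Lemma term_majorant p (s w : R[i]) : gprime p -> nc w = 1 ->
  Re (angular a h p * s * w) <= (1 - 1 / (2 * n%:R ^+ 2)) * nc s +
   6 / n%:R ^+ 4 * \sum_(1 <= k < n) (n - k)%:R *
     Re ((\sum_(z <- Z) z ^+ k) * w ^+ k * (dir R p ^+ (h * k) * argpow k s)).
Proof.
move=> gp w1; have p0 := gprime_neq0 gp.
have nR : 0 < n%:R :> R by rewrite ltr0n.
have [->|s0] := eqVneq s 0.
  rewrite mulr0 mul0r nc0 mulr0 add0r big1 ?mulr0// => k _.
  by rewrite /argpow nc0 mul0r !mulr0.
pose v := dir R p ^+ h * (s / (nc s)%:C) * w.
have cne : (nc s)%:C != 0 :> R[i].
  by rewrite -(rmorph0 (real_complex R)) (inj_eq (@complexI R)) nc_eq0.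
have v1 : nc v = 1.
  rewrite /v !ncM w1 mulr1 ncX nc_dir// expr1n mul1r ncV nc_real ger0_norm ?nc_ge0//.
  by rewrite divff ?nc_eq0.
have -> : angular a h p * s * w = (nc s)%:C * (a p * v).
  by rewrite -{1}(divfK cne s) /v /angular; ring.
rewrite ReZ; have := majorant n0 Z1 v1 (aZ gp); rewrite (majorant_fourier _ Z1 v1) => hm.
apply: le_trans (ler_wpM2l (nc_ge0 s) hm) _.
have -> : \sum_(1 <= k < n) (n - k)%:R * Re ((\sum_(z <- Z) z ^+ k) * w ^+ k *
      (dir R p ^+ (h * k) * argpow k s)) =
   nc s * \sum_(1 <= k < n) (n - k)%:R * Re ((\sum_(z <- Z) z ^+ k) * v ^+ k).
  rewrite mulr_sumr; apply: eq_bigr => k _; rewrite [RHS]mulrCA -[in RHS]ReZ.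
  apply: (congr1 (fun x => (n - k)%:R * Re x)).
  rewrite /v /argpow exprM; move: (\sum_(z <- Z) z ^+ k) (dir R p ^+ h) (s / _) => S d u.
  by rewrite !exprMn; ring.
set S := \sum_(_ <= _ < _) _.
have s0' := nc_ge0 s.
have hZ : 3 / n%:R ^+ 4 * (n%:R * (size Z)%:R) <= 3 / (2 * n%:R ^+ 2) :> R.
  have : 2 * (size Z)%:R <= n%:R :> R by rewrite -natrM ler_nat ltnW.
  have -> : 3 / n%:R ^+ 4 * (n%:R * (size Z)%:R) = 3 / (2 * n%:R ^+ 2) * (2 * (size Z)%:R / n%:R) :> R.
    by field; rewrite gt_eqF.
  move=> h2; rewrite -[leRHS]mulr1; apply: ler_wpM2l; last by rewrite ler_pdivrMr// mul1r.
  by rewrite divr_ge0// mulr_ge0// exprn_ge0.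
have e2 : 2 / n%:R ^+ 2 = 4 / (2 * n%:R ^+ 2) :> R by field; rewrite gt_eqF.
rewrite e2; have := ler_wpM2l s0' hZ; rewrite mul1r.
by move: (n%:R ^+ 4)^-1 (2 * n%:R ^+ 2)^-1 => i4 i2; lra.
Qed.

End Values.

Lemma argpow_recursion (n : nat) : (0 < n)%N -> exists C X0 : R, [/\ 0 < C, 1 <= X0 &
  forall (a : gaussInt -> R[i]) (Z : seq R[i]) (h K : nat) (X : R),
  (forall m k, m != 0 -> k != 0 -> a (m * k) = a m * a k) ->
  (forall m, m != 0 -> nc (a m) = 1) -> (forall p, gprime p -> a p \in Z) ->
  (forall z, z \in Z -> nc z = 1) -> (2 * size Z < n)%N ->
  perm_eq [seq a gI * z | z <- Z] Z -> a gI * 'i ^+ h = 1 ->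
  (0 < h)%N -> h%:R <= X ^+ 100 -> X0 <= X -> ln K%:R = X ^+ 5 ->
  X ^+ 5 * nc (mean (angular a h) K) <= (1 - 1 / (2 * n%:R ^+ 2)) *
     \sum_(p <- gnball K | cprime p) lam p * nc (mean (angular a h) (K %/ gn p)) + C * X ^+ 4].
Proof.
move=> n0; have [C1 C10 hrec] := mean_recursion.
have [C2 [X0 [C20 X01 hch]]] := char_argpow R n.
exists (C1 + 6 * C2), X0; split => //; first by rewrite addr_gt0 ?mulr_gt0.
move=> a Z h K X aM a1 aZ Z1 Zn ZI aI h0 hX XX0 KX; pose f := angular a h; rewrite -/f.
have X1 : 1 <= X by exact: le_trans XX0.
have X4 : 1 <= X ^+ 4 by exact: exprn_ege1.
have nR : 1 <= n%:R :> R by rewrite ler1n.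
have fM m k : m != 0 -> k != 0 -> f (m * k) = f m * f k.
  by move=> m0 k0; rewrite /f /angular aM// dirM [(dir R m * _) ^+ h]exprMn; ring.
have f1 m : m != 0 -> nc (f m) = 1.
  by move=> m0; rewrite /f /angular ncM a1// mul1r ncX nc_dir// expr1n.
have K0 : (0 < K)%N.
  rewrite lt0n; apply: contraTneq isT => e; move: KX; rewrite e ln0// => /eqP.
  by rewrite eq_sym expf_eq0 gt_eqF// (lt_le_trans ltr01).
have mu0 : 0 <= 1 - 1 / (2 * n%:R ^+ 2) :> R.
  have n2 : 1 <= n%:R ^+ 2 :> R by exact: exprn_ege1.
  by rewrite subr_ge0 ler_pdivrMr; lra.
have C0 : 0 <= C1 + 6 * C2 by rewrite addr_ge0 ?mulr_ge0 ?ltW.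
have [s0|s0] := eqVneq (mean f K) 0.
  rewrite s0 nc0 mulr0; apply: addr_ge0; last by rewrite mulr_ge0// (le_trans ler01).
  by rewrite mulr_ge0// sumr_ge0// => p _; rewrite mulr_ge0 ?lam_ge0 ?nc_ge0.
have ns : 0 < nc (mean f K) by rewrite nc_gt0.
have cne : (nc (mean f K))%:C != 0 :> R[i].
  by rewrite -(rmorph0 (real_complex R)) (inj_eq (@complexI R)) gt_eqF.
(* Multiplication by [w] makes the mean at K a positive real, so that its modulus is estimated by a
   real part and the one-sided majorant suffices. *)
pose w := (mean f K)^*%C / (nc (mean f K))%:C.
have w1 : nc w = 1 by rewrite ncM nc_conj ncV nc_real ger0_norm ?nc_ge0// divff ?gt_eqF.
have sw : mean f K * w = (nc (mean f K))%:C.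
  by rewrite mulrA mul_conj expr2 rmorphM mulfK.
pose T := \sum_(p <- gnball K | cprime p) (lam p)%:C * f p * mean f (K %/ gn p).
have hT : X ^+ 5 * nc (mean f K) <= Re (T * w) + C1.
  have h1 := hrec f K fM f1 K0; rewrite KX -/T in h1.
  have h2 := Re_le_nc (((X ^+ 5)%:C * mean f K - T) * w).
  rewrite ncM w1 mulr1 mulrBl -mulrA sw in h2.
  have : Re ((X ^+ 5)%:C * (nc (mean f K))%:C - T * w) = X ^+ 5 * nc (mean f K) - Re (T * w).
    by rewrite -rmorphM; case: (T * w) => x y.
  move=> e; rewrite e ler_norml in h2; move: h1 h2 => h1 /andP[_ h2]; move: h1 h2; clear; lra.
apply: le_trans hT _.
pose P k := \sum_(z <- Z) z ^+ k.
pose E k := \sum_(p <- gnball K | cprime p)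
  (lam p)%:C * dir R p ^+ (h * k) * argpow k (mean f (K %/ gn p)).
have hTw : Re (T * w) <= (1 - 1 / (2 * n%:R ^+ 2)) *
     (\sum_(p <- gnball K | cprime p) lam p * nc (mean f (K %/ gn p))) +
     6 / n%:R ^+ 4 * \sum_(1 <= k < n) (n - k)%:R * Re (P k * w ^+ k * E k).
  have -> : \sum_(1 <= k < n) (n - k)%:R * Re (P k * w ^+ k * E k) =
     \sum_(p <- gnball K | cprime p) lam p * \sum_(1 <= k < n) (n - k)%:R *
        Re (P k * w ^+ k * (dir R p ^+ (h * k) * argpow k (mean f (K %/ gn p)))).
    under [RHS]eq_bigr do rewrite mulr_sumr.
    rewrite [RHS]exchange_big; apply: eq_bigr => k _ /=.
    rewrite /E mulr_sumr Re_sum mulr_sumr; apply: eq_bigr => p _.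
    rewrite [RHS]mulrCA -[in RHS]ReZ; apply: (congr1 (fun x => (n - k)%:R * Re x)); ring.
  rewrite /T mulr_suml Re_sum !mulr_sumr -big_split /=; apply: ler_sum => p cp.
  have hp := @term_majorant a Z h n aZ Z1 Zn p (mean f (K %/ gn p)) w (cprime_gprime cp) w1.
  have := ler_wpM2l (lam_ge0 R p) hp; rewrite -[leLHS]ReZ.
  have -> : (lam p)%:C * (angular a h p * mean f (K %/ gn p) * w) =
    (lam p)%:C * f p * mean f (K %/ gn p) * w by rewrite !mulrA.
  move=> /le_trans; apply; rewrite le_eqVlt; apply/orP; left; apply/eqP.
  by rewrite /P; ring.
apply: le_trans (lerD hTw (lexx _)) _; rewrite -addrA lerD2l.
have hE k : (1 <= k < n)%N -> Re (P k * w ^+ k * E k) <= n%:R * (C2 * X ^+ 4).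
  move=> /andP[k0 kn]; apply: le_trans (ler_norm _) (le_trans (Re_le_nc _) _).
  have [hk|hk] := boolP (4 %| h * k)%N; last first.
    rewrite /P (power_sum_eq0 ZI aI hk) !mul0r nc0 mulr_ge0//.
    by rewrite mulr_ge0 ?(ltW C20)// (le_trans ler01).
  rewrite !ncM ncX w1 expr1n mulr1; apply: ler_pM; rewrite ?nc_ge0//.
    exact: (power_sum_le Z1 Zn).
  apply: hch => //; [by rewrite muln_gt0 h0| |exact: ltnW].
  rewrite natrM mulrC; apply: ler_pM => //; by rewrite ler_nat ltnW.
have hS : \sum_(1 <= k < n) (n - k)%:R * Re (P k * w ^+ k * E k) <= n%:R ^+ 3 * (C2 * X ^+ 4).
  have CX : 0 <= C2 * X ^+ 4 by rewrite mulr_ge0 ?(ltW C20)// (le_trans ler01).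
  apply: le_trans (_ : \sum_(1 <= k < n) n%:R * (n%:R * (C2 * X ^+ 4)) <= _).
    rewrite big_nat [leRHS]big_nat; apply: ler_sum => k hk.
    apply: le_trans (ler_wpM2l (ler0n _ _) (hE k hk)) _; apply: ler_wpM2r.
      by rewrite mulr_ge0.
    by rewrite ler_nat leq_subr.
  move: (C2 * X ^+ 4) CX => c c0.
  rewrite big_const_nat iter_addr_0 -[leLHS]mulr_natr.
  rewrite (_ : n%:R ^+ 3 * c = n%:R * (n%:R * c) * n%:R); last by ring.
  by apply: ler_wpM2l; [rewrite !mulr_ge0|rewrite ler_nat leq_subr].
have n4 : 0 < n%:R ^+ 4 :> R by rewrite exprn_gt0// (lt_le_trans ltr01).
have i4 : 0 <= 6 / n%:R ^+ 4 :> R by rewrite divr_ge0 ?(ltW n4).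
have h6 := ler_wpM2l i4 hS.
have h7 : 6 / n%:R ^+ 4 * (n%:R ^+ 3 * (C2 * X ^+ 4)) <= 6 * C2 * X ^+ 4.
  have -> : 6 / n%:R ^+ 4 * (n%:R ^+ 3 * (C2 * X ^+ 4)) = 6 * C2 * X ^+ 4 / n%:R.
    by field; rewrite gt_eqF// (lt_le_trans ltr01).
  rewrite ler_pdivrMr ?(lt_le_trans ltr01)// ler_peMr//.
  apply: mulr_ge0; last exact: le_trans ler01 X4.
  by rewrite mulr_ge0 ?(ltW C20).
have c1 : C1 <= C1 * X ^+ 4 by rewrite ler_peMr// ltW.
move: h6 h7 c1; clear; lra.
Qed.

End Recursion.

(** * Solving the recursion *)

Section Decay.
Variable R : realType.
Local Notation lgn := (lgn R).
Local Notation lam := (lam R).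

(** Partial summation replaces the prime weights by the increments of ln; since [F] is
    nondecreasing, the bounded Mertens error costs only a multiple of the last value of [F]. *)
Lemma mertens_abel : exists2 Cm : R, 0 < Cm & forall (F : nat -> R) K, (0 < K)%N ->
  (forall j, (0 < j <= K)%N -> 0 <= F j) ->
  (forall j, (0 < j < K)%N -> F j <= F j.+1) ->
  \sum_(p <- gnball K | cprime p) lam p * F (gn p) <=
  \sum_(2 <= j < K.+1) (ln j%:R - ln j.-1%:R) * F j + Cm * F K.
Proof.
have [Cm Cm0 hm] := mertens R; exists (2 * Cm) => [|F K K0 F0 Fmono]; first by rewrite mulr_gt0.
pose M J := \sum_(p <- gnball J | cprime p) lam p.
have hM J : (0 < J)%N -> `|M J - ln J%:R| <= Cm by exact: hm.
have shellE J (G : gaussInt -> R) : \sum_(p <- gnball J.+1 | cprime p) G p =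
    \sum_(p <- gnball J | cprime p) G p + \sum_(p <- shell J.+1 | cprime p) G p.
  by rewrite gnball_recr big_cat.
have shellF J : \sum_(p <- shell J | cprime p) lam p * F (gn p) =
    (\sum_(p <- shell J | cprime p) lam p) * F J.
  rewrite mulr_suml /shell !big_filter_cond; apply: eq_bigr => p /andP[/eqP -> _] //.
(* Shifted by [Cm], the Mertens error lies between 0 and 2 Cm, so its product with [F J] may be
   enlarged to that with [F J.+1] at each step. *)
suff h J : (0 < J)%N -> (J <= K)%N -> \sum_(p <- gnball J | cprime p) lam p * F (gn p) <=
    \sum_(2 <= j < J.+1) (ln j%:R - ln j.-1%:R) * F j + (M J - ln J%:R + Cm) * F J.
  apply: le_trans (h K K0 (leqnn _)) _; rewrite lerD2l; apply: ler_wpM2r.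
    by apply: F0; rewrite K0 leqnn.
  by have := hM K K0; rewrite ler_norml => /andP[_]; lra.
elim: J => // -[|J] IH _ JK.
  rewrite big_geq// add0r ln1 subr0 shellE shellF /gnball !big_nil add0r.
  have F1 : 0 <= F 1%N by apply: F0.
  by rewrite /M shellE /gnball big_nil add0r mulrDl lerDl mulr_ge0 ?(ltW Cm0).
rewrite shellE shellF; have {}IH := IH isT (ltnW JK).
have ME : M J.+2 = M J.+1 + \sum_(p <- shell J.+2 | cprime p) lam p by rewrite /M shellE.
set m := \sum_(p <- shell _ | _) _ in ME *.
rewrite big_nat_recr//= ME.
have FF : F J.+1 <= F J.+2 by apply: Fmono.
have c0 : 0 <= M J.+1 - ln J.+1%:R + Cm.
  by have := hM J.+1 isT; rewrite ler_norml => /andP[+ _]; lra.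
have := ler_wpM2l c0 FF; move: IH.
set s := \sum_(p <- _ | _) _; set t := \sum_(_ <= _ < _) _.
move: (M J.+1) (ln J.+1%:R) (ln J.+2%:R) (F J.+1) (F J.+2) => *; lra.
Qed.

Lemma powR_concave_incr (a x y : R) : 0 < a <= 1 -> 0 < x -> x <= y ->
  a * (y - x) * y `^ (a - 1) <= y `^ a - x `^ a.
Proof.
move=> /andP[a0 a1] x0 xy; have y0 : 0 < y by exact: lt_le_trans xy.
have e : x = y * (1 + (x / y - 1)) by field; rewrite gt_eqF.
have h1 : -1 < x / y - 1 by rewrite ltrBDr addNr divr_gt0.
have a01 : 0 <= a <= 1 by rewrite (ltW a0).
have hb := powR_bernoulli a01 h1.
have ya : y `^ (a - 1) = y `^ a / y.
  rewrite powRD ?(gt_eqF y0) ?implybT// powRN powRr1//; exact: ltW.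
have xE : x `^ a = y `^ a * (1 + (x / y - 1)) `^ a.
  rewrite -powRM ?(ltW y0)//; first by congr (_ `^ _).
  by move: h1; clear; lra.
rewrite ya xE.
have -> : a * (y - x) * (y `^ a / y) = y `^ a - y `^ a * (1 + a * (x / y - 1)).
  by field; rewrite gt_eqF.
by rewrite lerD2l lerN2 ler_wpM2l// powR_ge0.
Qed.

Definition decay (c V0 x : R) : R := V0 `^ c * (V0 + x) `^ (- c).

Lemma decay_anti c V0 x y : 0 <= c -> 0 < V0 + x -> x <= y -> decay c V0 y <= decay c V0 x.
Proof.
move=> c0 p xy; apply: ler_wpM2l; first exact: powR_ge0.
have p2 : 0 < V0 + y by apply: lt_le_trans p _; rewrite lerD2l.
rewrite !powRN lef_pV2 ?posrE ?powR_gt0//; apply: ge0_ler_powR => //; rewrite ?nnegrE ?(ltW p) ?(ltW p2)//.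
by rewrite lerD2l.
Qed.

Lemma decay0 c V0 : 0 < V0 -> decay c V0 0 = 1.
Proof. by move=> V00; rewrite /decay addr0 powRN divff// gt_eqF// powR_gt0. Qed.

Lemma decay_le1 c V0 x : 0 <= c -> 0 < V0 -> 0 <= x -> decay c V0 x <= 1.
Proof. by move=> c0 V00 x0; rewrite -(decay0 c V00); apply: decay_anti => //; rewrite addr0. Qed.

(** A Riemann sum for the integral of (V0 / (V0 + u))^c over 0 <= u <= ln K, which is at most ln K *
    decay (ln K) / (1 - c). The loss factor 1 / (1 - c) is what the factor 1 - mu of the recursion
    has to beat. *)
Lemma decay_sum : exists2 Cm : R, 0 < Cm & forall c V0 K, 0 <= c < 1 -> 3 <= V0 -> (0 < K)%N ->
  \sum_(p <- gnball K | cprime p) lam p * decay c V0 (ln (K %/ gn p)%:R) <=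
  (ln K%:R * decay c V0 (ln K%:R) + 2) / (1 - c) + Cm.
Proof.
have [Cm Cm0 hm] := mertens_abel; exists Cm => // c V0 K /andP[c0 c1] V03 K0.
have V00 : 0 < V0 by lra.
pose a := 1 - c; have a0 : 0 < a by rewrite /a; lra.
pose V := ln K%:R : R; have Vp : 0 <= V by rewrite ln_ge0// ler1n.
pose F j := decay c V0 (ln (K %/ j)%:R).
have Kj j : (0 < j <= K)%N -> (0 < K %/ j)%N by move=> /andP[j0 jK]; rewrite divn_gt0.
have lnp j : 0 <= ln (K %/ j)%:R :> R.
  by have [->|h] := posnP (K %/ j); [rewrite ln0|rewrite ln_ge0// ler1n].
have F1 j : F j <= 1 by apply: decay_le1.
have h1 := hm F K K0 _ _.
have {}h1 : \sum_(p <- gnball K | cprime p) lam p * F (gn p) <=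
  \sum_(2 <= j < K.+1) (ln j%:R - ln j.-1%:R) * F j + Cm * F K.
  apply: h1 => j h; first by rewrite mulr_ge0 ?powR_ge0.
  have [j0 jK] := andP h.
  apply: decay_anti => //; first by have := lnp j.+1; lra.
  by apply: ler_ln_nat; [apply: Kj; rewrite jK|exact: leq_div2l].
apply: le_trans h1 _; apply: lerD; last by rewrite -[leRHS]mulr1 ler_pM2l.
(* The offset 2 pays once for the integer part of K / j and once for passing from j to j - 1; V0 >=
   3 keeps [T] at least 1. *)
pose T j := V0 + V - 2 - ln j%:R : R.
have Tp j : (0 < j <= K)%N -> V0 - 2 <= T j.
  by move=> /andP[j0 jK]; have := ler_ln_nat R j0 jK; rewrite /T -/V; lra.
apply: le_trans (_ : \sum_(2 <= j < K.+1) V0 `^ c / a * (T j.-1 `^ a - T j `^ a) <= _).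
  rewrite big_nat [leRHS]big_nat; apply: ler_sum => j /andP[j2 jK].
  have j0 : (0 < j)%N by exact: leq_trans j2.
  have j1 : (0 < j.-1)%N by rewrite -ltnS prednK.
  have hj : (0 < j <= K)%N by rewrite j0 -ltnS.
  have hj1 : (0 < j.-1 <= K)%N by rewrite j1 (leq_trans (leq_pred j))// -ltnS.
  have Tj := Tp j hj; have Tj1 := Tp _ hj1.
  have lnle : ln j.-1%:R <= ln j%:R :> R by apply: ler_ln_nat => //; exact: leq_pred.
  have ln1 : ln j%:R <= ln j.-1%:R + 1 :> R.
    have j1R : 0 < j.-1%:R :> R by rewrite ltr0n.
    apply: le_trans (_ : ln (2 * j.-1%:R) <= _).
      rewrite ler_ln ?posrE ?ltr0n ?mulr_gt0// -natrM ler_nat -{1}(prednK j0) mul2n -addnn.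
      by rewrite -[X in (X <= _)%N]addn1 leq_add2l.
    by rewrite lnM ?posrE//; have := ln2_le1 R; lra.
  have lnK : V - ln j%:R - 1 <= ln (K %/ j)%:R.
    have qR : 0 < (K %/ j)%:R :> R by rewrite ltr0n Kj.
    have jR : 0 < j%:R :> R by rewrite ltr0n.
    have : V <= ln ((K %/ j)%:R * (2 * j%:R)).
      have -> : (K %/ j)%:R * (2 * j%:R) = ((K %/ j) * (2 * j))%N%:R :> R by rewrite !natrM.
      apply: ler_ln_nat => //; have := ltn_ceil K j0 => /ltnW/leq_trans; apply; rewrite mulnA leq_mul2r; apply/orP; right.
      by rewrite mulnC mul2n -addnn -[X in (X <= _)%N]addn1 leq_add2l Kj.
    rewrite lnM ?posrE ?mulr_gt0// lnM ?posrE//; have := ln2_le1 R; lra.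
  have Ty : 0 < T j.-1 by lra.
  have FT : F j <= V0 `^ c * T j.-1 `^ (- c).
    have -> : V0 `^ c * T j.-1 `^ (- c) = decay c V0 (T j.-1 - V0) by rewrite /decay addrC subrK.
    apply: decay_anti => //; first by rewrite addrC subrK.
    by rewrite /T; lra.
  have Tle : T j <= T j.-1 by rewrite /T; lra.
  have Tj0 : 0 < T j by lra.
  have a01 : 0 < a <= 1 by rewrite a0 /a; lra.
  have := powR_concave_incr a01 Tj0 Tle.
  have -> : T j.-1 - T j = ln j%:R - ln j.-1%:R by rewrite /T; lra.
  have -> : a - 1 = - c by rewrite /a; lra.
  set w := _ - _ `^ a => hw.
  have d0 : 0 <= ln j%:R - ln j.-1%:R :> R by lra.
  apply: le_trans (ler_wpM2l d0 FT) _.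
  have Vc : 0 <= V0 `^ c by exact: powR_ge0.
  have := ler_wpM2l Vc hw; rewrite (mulrAC (V0 `^ c)) ler_pdivlMr//.
  by move=> h; apply: le_trans h; rewrite le_eqVlt; apply/orP; left; apply/eqP; ring.
rewrite -mulr_sumr big_add1 /=.
have -> : \sum_(1 <= i < K) (T i `^ a - T i.+1 `^ a) = T 1%N `^ a - T K `^ a.
  by rewrite -[LHS]opprK -sumrN (eq_bigr (fun i => T i.+1 `^ a - T i `^ a)) ?telescope_sumr// ?opprB// => i _; rewrite opprB.
have T1E : T 1%N = V0 + V - 2 by rewrite /T ln1 subr0.
have TKE : T K = V0 - 2 by rewrite /T -/V; lra.
rewrite T1E TKE; set T1 := _ - 2; set U := V0 - 2.
have U1 : 1 <= U by rewrite /U; lra.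
have U0 : 0 < U by lra.
have T1U : T1 = U + V by rewrite /T1 /U; lra.
have T10 : 0 < T1 by lra.
have hT : T1 `^ a - U `^ a <= V * T1 `^ (- c).
  have e1 : T1 `^ a = T1 * T1 `^ (- c).
    rewrite -[X in X * _](powRr1 (ltW T10)) -powRD; first by congr (_ `^ _); rewrite /a; lra.
    by rewrite (gt_eqF T10) implybT.
  have e2 : U * T1 `^ (- c) <= U `^ a.
    have -> : U `^ a = U * U `^ (- c).
      rewrite -[X in X * _](powRr1 (ltW U0)) -powRD; first by congr (_ `^ _); rewrite /a; lra.
      by rewrite (gt_eqF U0) implybT.
    rewrite ler_pM2l// !powRN lef_pV2 ?posrE ?powR_gt0//.
    by apply: ge0_ler_powR; rewrite ?nnegrE ?(ltW U0) ?(ltW T10)//; lra.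
  rewrite e1; have : T1 * T1 `^ (- c) = U * T1 `^ (- c) + V * T1 `^ (- c) by rewrite T1U; ring.
  by move=> ->; lra.
(* This undoes the offset: replacing V0 + V - 2 by V0 + V costs a factor of at most 1 + 2 / T1, and
   V <= T1. *)
have hG : V0 `^ c * (V * T1 `^ (- c)) <= V * decay c V0 V + 2.
  have VV : 0 < V0 + V by lra.
  pose r := (V0 + V) / T1.
  have r1 : 1 <= r by rewrite /r ler_pdivlMr// mul1r /T1; lra.
  have e1 : T1 `^ (- c) = (V0 + V) `^ (- c) * r `^ c.
    rewrite {1}(_ : T1 = (V0 + V) * r^-1); last first.
      by rewrite /r invf_div mulrC divfK// gt_eqF.
    rewrite powRM ?(ltW VV) ?invr_ge0 ?(le_trans ler01 r1)//; congr (_ * _).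
    by rewrite -powR_inv1 ?(le_trans ler01 r1)// -powRrM; congr (_ `^ _); lra.
  have e2 : r `^ c <= r by rewrite -[leRHS]powRr1 ?(le_trans ler01 r1)//; apply: ler_powR => //; exact: ltW.
  have e3 : r = 1 + 2 / T1 by rewrite /r /T1; field; rewrite gt_eqF.
  have -> : V0 `^ c * (V * T1 `^ (- c)) = V * decay c V0 V * r `^ c.
    by rewrite e1 /decay; ring.
  have dV : 0 <= V * decay c V0 V by rewrite !mulr_ge0 ?powR_ge0.
  apply: le_trans (ler_wpM2l dV e2) _; rewrite {1}e3 mulrDr mulr1 lerD2l.
  rewrite mulrCA -[leRHS]mulr1 ler_pM2l// ler_pdivrMr// mul1r.
  have d1 : decay c V0 V <= 1 by exact: decay_le1.
  have := ler_wpM2l Vp d1; lra.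
have ia : 0 < a^-1 by rewrite invr_gt0.
have Vc : 0 <= V0 `^ c by exact: powR_ge0.
rewrite mulrAC ler_pM2r//; apply: le_trans hG; exact: ler_wpM2l.
Qed.

End Decay.

Section MeanDecay.
Variable R : realType.
Local Notation lam := (lam R).

(** V0 + X^5 is at most X^10, and its power with exponent -c >= -1/20 is at least X^(-1/2). So the
    target bound dominates the relative error 1 / X of one recursion step. *)
Lemma decay_ge (c V0 X : R) : 0 < c -> c <= 20^-1 -> 1 <= V0 -> V0 <= X ^+ 5 -> 2 <= X ->
  X `^ (- (1 / 2)) <= decay c V0 (X ^+ 5).
Proof.
move=> c0 c20 V01 V0X X2; have Xp : 0 < X by lra.
have V00 : 0 < V0 by lra.
have X5 : 0 < X ^+ 5 by exact: exprn_gt0.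
have X1 : 1 <= X by lra.
have X55 : X <= X ^+ 5 by rewrite -[leLHS]expr1; exact: ler_weXn2l.
have X10 : V0 + X ^+ 5 <= X ^+ 10.
  have -> : X ^+ 10 = X ^+ 5 * X ^+ 5 by rewrite -exprD.
  by move: (X ^+ 5) V0X X55 X2 => Y; clear; nra.
rewrite /decay -[leLHS]mul1r; apply: ler_pM; rewrite ?powR_ge0//.
  by rewrite -[leLHS](powRr0 V0); apply: ler_powR => //; exact: ltW.
rewrite !powRN lef_pV2 ?posrE ?powR_gt0 ?addr_gt0//.
apply: le_trans (_ : (X ^+ 10) `^ c <= _).
  by apply: (ge0_ler_powR (ltW c0)); rewrite ?nnegrE ?addr_ge0 ?exprn_ge0// ltW.
rewrite -(powR_mulrn 10 (ltW Xp)) -powRrM; apply: ler_powR => //.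
by move: c20; clear; lra.
Qed.

Lemma mean_decay (D : nat) : (0 < D)%N -> exists2 V1 : R, 3 <= V1 &
  forall (a : gaussInt -> R[i]) (Z : seq R[i]) (h : nat) (V0 : R),
  (forall m k, m != 0 -> k != 0 -> a (m * k) = a m * a k) ->
  (forall m, m != 0 -> nc (a m) = 1) -> (forall p, gprime p -> a p \in Z) ->
  (forall z, z \in Z -> nc z = 1) -> (size Z <= D)%N ->
  perm_eq [seq a gI * z | z <- Z] Z -> a gI * 'i ^+ h = 1 ->
  (0 < h)%N -> V1 <= V0 -> forall K, (0 < K)%N -> h%:R <= V0 ^+ 20 ->
  nc (mean (angular a h) K) <= 2 * decay (20 * D%:R ^+ 2)^-1 V0 (ln K%:R).
Proof.
move=> D0; have n0 : (0 < 2 * D + 1)%N by rewrite addn1.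
have [C [X0 [C0 X01 hrec]]] := argpow_recursion R n0.
have [Cm Cm0 hm] := decay_sum R.
have D1 : 1 <= D%:R :> R by rewrite ler1n.
have D2 : 1 <= D%:R ^+ 2 :> R by exact: exprn_ege1.
pose c : R := (20 * D%:R ^+ 2)^-1.
have D2p : 0 < 20 * D%:R ^+ 2 :> R by lra.
have c0 : 0 < c by rewrite invr_gt0.
have c20 : c <= 20^-1 by rewrite lef_pV2 ?posrE//; lra.
(* With n = 2 D + 1 <= 3 D, the gain 1 / (2 n^2) of the recursion is at least [mu]; [c] is taken
   smaller to leave a positive margin [delta]. *)
pose mu : R := (18 * D%:R ^+ 2)^-1.
have mu_c : mu = c * (10 / 9) by rewrite /mu /c; field; rewrite gt_eqF// (lt_le_trans ltr01).
have nD : 2 * (2 * D + 1)%:R ^+ 2 <= 18 * D%:R ^+ 2 :> R.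
  by rewrite natrD natrM; nra.
have n2p : 0 < 2 * (2 * D + 1)%:R ^+ 2 :> R by rewrite mulr_gt0// exprn_gt0// ltr0n.
have hmu : 1 - 1 / (2 * (2 * D + 1)%:R ^+ 2) <= 1 - mu.
  by rewrite lerD2l lerN2 mul1r lef_pV2 ?posrE//; lra.
pose delta := mu - c.
have d0 : 0 < delta by rewrite /delta mu_c; lra.
(* All error terms of one step add up to at most 2 delta B X^4, and [X1] is chosen so that B <=
   X^(1/2); the margin 2 delta V G then covers them. *)
pose B := (C + 4 + 2 * Cm) / (2 * delta).
have B0 : 0 < B by rewrite divr_gt0 ?mulr_gt0//; lra.
pose X1 := X0 + B ^+ 2 + 2.
have B2 : 0 < B ^+ 2 by exact: exprn_gt0.
have X12 : 2 <= X1 by rewrite /X1; lra.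
have X0X1 : X0 <= X1 by rewrite /X1; lra.
have B2X1 : B ^+ 2 <= X1 by rewrite /X1; lra.
have q2 : 0 <= 1 / 2 :> R by lra.
have d2 : 0 < 2 * delta by lra.
have c1 : 0 < 1 - c by lra.
have m1 : 0 <= 1 - mu by rewrite mu_c; lra.
have c01 : 0 <= c < 1 by rewrite (ltW c0)/=; lra.
have BE : C + 4 + 2 * Cm = 2 * delta * B by rewrite /B [RHS]mulrC divfK// gt_eqF.
(* Hence (1 - mu) / (1 - c) <= 1 - delta: the gain of the recursion beats the loss in
   [decay_sum]. *)
have dE : 1 - mu = (1 - delta) * (1 - c) - delta * c by rewrite /delta; ring.
have mc : c <= mu by rewrite -subr_ge0 (ltW d0).
have Cm1 : (1 - mu) * Cm <= Cm by rewrite ler_piMl ?(ltW Cm0)//; lra.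
clearbody X1 B delta mu.
exists (X1 ^+ 5 + 3) => [|a Z h V0 aM a1 aZ Z1 ZD ZI aI h0 V10].
  by rewrite lerDr exprn_ge0//; move: X12; clear; lra.
have Zn : (2 * size Z < 2 * D + 1)%N by rewrite addn1 ltnS leq_mul2l.
have X15 : 0 < X1 ^+ 5 by rewrite exprn_gt0//; move: X12; clear; lra.
have V03 : 3 <= V0 by move: V10 X15; clear; lra.
have V00 : 0 < V0 by move: V03; clear; lra.
have V01 : 1 <= V0 by move: V03; clear; lra.
rewrite -/c; clearbody c; elim/ltn_ind => K IH K0.
have f1 m : m != 0 -> nc (angular a h m) = 1.
  by move=> m0; rewrite /angular ncM a1// mul1r ncX nc_dir// expr1n.
pose V := ln K%:R : R; have Vp : 0 <= V by rewrite ln_ge0// ler1n.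
have [hV0|hV0] := leP V V0.
  (* Start of the induction: for ln K <= V0 the decay factor is at least 2^(-c) >= 1/2, so the
     factor 2 in the claim makes it trivial. *)
  move=> _; apply: le_trans (mean_le1 _ f1) _.
  have : decay c V0 V0 <= decay c V0 V by apply: decay_anti => //; [exact: ltW|exact: ltr_wpDr].
  have -> : decay c V0 V0 = 2 `^ (- c).
    rewrite /decay (_ : V0 + V0 = V0 * 2) ?powRM ?(ltW V00)//; last by ring.
    by rewrite powRN mulrA divff ?mul1r// gt_eqF// powR_gt0.
  have : 2^-1 <= 2 `^ (- c) :> R.
    by rewrite -powR_inv1//; apply: ler_powR; move: c20; clear; lra.
  rewrite -/V; move: (decay c V0 V) => y; clear; lra.
have Vgt0 : 0 < V by exact: lt_trans V00 hV0.
pose X := V `^ (5^-1).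
have X5 : X ^+ 5 = V by rewrite -powR_mulrn ?powR_ge0// -powRrM mulVf// powRr1.
have Xp : 0 < X by rewrite powR_gt0.
have X1X : X1 <= X.
  rewrite -(@ler_pXn2r _ 5)// ?nnegrE ?(ltW Xp)//; last by move: X12; clear; lra.
  by rewrite X5; move: V10 hV0; clear; lra.
have XX0 : X0 <= X by exact: le_trans X1X.
have X2 : 2 <= X by exact: le_trans X1X.
(* V0^20 is at most V^20 = X^100 in this range. *)
move=> hV; have hX : h%:R <= X ^+ 100.
  apply: le_trans hV _; rewrite (exprM X 5 20) X5 ler_pXn2r ?nnegrE ?(ltW V00) ?(ltW Vgt0)//.
  exact: ltW.
have hr := hrec a Z h K X aM a1 aZ Z1 Zn ZI aI h0 hX XX0 (esym X5).
clear hX.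
set G := decay c V0 V.
have G0 : 0 <= G by rewrite mulr_ge0 ?powR_ge0.
have hsum : \sum_(p <- gnball K | cprime p) lam p * nc (mean (angular a h) (K %/ gn p)) <=
    2 * ((V * G + 2) / (1 - c) + Cm).
  apply: le_trans (_ : 2 * \sum_(p <- gnball K | cprime p) lam p * decay c V0 (ln (K %/ gn p)%:R) <= _).
    rewrite mulr_sumr big_seq_cond [leRHS]big_seq_cond; apply: ler_sum => p /andP[].
    rewrite mem_gnball => /andP[p0 pK] cp; rewrite mulrCA; apply: ler_wpM2l; first exact: lam_ge0.
    apply: IH => //; last by rewrite divn_gt0.
    by apply: ltn_Pdiv => //; exact: gprime_gn (cprime_gprime cp).
  by rewrite ler_pM2l//; exact: hm.
clear hV; have VG : B * X ^+ 4 <= V * G.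
  have g1 : X `^ (- (1 / 2)) <= G.
    by have := @decay_ge c V0 X c0 c20 V01; rewrite X5; apply=> //; exact: ltW.
  have g2 : B <= X `^ (1 / 2).
    have -> : B = (B ^+ 2) `^ (1 / 2) by rewrite -(powR_mulrn 2 (ltW B0)) -powRrM mulrA mulr1 divff// powRr1// ltW.
    apply: (ge0_ler_powR q2); rewrite ?nnegrE ?(ltW B2) ?(ltW Xp)//.
    exact: le_trans B2X1 X1X.
  apply: le_trans (_ : V * X `^ (- (1 / 2)) <= _); last by rewrite ler_pM2l.
  have -> : V * X `^ (- (1 / 2)) = X * X `^ (- (1 / 2)) * X ^+ 4.
    by rewrite -[V]X5 (exprS X 4) mulrAC.
  apply: ler_wpM2r; first by rewrite exprn_ge0 ?(ltW Xp).
  apply: le_trans g2 _; rewrite powRN -[X in _ <= X / _](powRr1 (ltW Xp)).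
  rewrite -powRB ?(gt_eqF Xp) ?implybT// (_ : 1 - 1 / 2 = 1 / 2)//; clear; lra.
rewrite -/V -/G -(ler_pM2l Vgt0) -{1}X5; apply: le_trans hr _.
have s0 : 0 <= \sum_(p <- gnball K | cprime p) lam p * nc (mean (angular a h) (K %/ gn p)).
  by apply: sumr_ge0 => p _; rewrite mulr_ge0 ?lam_ge0 ?nc_ge0.
apply: le_trans (lerD (ler_wpM2r s0 hmu) (lexx _)) _.
apply: le_trans (lerD (ler_wpM2l m1 hsum) (lexx _)) _.
have VG0 : 0 <= V * G by rewrite mulr_ge0.
have e1 : (1 - mu) * ((V * G + 2) / (1 - c)) <= (1 - delta) * (V * G) + 2.
  rewrite mulrA ler_pdivrMr//.
  have dcVG : 0 <= delta * c * (V * G) by exact: mulr_ge0 (mulr_ge0 (ltW d0) (ltW c0)) VG0.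
  have -> : (1 - mu) * (V * G + 2) = ((1 - delta) * (1 - c) - delta * c) * (V * G) + (1 - mu) * 2.
    by rewrite -dE mulrDr.
  by move: mc dcVG; clear; lra.
have X41 : 1 <= X ^+ 4 by apply: exprn_ege1; move: X2; clear; lra.
have e2 : (C + 4 + 2 * Cm) * X ^+ 4 <= 2 * delta * (V * G).
  by rewrite BE -(mulrA _ B) ler_pM2l.
have e4 : Cm <= Cm * X ^+ 4 by rewrite ler_peMr// ltW.
clearbody V G X; move: e1 e2 Cm1 e4 X41; clear; lra.
Qed.

End MeanDecay.

(** * Choice of parameters and passage to averages over the ball *)

Section Assembly.
Variable R : realType.
Local Notation dir := (dir R).
Local Notation gcount := (gcount R).

Lemma sum_gnball_rot (f : gaussInt -> R[i]) K :
  (forall n, n != 0 -> f (gI * n) = f gI * f n) -> f gI != 1 ->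
  \sum_(n <- gnball K) f n = 0.
Proof.
move=> fI f1.
have gI0 : gI != 0 by [].
have uniqI : uniq [seq gI * n | n <- gnball K].
  by rewrite map_inj_in_uniq ?gnball_uniq// => x y _ _; exact: gmulfI.
have subI : {subset [seq gI * n | n <- gnball K] <= gnball K}.
  by move=> _ /mapP[n nK ->]; move: nK; rewrite !mem_gnball gnM gnI mul1n.
have pe : perm_eq [seq gI * n | n <- gnball K] (gnball K).
  apply: uniq_perm => //; first exact: gnball_uniq.
  by have [] := uniq_min_size uniqI subI; rewrite ?size_map.
have e : f gI * \sum_(n <- gnball K) f n = \sum_(n <- gnball K) f n.
  rewrite -[RHS](perm_big _ pe) big_map mulr_sumr big_seq [RHS]big_seq.
  by apply: eq_bigr => n; rewrite mem_gnball gn_gt0 => /andP[n0 _]; rewrite fI.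
apply/eqP; apply: contraNT f1 => S0; apply/eqP; apply: (mulIf S0); by rewrite mul1r.
Qed.

Lemma sinc_ge (D : nat) : (0 < D)%N -> 1 - sinc (pi / D%:R : R) <= 16 / (6 * D%:R ^+ 2).
Proof.
move=> D0; have DR : 0 < D%:R :> R by rewrite ltr0n.
set t := pi / D%:R; have t0 : 0 < t by rewrite divr_gt0 ?pi_gt0.
have h : 1 - t ^+ 2 / 6 <= sinc t.
  rewrite /sinc ler_pdivlMr//; apply: le_trans (sin_ge (ltW t0)).
  by rewrite le_eqVlt; apply/orP; left; apply/eqP; field.
have t4 : t ^+ 2 <= 16 / D%:R ^+ 2.
  rewrite /t expr_div_n ler_pM2r ?invr_gt0 ?exprn_gt0//.
  have := pi_le4 R; have := pi_gt0 R; rewrite expr2; nra.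
have -> : 16 / (6 * D%:R ^+ 2) = (16 / D%:R ^+ 2) / 6 :> R by field; rewrite gt_eqF.
by move: h t4; clear; lra.
Qed.

Lemma angular_sum_bound (D : nat) : (0 < D)%N -> exists C N0 : R, [/\ 0 < C, 3 <= N0, 0 <= ln N0 &
  forall (a : gaussInt -> R[i]) (Z : seq R[i]),
  (forall m k, m != 0 -> k != 0 -> a (m * k) = a m * a k) ->
  (forall m, m != 0 -> nc (a m) = 1) -> (forall p, gprime p -> a p \in Z) ->
  (forall z, z \in Z -> nc z = 1) -> (size Z <= D)%N ->
  perm_eq [seq a gI * z | z <- Z] Z ->
  forall N (h : nat), N0 <= N -> (0 < h)%N -> h%:R <= ln N ^+ 2 ->
  nc (\sum_(n <- gnball (Num.truncn N)) angular a h n) <=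
  C * ln N `^ (- decay_exponent R D) * gcount (Num.truncn N)].
Proof.
move=> D0; have [V1 V13 hdec] := mean_decay R D0.
pose Y0 := V1 ^+ 10; have Y01 : 3 <= Y0.
  have V11 : 1 <= V1 by lra.
  by apply: le_trans V13 _; rewrite -[leLHS]expr1; exact: ler_weXn2l.
have N01 : 3 <= expR Y0 by have := expR_ge1Dx Y0; lra.
(* 480 = 30 * 2 * 8: the normalization of the mean, the factor in [mean_decay], and K <= 8 gcount
   K. *)
have [C C0 hC] : exists2 C : R, 0 < C & 480 <= C by exists 480; rewrite ?ltr0n ?lexx.
exists C, (expR Y0); split => //; first by rewrite expRK; lra.
move=> a Z aM a1 aZ Z1 ZD ZI N h hN h0 hY.
have N0 : 0 < N by lra.
pose Y := ln N; have YY : Y0 <= Y by rewrite -[leLHS]expRK /Y ler_ln ?posrE ?expR_gt0.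
have Yp : 0 < Y by lra.
pose K := Num.truncn N.
have N1 : 1 <= N by lra.
have K0 : (0 < K)%N by rewrite /K truncn_ge_nat// ltW.
have KR : 0 < K%:R :> R by rewrite ltr0n.
have f1 m : m != 0 -> nc (angular a h m) = 1.
  by move=> m0; rewrite /angular ncM a1// mul1r ncX nc_dir// expr1n.
have p0 : 0 <= Y `^ (- decay_exponent R D) by exact: powR_ge0.
have g0 : 0 <= gcount K by rewrite /gcount.
have [aI|aI] := eqVneq (a gI * 'i ^+ h) 1; last first.
  have fI n : n != 0 -> angular a h (gI * n) = angular a h gI * angular a h n.
    move=> n0; have gI0 : gI != 0 by [].
    by rewrite /angular aM// dirM [(dir _ * _) ^+ h]exprMn; ring.
  have fI1 : angular a h gI != 1 by rewrite /angular dirI.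
  rewrite (sum_gnball_rot _ fI fI1) nc0.
  by rewrite mulr_ge0// mulr_ge0// ltW.
(* The exponent 1/10 makes V0^20 equal to (ln N)^2, the full range of h, and leaves a decay (ln
   N)^(-9 c / 10). *)
pose V0 := Y `^ (1 / 10).
have V0E : V0 ^+ 10 = Y by rewrite -powR_mulrn ?powR_ge0// -powRrM (_ : 1 / 10 * 10%:R = 1) ?powRr1 ?(ltW Yp)//; lra.
have V0p : 0 < V0 by rewrite powR_gt0.
have V10 : V1 <= V0.
  by rewrite -(@ler_pXn2r _ 10) ?nnegrE ?(ltW V0p)// ?V0E//; lra.
have hV : h%:R <= V0 ^+ 20 by rewrite (exprM V0 10 2) V0E.
have hd := hdec a Z h V0 aM a1 aZ Z1 ZD ZI aI h0 V10 K K0 hV; clear hV.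
set c := (20 * D%:R ^+ 2)^-1 in hd.
have D1 : 1 <= D%:R :> R by rewrite ler1n.
have D2 : 1 <= D%:R ^+ 2 :> R by exact: exprn_ege1.
have c0 : 0 < c by rewrite invr_gt0; lra.
have dY : decay c V0 (ln K%:R) <= Y `^ (- decay_exponent R D).
  have lnK : Y - 1 <= ln K%:R.
    have [_ _ ] := @ln_truncn R N 1 isT N1; rewrite invr1 -/K -/Y; lra.
  apply: le_trans (_ : V0 `^ c * Y `^ (- c) <= _).
    apply: ler_wpM2l; first exact: powR_ge0.
    rewrite !powRN lef_pV2 ?posrE ?powR_gt0//; last lra.
    by apply: (ge0_ler_powR (ltW c0)); rewrite ?nnegrE; move: Yp lnK V10 V13; clear; lra.
  rewrite /V0 -powRrM -powRD; last by rewrite (gt_eqF Yp) implybT.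
  apply: ler_powR; first by lra.
  (* The required exponent is at most 16 / (64 * 6 D^2) = 5 c / 6, below 9 c / 10. *)
  have := sinc_ge D0; rewrite /decay_exponent.
  have -> : 16 / (6 * D%:R ^+ 2) = c * (160 / 3) :> R.
    by rewrite /c; field; rewrite gt_eqF// (lt_le_trans ltr01).
  by move: c c0 {hd} => c c0; lra.
have sE : \sum_(n <- gnball K) angular a h n = (30 * K%:R)%:C * mean (angular a h) K.
  rewrite /mean mulrA -rmorphM divff ?rmorph1 ?mul1r//.
  by rewrite mulf_neq0 ?pnatr_eq0 -?lt0n// pnatr_eq0.
rewrite -/K sE ncM nc_real gtr0_norm ?mulr_gt0//.
apply: le_trans (_ : 30 * K%:R * (2 * Y `^ (- decay_exponent R D)) <= _).
  apply: ler_wpM2l; first by rewrite mulr_ge0.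
  by apply: le_trans hd _; rewrite ler_pM2l.
have := gcount_ge R K => hg; have h1 := ler_wpM2r p0 hg.
have h2 := ler_wpM2r (mulr_ge0 p0 g0) hC.
by rewrite -/Y; move: h1 h2; move: (Y `^ _) => y; clear; lra.
Qed.

Lemma mem_gball (N : R) n : 0 <= N -> (n \in fset_set (gball N)) = (n \in gnball (Num.truncn N)).
Proof.
move=> N0; rewrite in_fset_set; last exact: finite_gball.
rewrite mem_gnball gn_gt0 truncn_ge_nat//.
have e : (gnorm n)%:~R = (gn n)%:R :> R.
  have -> : gnorm n = gn n :> int by rewrite /gn gez0_abs// /gnorm addr_ge0 ?sqr_ge0.
  by [].
by apply/idP/andP => [/set_mem [h1 h2]|[h1 h2]]; [rewrite -e|apply/mem_set; split; rewrite ?e].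
Qed.

Lemma averageE (N : R) (F : gaussInt -> R[i]) : 0 <= N ->
  average (gball N) F = (gcount (Num.truncn N))^-1%:C * \sum_(n <- gnball (Num.truncn N)) F n.
Proof.
move=> N0; have pe : perm_eq (fset_set (gball N)) (gnball (Num.truncn N)).
  by apply: uniq_perm; [exact: fset_uniq|exact: gnball_uniq|move=> n; exact: mem_gball].
by rewrite /average (perm_big _ pe) (perm_size pe) /gcount fmorphV rmorph_nat.
Qed.

Lemma expi_carg (h : int) n : n != 0 ->
  expi (h%:~R * carg (gaussC R n)) =
  if 0 <= h then dir n ^+ `|h|%N else (dir n ^+ `|h|%N)^*%C.
Proof.
move=> n0; case: (leP 0 h) => h0.
  by rewrite dir_expi// -expi_mulrn -{1}(gez0_abs h0).
rewrite dir_expi// -expi_mulrn expi_conj -{1}(opprK h) -{1}(ltz0_abs h0).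
by rewrite rmorphN mulNr.
Qed.

End Assembly.

Theorem proposition3p9 (R : realType) (D : nat) (hD : (1 <= D)%N) :
  exists C N0 : R, [/\ 0 < C, 3 <= N0 &
    forall a : gaussInt -> R[i],
      completely_multiplicative a ->
      (forall n : gaussInt, n != 0 -> `|a n| = 1) ->
      a @` [set p | gprime p] #<= `I_D ->
      forall N : R, N0 <= N ->
        \big[Num.max/0]_(h <- fset_set (freqs (Num.floor (ln N ^+ 2))))
          ComplexField.Normc.normc
            (average (gball N)
               (fun n => a n * expi (h%:~R * carg (gaussC R n))))
        <= C * ln N `^ (- decay_exponent R D)].
Proof.
have [C [N0 [C0 N03 lN0 hmain]]] := angular_sum_bound R hD.
exists C, N0; split=> // a aM a1' aD N hN.
have a1 m : m != 0 -> nc (a m) = 1.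
  move=> m0; have := a1' m m0; rewrite normc_def => e.
  by have /complexI := e; case: (a m) => x y.
have Nge0 : 0 <= N by lra.
have lnN : 0 <= ln N by apply: le_trans lN0 _; rewrite ler_ln ?posrE; lra.
pose A := a @` [set p | gprime p].
have Afin : finite_set A by exact: card_le_finite aD (finite_II D).
pose Z : seq R[i] := fset_set A.
have memZ z : (z \in Z) = (z \in A) by rewrite in_fset_set.
have aZ p : gprime p -> a p \in Z by move=> gp; rewrite memZ; apply/mem_set; exists p.
have Zex z : z \in Z -> exists2 p, gprime p & z = a p.
  by rewrite memZ => /set_mem [p gp <-]; exists p.
have Z1 z : z \in Z -> nc z = 1 by move=> /Zex[p gp ->]; exact/a1/gprime_neq0.
have ZD : (size Z <= D)%N by rewrite -[size _]/(#|` fset_set A|) ; apply: geq_card_fset_set.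
have gI0 : gI != 0 by [].
have aI0 : a gI != 0 by rewrite -nc_eq0 a1// oner_eq0.
have ZI : perm_eq [seq a gI * z | z <- Z] Z.
  have uZ : uniq Z by exact: fset_uniq.
  have uI : uniq [seq a gI * z | z <- Z] by rewrite map_inj_uniq//; exact: mulfI.
  have sI : {subset [seq a gI * z | z <- Z] <= Z}.
    move=> _ /mapP[z /Zex[p gp ->] ->].
    have <- : a (gI * p) = a gI * a p by apply: aM => //; exact: gprime_neq0.
    by apply: aZ; have := gprime_rot 1 gp; rewrite expr1.
  by apply: uniq_perm => //; have [] := uniq_min_size uI sI; rewrite ?size_map.
(* Negative frequencies are reduced to positive ones: the sum for [a] at h is the conjugate of the
   sum for [b] at |h|, and [b] inherits all hypotheses. *)
pose b n := (a n)^*%C.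
have bM m k : m != 0 -> k != 0 -> b (m * k) = b m * b k.
  by move=> m0 k0; rewrite /b aM// rmorphM.
have b1 m : m != 0 -> nc (b m) = 1 by move=> m0; rewrite /b nc_conj a1.
pose W := [seq z^*%C | z <- Z].
have bW p : gprime p -> b p \in W by move=> gp; apply: map_f; exact: aZ.
have W1 z : z \in W -> nc z = 1 by move=> /mapP[w wZ ->]; rewrite nc_conj Z1.
have WD : (size W <= D)%N by rewrite size_map.
have WI : perm_eq [seq b gI * z | z <- W] W.
  rewrite /W -map_comp.
  have -> : [seq (fun z => b gI * z) ((fun z => z^*%C) z) | z <- Z] =
     [seq z^*%C | z <- [seq a gI * z | z <- Z]].
    by rewrite -map_comp; apply: eq_map => z /=; rewrite /b -rmorphM.
  exact: perm_map.
have ha := hmain a Z aM a1 aZ Z1 ZD ZI N.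
have hb := hmain b W bM b1 bW W1 WD WI N.
(* Required because the maximum is taken with default value 0. *)
have CN : 0 <= C * ln N `^ (- decay_exponent R D) by rewrite mulr_ge0 ?powR_ge0 ?(ltW C0).
rewrite big_seq; apply: bigmax_le => // h.
rewrite in_fset_set; last exact: finite_freqs.
move=> /set_mem /= /andP[h1 h2].
have habs : (0 < `|h|)%N by rewrite -ltz_nat abszE.
have hY : `|h|%N%:R <= ln N ^+ 2 :> R.
  apply: le_trans (floor_le_tmp (ln N ^+ 2)).
  have -> : `|h|%N%:R = `|h|%:~R :> R by rewrite -abszE.
  by rewrite ler_int.
have gpos : 0 < gcount R (Num.truncn N).
  have := gcount_ge R (Num.truncn N).
  have : 1 <= (Num.truncn N)%:R :> R by rewrite ler1n truncn_ge_nat//; lra.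
  lra.
rewrite averageE// ncM nc_real gtr0_norm ?invr_gt0// mulrC ler_pdivrMr//.
have [h0|h0] := leP 0 h.
  rewrite big_seq (eq_bigr (angular a `|h|)) -?big_seq; last first.
    by move=> n; rewrite mem_gnball gn_gt0 => /andP[n0 _]; rewrite expi_carg// h0.
  exact: ha.
rewrite big_seq (eq_bigr (fun n => (angular b `|h| n)^*%C)) -?big_seq; last first.
  move=> n; rewrite mem_gnball gn_gt0 => /andP[n0 _]; rewrite expi_carg// leNgt h0 /=.
  by rewrite /angular /b conj_mul_conj.
by rewrite -rmorph_sum nc_conj; exact: hb.
Qed.
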